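(* Let $\lambda,\mu>0$, $k\ge1$ an integer and $\nu\in(0,1)$. Let $\mathcal{L}^\nu$ be the queue length process of a $\nu$-fractional $M/E_k/1$ queue, let $M^\nu(t)=\mathbb{E}[\mathcal{L}^\nu(t)\mid\mathcal{L}^\nu(0)=0]$ and denote by $\overline{M}^\nu(v)$ its Laplace transform. Then $$M^\nu(t)=k(\lambda-\mu)\frac{t^\nu}{\Gamma(\nu+1)}+k\mu \sum_{m=1}^{+\infty}\sum_{r=0}^{+\infty}C^0_{m,r}\,t^{\gamma^M_{m,r}-1}E^{\delta^0_{m,r}}_{\nu,\gamma^M_{m,r}}(-(\lambda+k\mu)t^\nu)$$ and $$\overline{M}^\nu(v)=k(\lambda-\mu)\frac{1}{v^{\nu+1}}+k\mu \sum_{m=1}^{+\infty}\sum_{r=0}^{+\infty}C^0_{m,r}\frac{v^{\nu \delta^0_{m,r}-\gamma^M_{m,r}}}{(\lambda+k\mu+v^\nu)^{\delta^0_{m,r}}},\qquad v>0,$$ where $$C^0_{m,r}=\frac{m}{m+r(k+1)}\binom{m+r(k+1)}{m+rk}\lambda^r(k\mu)^{m+rk-1},\qquad \delta^0_{m,r}=m+r(k+1),\qquad \gamma^M_{m,r}=\nu\delta^0_{m,r}+1.$$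
   Context: Classical queue: let $\mathcal{S}^*=\{(n,s): n\ge 1,\ 1\le s\le k\}$ ($n,s$ integers) and $\mathcal{S}=\mathcal{S}^*\cup\{(0,0)\}$. The state-phase process $Q(t)=(N(t),S(t))$ of the classical $M/E_k/1$ queue ($N$ = number of customers in the system, $S$ = phase of the customer currently being served, $S=0$ if $N=0$) is the continuous-time Markov chain on $\mathcal{S}$ with transition rates: $(0,0)\to(1,k)$ at rate $\lambda$; $(n,s)\to(n+1,s)$ at rate $\lambda$ for $(n,s)\in\mathcal{S}^*$; $(n,s)\to(n,s-1)$ at rate $k\mu$ for $s\ge2$; $(n,1)\to(n-1,k)$ at rate $k\mu$ for $n\ge2$; $(1,1)\to(0,0)$ at rate $k\mu$. Fractional queue: let $\{\sigma_\nu(t)\}_{t\ge0}$ be a $\nu$-stable subordinator independent of $Q$, with $\mathbb{E}[e^{-v\sigma_\nu(t)}]=e^{-tv^\nu}$ for $v>0$, and let $L_\nu(t)=\inf\{s\ge0:\sigma_\nu(s)>t\}$. The $\nu$-fractional $M/E_k/1$ queue has state-phase process $Q^\nu(t)=(N^\nu(t),S^\nu(t)):=Q(L_\nu(t))$. Its queue length process (in phases) is $\mathcal{L}^\nu(t)=k(N^\nu(t)-1)+S^\nu(t)$ if $N^\nu(t)\neq0$ and $\mathcal{L}^\nu(t)=0$ if $N^\nu(t)=0$. Three-parameter Mittag-Leffler function: $E_{\nu,\gamma}^{\delta}(z)=\sum_{j=0}^{+\infty}\frac{\Gamma(\delta+j)\,z^j}{j!\,\Gamma(\delta)\,\Gamma(\nu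 j+\gamma)}$. *)

(* Defs.v *)
From HB Require Import structures.
From mathcomp Require Import all_boot all_order all_algebra.
From mathcomp Require Import all_classical all_reals all_analysis.

Set Implicit Arguments.
Unset Strict Implicit.
Unset Printing Implicit Defensive.

Import Order.TTheory GRing.Theory Num.Theory.
Import numFieldNormedType.Exports.

Local Open Scope classical_set_scope.
Local Open Scope ring_scope.

(* Processes are families indexed by [R] of which only the times [0 <= t]
   matter; their values at negative times are never used. *)

Section SpecialFunctions.
Context {R : realType}.
Implicit Types (nu gamma delta z : R) (f : nat -> nat -> R).

(* Euler's integral, used only for [0 < x]. *)
Definition Gamma (x : R) : R :=
  fine (\int[lebesgue_measure]_(u in `]0%R, +oo[)
          (u `^ (x - 1) * expR (- u))%:E)%E.

Definition mittag_leffler nu gamma delta z : R :=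
  limn (series (fun j : nat =>
    Gamma (delta + j%:R) * z ^+ j
      / (j`!%:R * Gamma delta * Gamma (nu * j%:R + gamma)))).

Definition laplace_transform (f : R -> \bar R) (v : R) : \bar R :=
  (\int[lebesgue_measure]_(t in `[0%R, +oo[) ((expR (- (v * t)))%:E * f t))%E.

(* sum_{m >= 1} sum_{r >= 0} f m r = l, where every inner series and the
   outer series converge in R. *)
Definition iterated_sum f (l : R) : Prop :=
  exists2 a : nat -> R,
    forall m, (1 <= m)%N -> (\sum_(0 <= r < n) f m r) @[n --> \oo] --> a m &
    (\sum_(1 <= m < n) a m) @[n --> \oo] --> l.

End SpecialFunctions.

Section Processes.
Context {d : measure_display} {T : measurableType d} {R : realType}.
Variable P : probability T R.

(* Elementary conditional expectation given an event of positive
   probability. *)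
Definition cond_expectation (X : T -> R) (A : set T) : \bar R :=
  ('E_P[fun w => (X w * \1_A w)%R] * ((fine (P A))^-1)%:E)%E.

Definition process_sigma_algebra d' (E : measurableType d')
    (X : R -> {RV P >-> E}) : set (set T) :=
  <<s \bigcup_(t in `[0, +oo[) preimage_set_system setT (X t) measurable >>.

Definition independent_processes d1 d2 (E1 : measurableType d1)
    (E2 : measurableType d2) (X : R -> {RV P >-> E1}) (Y : R -> {RV P >-> E2}) :=
  forall A B, process_sigma_algebra X A -> process_sigma_algebra Y B ->
    P (A `&` B) = (P A * P B)%E.

Section MarkovChain.
Context {d' : measure_display} {E : measurableType d'}.
Variables (S : set E) (q : E -> E -> R).

(* [q x y] is only meaningful for [x != y]; the diagonal is
   minus the total exit rate. *)
Definition rate_matrix (x y : E) : R :=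
  if x == y then - fine (\esum_(z in S `\ x) (q x z)%:E)%E else q x y.

Record transition_function (p : R -> E -> E -> R) : Prop := {
  transition_ge0 : forall t x y, 0 <= t -> S x -> S y -> 0 <= p t x y ;
  transition_sum1 : forall t x, 0 <= t -> S x ->
    (\esum_(y in S) (p t x y)%:E = 1)%E ;
  transition_0 : forall x y, S x -> S y -> p 0 x y = (x == y)%:R ;
  transition_semigroup : forall s t x y, 0 <= s -> 0 <= t -> S x -> S y ->
    ((p (s + t) x y)%:E = \esum_(z in S) (p s x z * p t z y)%:E)%E ;
  transition_rate : forall x y, S x -> S y ->
    ((p h x y - (x == y)%:R) / h) @[h --> 0^'+] --> rate_matrix x y }.

(* [ctmc_right_continuous] is right-continuity for the discrete topology on
   the state space; [ctmc_markov] is the time-homogeneous Markov property with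
   the conditioning denominators cleared. The initial law is arbitrary. *)
Record markov_chain (Q : R -> {RV P >-> E}) : Prop := {
  ctmc_state : forall t w, 0 <= t -> S (Q t w) ;
  ctmc_right_continuous : forall t w, 0 <= t ->
    \forall s \near t^'+, Q s w = Q t w ;
  ctmc_markov : exists2 p, transition_function p &
    forall (n : nat) (t : nat -> R) (x : nat -> E), 0 <= t 0%N ->
      {homo t : i j / (i <= j)%N >-> i <= j} -> (forall i, S (x i)) ->
      P [set w | forall i, (i <= n.+1)%N -> Q (t i) w = x i] =
      (P [set w | forall i, (i <= n)%N -> Q (t i) w = x i] *
       (p (t n.+1 - t n) (x n) (x n.+1))%:E)%E }.

End MarkovChain.

Record stable_subordinator (nu : R) (sigma : R -> {RV P >-> R}) : Prop := {
  subordinator_0 : forall w, sigma 0 w = 0 ;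
  subordinator_nondecreasing : forall w s t, 0 <= s -> s <= t ->
    sigma s w <= sigma t w ;
  subordinator_right_continuous : forall w t, 0 <= t ->
    sigma s w @[s --> t^'+] --> sigma t w ;
  subordinator_independent_increments :
    forall (n : nat) (t : nat -> R) (B : nat -> set R), 0 <= t 0%N ->
      {homo t : i j / (i <= j)%N >-> i <= j} -> (forall i, measurable (B i)) ->
      (P [set w | forall i, (i < n)%N -> B i (sigma (t i.+1) w - sigma (t i) w)%R]
       = \prod_(i < n) P [set w | B i (sigma (t i.+1) w - sigma (t i) w)%R])%E ;
  subordinator_stationary_increments :
    forall s h (B : set R), 0 <= s -> 0 <= h -> measurable B ->
      P [set w | B (sigma (s + h) w - sigma s w)] = P [set w | B (sigma h w)] ;
  subordinator_laplace : forall t v, 0 <= t -> 0 < v ->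
    ('E_P[fun w => expR (- (v * sigma t w))%R] =
     (expR (- (t * v `^ nu)))%:E)%E }.

(* The set below is nonempty for almost every [w]; on the exceptional null set
   [inf] returns 0. *)
Definition inverse_subordinator (sigma : R -> T -> R) (t : R) (w : T) : R :=
  inf [set s | 0 <= s /\ t < sigma s w].

End Processes.

Section ErlangQueue.
Context {d : measure_display} {T : measurableType d} {R : realType}.
Variable P : probability T R.
Variables (lambda mu nu : R) (k : nat).

(* A state is [(n, s)]: number of customers, current service phase. *)
Definition queue_states : set (nat * nat) :=
  [set x | x = (0, 0)%N \/ ((1 <= x.1)%N /\ (1 <= x.2 <= k)%N)].

(* The right-hand targets are pairwise distinct, so at most one summand is
   nonzero. *)
Definition queue_rate (x y : nat * nat) : R :=
  let: (n, s) := x in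
    lambda * ((x == (0, 0)%N) && (y == (1%N, k)))%:R
  + lambda * ((x != (0, 0)%N) && (y == (n.+1, s)))%:R
  + k%:R * mu * ((2 <= s)%N && (y == (n, s.-1)))%:R
  + k%:R * mu * [&& s == 1%N, (2 <= n)%N & y == (n.-1, k)]%:R
  + k%:R * mu * ((x == (1, 1)%N) && (y == (0, 0)%N))%:R.

Definition classical_queue (Q : R -> {RV P >-> (nat * nat)%type}) : Prop :=
  markov_chain queue_states queue_rate Q.

Definition fractional_state (Q : R -> T -> nat * nat) (sigma : R -> T -> R)
  (t : R) (w : T) : nat * nat := Q (inverse_subordinator sigma t w) w.

Definition queue_length (x : nat * nat) : nat :=
  if x.1 == 0%N then 0%N else (k * (x.1 - 1) + x.2)%N.

Definition fractional_queue_length (Q : R -> T -> nat * nat)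
    (sigma : R -> T -> R) (t : R) (w : T) : nat :=
  queue_length (fractional_state Q sigma t w).

Definition starts_empty (Q : R -> T -> nat * nat) (sigma : R -> T -> R)
  : set T := [set w | fractional_queue_length Q sigma 0 w = 0%N].

Definition mean_queue_length (Q : R -> T -> nat * nat) (sigma : R -> T -> R)
    (t : R) : \bar R :=
  cond_expectation P (fun w => (fractional_queue_length Q sigma t w)%:R)
    (starts_empty Q sigma).

Definition coefC0 (m r : nat) : R :=
  m%:R / (m + r * (k + 1))%:R * ('C(m + r * (k + 1), m + r * k))%:R
  * lambda ^+ r * (k%:R * mu) ^+ (m + r * k - 1).

Definition delta0 (m r : nat) : nat := (m + r * (k + 1))%N.

Definition gammaM (m r : nat) : R := nu * (delta0 m r)%:R + 1.

End ErlangQueue.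

(* Main.v *)
(* Code a state of the classical queue by its number of phases: the queue becomes
   a chain on the natural numbers jumping by [+k] at rate [lambda] and by [-1],
   except at [0], at rate [b = k mu].  Uniformizing at rate
   [theta = lambda + b], the mean length from the empty state at time [u] is
   [(k lambda - b) u + b \sum_j w_j \int_0^u (s^j / j!) e^(- theta s) ds], where
   [w_j] is the total weight of the [j]-step walks from [0] to [0]; the ballot
   theorem expands [w_j] into the coefficients [C^0_(m,r)] with
   [m + r (k + 1) = j + 1].  The fractional queue replaces [u] by the independent
   time [L_nu(t)], and the mean of [\int_0^(L_nu(t)) phi] is
   [\int phi(s) P(sigma_nu(s) <= t) ds], whose Laplace transform in [t] is
   [v^-1 \int phi(s) e^(- s v^nu) ds].  This gives the transform of the mean
   length.  For [phi(s) = s^j / j!], uniqueness of Laplace transforms gives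
   [t^(nu (j + 1)) / Gamma(nu (j + 1) + 1)], and expanding [e^(- theta s)] turns
   these moments into Mittag-Leffler functions. *)

Require Import Defs.
From HB Require Import structures.
From mathcomp Require Import all_boot all_order all_algebra.
From mathcomp Require Import all_classical all_reals all_analysis.
From mathcomp Require Import measurable_realfun.
From mathcomp Require Import ring lra zify.

Set Implicit Arguments.
Unset Strict Implicit.
Unset Printing Implicit Defensive.

Import Order.TTheory GRing.Theory Num.Theory.
Import numFieldNormedType.Exports.

Local Open Scope classical_set_scope.
Local Open Scope ring_scope.

(** The hypotheses on the chain give only its semigroup and its rates at time [0], so the
    uniformized series has to be derived: the backward equation holds because each state has at most
    two jump targets, and a Taylor remainder of order [(theta t) ^ n / n!] identifies the transition
    probabilities. The mean rests on one computation: a step turns the function [l] into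
    [theta l + (k lambda - b)], plus [b] at [l = 0], where the down-step is lost. As [k lambda - b]
    may be negative, sums in the extended reals keep the [b] term on the left, and subtraction waits
    for finiteness, which follows from [w_j <= theta ^ j] and the fact that Poisson probabilities
    sum to [1]. At the random time [L_nu(t)] the law of the queue is obtained from dyadic times that
    approach it from the right and depend on the subordinator alone, so that independence and right
    continuity combine. The Mittag-Leffler series alternates; its termwise integration is dominated
    with [e^(theta s)] in place of [e^(- theta s)], which is integrable because
    [P(sigma_nu(s) <= t)] decays faster than any exponential in [s]. *)

Section SeriesFacts.
Context {R : realType}.
Implicit Types (u : nat -> R) (l : R).

Lemma nneseries_cvg u l : (forall n, 0 <= u n) ->
  (\sum_(n <oo) (u n)%:E = l%:E)%E -> series u @ \oo --> l.
Proof.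
move=> u0 ul.
have : (\sum_(0 <= k < n) (u k)%:E)%E @[n --> \oo] --> l%:E.
  by rewrite -ul; apply: is_cvg_nneseries => n _ _; rewrite lee_fin.
under eq_fun do rewrite sumEFin.
by move=> /fine_cvgP[].
Qed.

Lemma cvg_nneseries u l : series u @ \oo --> l ->
  (\sum_(n <oo) (u n)%:E = l%:E)%E.
Proof.
move=> ul; apply/cvg_lim => //.
under eq_fun do rewrite sumEFin.
by apply: cvg_EFin => //; exact: nearW.
Qed.

Lemma nneseries_finite (a : nat -> \bar R) N :
  (forall n, (N <= n)%N -> a n = 0%E) ->
  (\sum_(n <oo) a n = \sum_(n < N) a n)%E.
Proof.
move=> a0; apply/cvg_lim => //; apply: cvg_near_cst.
near=> n; have Nn : (N <= n)%N by near: n; exact: nbhs_infty_ge.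
rewrite (@big_cat_nat _ _ _ N)//= [X in (_ + X)%E]big1_seq ?adde0 ?big_mkord//.
by move=> i /=; rewrite mem_index_iota => /andP[+ _]; exact: a0.
Unshelve. all: by end_near. Qed.

Lemma nneseries_single (a : nat -> \bar R) N :
  (forall n, n != N -> a n = 0%E) -> (\sum_(n <oo) a n = a N)%E.
Proof.
move=> a0; rewrite (@nneseries_finite _ N.+1); last first.
  by move=> n Nn; apply: a0; rewrite neq_ltn Nn orbT.
rewrite big_ord_recr/= big1 ?add0e// => i _.
by apply: a0; rewrite neq_ltn ltn_ord.
Qed.

End SeriesFacts.

(** * The walk with steps [+k] and [-1] *)

Section BulkWalk.
Context {R : realType}.
Variables (a b : R) (k : nat).

(* Since [0.-1 = 0], a down-step at [0] stays put, so that the steps from every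
   [i] have total weight [a + b]. *)
Definition walk_step (g : nat -> R) (i : nat) : R := a * g (i + k)%N + b * g i.-1.

Definition return_weight (n : nat) : R :=
  iter n walk_step (fun j => (j == 0)%N%:R) 0%N.

(** With steps [+k] and [-1] and a floor at [0], a walk from [i] ends at [0] exactly when [i] plus
    the total of the steps is at most [0] and no final segment of the steps has a positive sum. The
    second condition does not involve [i], which is why one count serves all starting points. *)
Definition ballot (n r : nat) : R :=
  'C(n, r)%:R - k%:R * (if r is r'.+1 then 'C(n, r')%:R else 0).

Lemma ballotS n r : ballot n.+1 r.+1 = ballot n r.+1 + ballot n r.
Proof.
case: r => [|r]; rewrite /ballot !binS !natrD ?bin0; ring.
Qed.

Lemma ballot0 n : ballot n 0 = 1.
Proof. by rewrite /ballot bin0 mulr0 subr0. Qed.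

(** The boundary condition of the recursion: a down-step at [0] stays there, so the constraints
    [r * k.+1 <= n] and [r * k.+1 <= n.+1] have to select the same nonzero terms. *)
Lemma ballot_eq0 n r : (r * k.+1 = n.+1)%N -> ballot n r = 0.
Proof.
case: r => [//|r] nE.
have h : (r.+1 * 'C(n, r.+1) = r.+1 * (k * 'C(n, r)))%N.
  by rewrite mul_bin_left mulnA; congr (_ * _)%N; nia.
have /eqP := h; rewrite eqn_mul2l/= => /eqP {}h.
by rewrite /ballot h natrM subrr.
Qed.

(** The hitting-time form of the ballot theorem: [m] is the net descent of [n.+1] steps of which [r]
    go up, and the right-hand side counts the sequences that first descend by [m] at the last step.
    It has the shape of [coefC0]. *)
Lemma ballotE n r m : (n.+1 = m + r * (k + 1))%N ->
  ballot n r = m%:R / n.+1%:R * 'C(n.+1, r)%:R.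
Proof.
move=> nE; have n0 : n.+1%:R != 0 :> R by rewrite pnatr_eq0.
have mE : m%:R = n.+1%:R - r%:R * (k%:R + 1) :> R.
  by rewrite nE natrD natrM natrD; ring.
case: r => [|r] in nE mE *.
  by rewrite ballot0 bin0 mE mul0r subr0 mulr1 divff.
have d1 : n.+1%:R * 'C(n, r)%:R = r.+1%:R * 'C(n.+1, r.+1)%:R :> R.
  by rewrite -!natrM (mul_bin_diag n.+1 r).
apply: (mulfI n0); rewrite mulrA (mulrCA n.+1%:R) mulfV// mulr1.
rewrite /ballot mulrBr mulrCA d1 mE.
have -> : 'C(n, r.+1)%:R = 'C(n.+1, r.+1)%:R - 'C(n, r)%:R :> R.
  by rewrite binS natrD addrK.
rewrite mulrBr d1; ring.
Qed.

(* The weight of the [n]-step paths from [i] to [0], a path with [r] up-steps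
   weighing [a ^ r * b ^ (n - r)]; [ballot n r] counts the paths from [0]. *)
Lemma iter_walk_step n i : iter n walk_step (fun j => (j == 0)%N%:R) i =
  \sum_(r < n.+1)
    (i + r * k.+1 <= n)%N%:R * ballot n r * a ^+ r * b ^+ (n - r).
Proof.
elim: n i => [|n IH] i.
  by rewrite big_ord1/= mul0n addn0 ballot0 leqn0 !expr0 !mulr1.
rewrite iterS /walk_step !IH !mulr_sumr.
pose u r := a * ((i + k + r * k.+1 <= n)%N%:R * ballot n r * a ^+ r * b ^+ (n - r)).
pose v r := b * ((i.-1 + r * k.+1 <= n)%N%:R * ballot n r * a ^+ r * b ^+ (n - r)).
(* A first step up uses one of the up-steps, hence the shift of the index. *)
have -> : \sum_(r < n.+1) u r = \sum_(r < n.+2) if (r : nat) is r'.+1 then u r' else 0.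
  by rewrite [RHS]big_ord_recl/= add0r; apply: eq_bigr.
have -> : \sum_(r < n.+1) v r = \sum_(r < n.+2) v r.
  rewrite [RHS]big_ord_recr/= [X in _ + X](_ : _ = 0) ?addr0// /v.
  by rewrite (_ : (_ <= n)%N = false) ?mul0r ?mulr0//; nia.
rewrite -big_split/=; apply: eq_bigr => -[r /= rn] _.
have vE : v r = (i + r * k.+1 <= n.+1)%N%:R * ballot n r * a ^+ r * b ^+ (n.+1 - r).
  rewrite /v; have [h|h] := eqVneq (r * k.+1)%N n.+1.
    by rewrite ballot_eq0//; ring.
  have -> : (i.-1 + r * k.+1 <= n)%N = (i + r * k.+1 <= n.+1)%N by lia.
  have [rn1|rn1] := ltnP r n.+1; first by rewrite subSn// exprS; ring.
  by rewrite (_ : (_ <= _)%N = false) ?mul0r ?mulr0//; nia.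
rewrite {}vE; case: r rn => [|r] rn; first by rewrite !ballot0 add0r.
rewrite /u ballotS subSS exprS.
have -> : (i + k + r * k.+1 <= n)%N = (i + r.+1 * k.+1 <= n.+1)%N by lia.
ring.
Qed.

End BulkWalk.

(** * From return weights to the double series *)

Section Regroup.
Context {R : realType}.
Variables (lambda mu : R) (k : nat).
Hypotheses (lambda_gt0 : 0 < lambda) (mu_gt0 : 0 < mu).

Lemma coefC0_ge0 m r : 0 <= coefC0 lambda mu k m r.
Proof.
by rewrite /coefC0 !mulr_ge0// ?invr_ge0 ?exprn_ge0 ?mulr_ge0// ltW.
Qed.

Lemma return_weightE n : return_weight lambda (k%:R * mu) k n = \sum_(r < n.+1)
  (r * (k + 1) <= n)%N%:R * coefC0 lambda mu k (n.+1 - r * (k + 1)) r.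
Proof.
rewrite /return_weight iter_walk_step; apply: eq_bigr => -[r /= _] _.
rewrite addn1 add0n; have [rn|] := leqP; last by rewrite !mul0r.
have nE : (n.+1 = (n.+1 - r * k.+1) + r * (k + 1))%N by lia.
rewrite !mul1r /coefC0 -nE (ballotE nE).
have -> : (n.+1 - r * k.+1 + r * k = n.+1 - r)%N by nia.
have -> : (n.+1 - r - 1 = n - r)%N by lia.
rewrite bin_sub//; nia.
Qed.

(** For [m >= 1] and [r] exactly one [j] satisfies [j.+1 = m + r * (k + 1)], so for nonnegative
    terms this is Tonelli for series; finiteness of the total makes every inner series converge in
    [R]. *)
Lemma iterated_sum_regroup (G : nat -> R) (s : R) : (forall j, 0 <= G j) ->
  (\sum_(j <oo) (return_weight lambda (k%:R * mu) k j * G j)%:E = s%:E)%E ->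
  iterated_sum (fun m r => coefC0 lambda mu k m r * G (delta0 k m r).-1) s.
Proof.
move=> G0 Gs.
(* Series over [nat] start at [0]: the factor removes the row [m = 0], in which [delta0] can vanish
   and [.-1] would not undo a successor. *)
pose c (m r : nat) : R := (m != 0)%N%:R * (coefC0 lambda mu k m r * G (delta0 k m r).-1).
have c0 m r : 0 <= c m r by apply: mulr_ge0 => //; apply: mulr_ge0 (coefC0_ge0 _ _) _.
have cs : (\sum_(m <oo) \sum_(r <oo) (c m r)%:E = s%:E)%E.
  (* An indicator sum over [j] puts the three indices on the same footing, ready for interchange. *)
  transitivity (\sum_(m <oo) \sum_(r <oo) \sum_(j <oo)
      ((j.+1 == delta0 k m r)%N%:R * c m r)%:E)%E.
    apply: eq_eseriesr => m _; apply: eq_eseriesr => r _.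
    rewrite (@nneseries_single _ _ (delta0 k m r).-1); last first.
      by move=> j jE; rewrite (_ : (_ == _) = false) ?mul0r//; lia.
    have [->|m0] := eqVneq m 0%N; first by rewrite /c eqxx !mul0r mulr0.
    by rewrite prednK ?eqxx ?mul1r// /delta0; lia.
  have d0 m r j : (0 <= ((j.+1 == delta0 k m r)%N%:R * c m r)%:E)%E.
    by rewrite lee_fin; exact: mulr_ge0.
  under eq_eseriesr => m _ do rewrite nneseries_interchange//.
  rewrite nneseries_interchange; last first.
    move=> m j; apply: nneseries_ge0 => r _ _.
    exact: d0.
  rewrite -Gs; apply: eq_eseriesr => j _.
  rewrite nneseries_interchange; last by move=> m r; exact: d0.
  transitivity (\sum_(r <oo) ((r * (k + 1) <= j)%N%:R *
      coefC0 lambda mu k (j.+1 - r * (k + 1)) r * G j)%:E)%E.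
    apply: eq_eseriesr => r _.
    rewrite (@nneseries_single _ _ (j.+1 - r * (k + 1))%N); last first.
      move=> m mE; rewrite /c; have [->|m0] := eqVneq m 0%N.
        by rewrite !mul0r mulr0.
      by rewrite /delta0 (_ : (_ == _) = false) ?mul0r//; lia.
    rewrite /c /delta0; have [rj|rj] := leqP (r * (k + 1)) j.
      have -> : (j.+1 - r * (k + 1) + r * (k + 1) = j.+1)%N by lia.
      rewrite eqxx (_ : _ != 0)%N ?mul1r//; lia.
    rewrite [in LHS](_ : (j.+1 - r * (k + 1) = 0)%N) ?eqxx ?mul0r ?mulr0//; lia.
  rewrite (@nneseries_finite _ _ j.+1); last first.
    move=> r jr; rewrite (_ : (_ <= _)%N = false) ?mul0r//; nia.
  by rewrite return_weightE mulr_suml -sumEFin.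
have s_fin m : (\sum_(r <oo) (c m r)%:E)%E \is a fin_num.
  rewrite ge0_fin_numE; last by apply: nneseries_ge0 => r _ _; rewrite lee_fin.
  apply: (@le_lt_trans _ _ s%:E); last exact: ltry.
  rewrite -cs [leRHS](@nneseriesD1 _ _ m)//; last first.
    by move=> n _; apply: nneseries_ge0 => r _ _; rewrite lee_fin.
  apply: leeDl; apply: nneseries_ge0 => n _ _.
  by apply: nneseries_ge0 => r _ _; rewrite lee_fin.
pose A m := fine (\sum_(r <oo) (c m r)%:E)%E.
have A0 m : 0 <= A m.
  by apply: fine_ge0; apply: nneseries_ge0 => r _ _; rewrite lee_fin.
exists A => [m m1|].
  have := @nneseries_cvg _ (c m) (A m) (c0 m); rewrite /A fineK// => /(_ erefl).
  rewrite /series/= /c -lt0n m1.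
  by under eq_fun do under eq_bigr do rewrite mul1r.
have sA : (\sum_(m <oo) (A m)%:E = s%:E)%E.
  by rewrite -cs; apply: eq_eseriesr => m _; rewrite /A fineK.
have A00 : A 0%N = 0.
  by rewrite /A eseries0// => r _ _; rewrite /c eqxx mul0r.
have := nneseries_cvg A0 sA; rewrite /series/= => As.
apply: cvg_trans As; apply: near_eq_cvg; near=> n.
rewrite [LHS]big_ltn ?A00 ?add0r//.
by near: n; exact: nbhs_infty_gt.
Unshelve. all: by end_near. Qed.

End Regroup.

(** * Transition functions of a queue counted in phases *)

Lemma cvg_sum_seq {R : realType} {T I : Type} (F : set_system T) {FF : Filter F}
    (r : seq I) (f : I -> T -> R) (l : I -> R) :
  (forall i, f i x @[x --> F] --> l i) ->
  \sum_(i <- r) f i x @[x --> F] --> \sum_(i <- r) l i.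
Proof.
move=> fl; elim: r => [|i r IH].
  by rewrite big_nil; under eq_cvg do rewrite big_nil; exact: cvg_cst.
by rewrite big_cons; under eq_cvg do rewrite big_cons; exact: cvgD.
Qed.

Section WeightedMean.
Context {R : realType}.
Variables (f g : nat -> R) (c : R).
Hypotheses (f_ge0 : forall n, 0 <= f n) (g_ge0 : forall n, 0 <= g n).
Hypothesis g_le1 : forall n, g n <= 1.
Hypothesis f_sum1 : (\sum_(n <oo) (f n)%:E = 1)%E.
Hypothesis fg_sum : (\sum_(n <oo) (f n * g n)%:E = c%:E)%E.

Lemma sum_seq_le_nneseries (h : nat -> R) (l : R) (s : seq nat) : uniq s ->
  (forall n, 0 <= h n) -> (\sum_(n <oo) (h n)%:E = l%:E)%E ->
  \sum_(z <- s) h z <= l.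
Proof.
move=> us h0 hl; rewrite -lee_fin -hl nneseries_esumT; last first.
  by move=> n; rewrite lee_fin.
apply: esum_ge; exists [set` s]; first by split => //; exact: finite_seq.
by rewrite -fsbig_seq// -sumEFin.
Qed.

(** As [0 <= g <= 1], the indices outside [s] contribute between [0] and the mass that [f] gives
    them. *)
Lemma weighted_mean_seq (s : seq nat) : uniq s ->
  0 <= c - \sum_(z <- s) f z * g z <= 1 - \sum_(z <- s) f z.
Proof.
move=> us; apply/andP; split.
  by rewrite subr_ge0; apply: sum_seq_le_nneseries => // n; rewrite mulr_ge0.
have h n : 0 <= f n * (1 - g n) by rewrite mulr_ge0// subr_ge0.
have hs : (\sum_(n <oo) (f n * (1 - g n))%:E = (1 - c)%:E)%E.
  have : (\sum_(n <oo) (f n * (1 - g n))%:E + c%:E = 1)%E.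
    rewrite -f_sum1 -fg_sum -nneseriesD.
    - by apply: eq_eseriesr => n _; rewrite -EFinD; congr EFin; ring.
    - by move=> n _ _; rewrite lee_fin.
    - by move=> n _ _; rewrite lee_fin mulr_ge0.
  by case: (\sum_(_ <oo) _)%E => [x [<-]| |]//; rewrite addrK.
have := sum_seq_le_nneseries us h hs.
under eq_bigr do rewrite mulrBr mulr1.
rewrite big_split/= sumrN; lra.
Qed.

End WeightedMean.

Section ChainDerivative.
Context {R : realType}.
Variables (a b : R) (k : nat) (p : R -> nat -> nat -> R).
Hypothesis p_ge0 : forall (t : R) i j, 0 <= t -> 0 <= p t i j.
Hypothesis p_sum1 : forall (t : R) i, 0 <= t -> (\sum_(j <oo) (p t i j)%:E = 1)%E.
Hypothesis p_semigroup : forall (s t : R) i j, 0 <= s -> 0 <= t ->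
  ((p (s + t) i j)%:E = \sum_(z <oo) (p s i z * p t z j)%:E)%E.
Hypothesis p_rate : forall i j, ((p h i j - (i == j)%:R) / h) @[h --> (0 : R)^'+] -->
  a * (j == i + k)%N%:R + b * (j == i.-1)%:R - (a + b) * (i == j)%:R.

Lemma chain_le1 (t : R) i j : 0 <= t -> p t i j <= 1.
Proof.
move=> t0; have := @sum_seq_le_nneseries _ (p t i) 1 [:: j] isT.
by rewrite big_seq1; apply=> [n|]; [exact: p_ge0|exact: p_sum1].
Qed.

(** The semigroup with the short time [h] first: the states outside the finite list [r] contribute
    at most the probability of having moved there. This replaces any exchange of a limit with an
    infinite sum. *)
Lemma chain_increment (s h : R) i j (r : seq nat) : 0 <= s -> 0 <= h -> uniq r ->
  0 <= p (s + h) i j - \sum_(z <- r) p h i z * p s z j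
    <= 1 - \sum_(z <- r) p h i z.
Proof.
move=> s0 h0 ur; apply: weighted_mean_seq => //.
- by move=> n; exact: p_ge0.
- by move=> n; exact: p_ge0.
- by move=> n; exact: chain_le1.
- exact: p_sum1.
- by rewrite addrC p_semigroup.
Qed.

(** Taking the starting state alone as list gives a modulus of continuity that is uniform in [s] and
    [j]. *)
Lemma chain_modulus (s h : R) i j : 0 <= s -> 0 <= h ->
  `|p (s + h) i j - p s i j| <= 1 - p h i i.
Proof.
move=> s0 h0; have := @chain_increment s h i j [:: i] s0 h0 isT.
rewrite !big_seq1; have := p_ge0 i j s0; have := chain_le1 i j s0.
have := chain_le1 i i h0; have := p_ge0 i i h0.
by rewrite ler_norml => ? ? ? ? /andP[? ?]; nra.
Qed.

Lemma cvg_chain_diag i : p h i i @[h --> (0 : R)^'+] --> (1 : R).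
Proof.
have h0 : h @[h --> (0 : R)^'+] --> (0 : R) by apply: cvg_at_right_filter; exact: cvg_id.
have : 1 + (p h i i - (i == i)%:R) / h * h @[h --> (0 : R)^'+] --> (1 : R).
  rewrite -[X in _ --> X]addr0 -[X in _ --> _ + X](mulr0 (a * (i == (i + k)%N)%:R
    + b * (i == i.-1)%:R - (a + b) * (i == i)%:R)).
  by apply: cvgD; [exact: cvg_cst|apply: cvgM => //; exact: p_rate].
apply: cvg_trans; apply: near_eq_cvg; near=> h.
rewrite eqxx /= divfK; first by rewrite addrC subrK.
by apply: lt0r_neq0; near: h; exact: nbhs_right_gt.
Unshelve. all: by end_near. Qed.

Lemma cvg_norm_at_right : `|h| @[h --> (0 : R)^'] --> (0 : R)^'+.
Proof.
move=> A [e /= e0 eA].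
exists e => //= h; rewrite /= sub0r normrN => he h0; apply: eA => /=.
  by rewrite sub0r normrN normr_id.
by rewrite normr_gt0.
Qed.

(** The backward equation. The list [r] contains all jump targets of [i], so its rates sum to [0]
    and the error left by the other states is [o(h)]. The rates are one-sided limits at time [0]; a
    negative [h] is treated as a positive increment started from [t + h]. *)
Lemma chain_derive (t : R) (i j : nat) : 0 < t -> is_derive t 1 (fun t => p t i j)
  (a * p t (i + k)%N j + b * p t i.-1 j - (a + b) * p t i j).
Proof.
move=> t0.
(* [undup], because [i.-1 = i] when [i = 0] and the increment estimate wants distinct states. *)
pose r := undup [:: i; (i + k)%N; i.-1].
have ur : uniq r by exact: undup_uniq.
have ri : i \in r by rewrite mem_undup !inE eqxx.
have ru : (i + k)%N \in r by rewrite mem_undup !inE eqxx orbT.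
have rd : i.-1 \in r by rewrite mem_undup !inE eqxx !orbT.
have sum_pick x (F : nat -> R) : x \in r -> \sum_(z <- r) (z == x)%:R * F z = F x.
  move=> xr; rewrite (bigD1_seq x)//= eqxx mul1r big1 ?addr0// => z /negbTE ->.
  by rewrite mul0r.
pose rho z := a * (z == i + k)%N%:R + b * (z == i.-1)%:R - (a + b) * (i == z)%:R.
have rhoE F : \sum_(z <- r) rho z * F z = a * F (i + k)%N + b * F i.-1 - (a + b) * F i.
  rewrite -(sum_pick _ F ru) -(sum_pick _ F rd) -(sum_pick _ F ri).
  rewrite !mulr_sumr -sumrN -!big_split/=; apply: eq_bigr => z _.
  by rewrite /rho (eq_sym i); ring.
pose u (g : R) z := (p g i z - (i == z)%:R) / g.
(* The minimum is the earlier of the two times, where the increment starts for either sign of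
   [h]. *)
pose q (h : R) z := p (Num.min t (t + h)) z j.
have cvg_u z : u `|h| z @[h --> (0 : R)^'] --> rho z.
  exact: (cvg_comp _ _ cvg_norm_at_right (@p_rate i z)).
have near_h : \forall h \near (0 : R)^', `|h| < t.
  have [e e0 H] : \forall h \near (0 : R)^'+, h < t by exact: nbhs_right_lt.
  exists e => // h; rewrite /ball_ /= sub0r normrN => he h0; apply: H.
    by rewrite /= sub0r normrN normr_id.
  by rewrite normr_gt0.
have cvg_d z : p `|h| z z @[h --> (0 : R)^'] --> (1 : R).
  exact: (cvg_comp _ _ cvg_norm_at_right (@cvg_chain_diag z)).
have minP h : `|h| < t -> 0 <= Num.min t (t + h) /\
    ((h < 0 -> Num.min t (t + h) = t + h) /\ (0 <= h -> Num.min t (t + h) = t)).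
  move=> ht; have [h0|h0] := ltP h 0.
    rewrite min_r; last lra.
    by move: ht; rewrite ltr0_norm// => ht; split; [lra|split => //; lra].
  by rewrite min_l; [split; [lra|split => //; lra]|lra].
have cvg_q z : q h z @[h --> (0 : R)^'] --> p t z j.
  apply/cvgrPdist_lt => e e0.
  have /cvgrPdist_lt/(_ e e0) H := cvg_d z.
  near=> h; have ht : `|h| < t by near: h.
  have [q0 [q1 q2]] := minP h ht.
  have He : `|1 - p `|h| z z| < e by near: h.
  apply: le_lt_trans (le_lt_trans (ler_norm _) He).
  rewrite /q; have [h0|h0] := ltP h 0.
    have := chain_modulus z j q0 (normr_ge0 h).
    by rewrite q1// (ltr0_norm h0) addrK.
  by rewrite q2// subrr normr0 subr_ge0; exact: chain_le1.
pose E (h : R) := (p (t + h) i j - p t i j) / h - \sum_(z <- r) u `|h| z * q h z.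
have EB h : h != 0 -> `|h| < t -> 0 <= E h <= - \sum_(z <- r) u `|h| z.
  move=> h0 ht; have [q0 [q1 q2]] := minP h ht.
  have g0 : 0 < `|h| by rewrite normr_gt0.
  have := @chain_increment _ _ i j r q0 (normr_ge0 h) ur.
  have -> : E h = (p (Num.min t (t + h) + `|h|) i j -
      \sum_(z <- r) p `|h| i z * q h z) / `|h|.
    rewrite /E /q; have -> : (p (t + h) i j - p t i j) / h =
        (p (Num.min t (t + h) + `|h|) i j - q h i) / `|h|.
      rewrite /q; have [hn|hp] := ltP h 0.
        by rewrite q1// (ltr0_norm hn) addrK invrN mulrN -mulNr opprB.
      by rewrite q2// ger0_norm.
    rewrite -(sum_pick i (q h) ri) mulrBl mulrBl !mulr_suml -addrA -opprD.
    rewrite -big_split/=; congr (_ - _); apply: eq_bigr => z _.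
    by rewrite /u /q (eq_sym z); ring.
  have -> : - \sum_(z <- r) u `|h| z = (1 - \sum_(z <- r) p `|h| i z) / `|h|.
    rewrite -[X in (X - _) / _](sum_pick i (fun=> 1) ri) mulrBl !mulr_suml -!sumrN.
    rewrite -big_split/=; apply: eq_bigr => z _.
    by rewrite /u mulr1 (eq_sym z); ring.
  by move=> /andP[h1 h2]; rewrite divr_ge0//= ler_pM2r ?invr_gt0.
have cvg_S : \sum_(z <- r) u `|h| z @[h --> (0 : R)^'] --> (0 : R).
  have rho0 : \sum_(z <- r) rho z = 0.
    by under eq_bigr do rewrite -[rho _]mulr1; rewrite rhoE; ring.
  by rewrite -[X in _ --> X]rho0; apply: cvg_sum_seq => z; exact: cvg_u.
have cvg_E : E h @[h --> (0 : R)^'] --> (0 : R).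
  apply: (@squeeze_cvgr _ _ _ _ (cst 0) (fun h => - \sum_(z <- r) u `|h| z)).
  - near=> h; apply: EB; last by near: h.
    by near: h; exact: nbhs_dnbhs_neq.
  - exact: cvg_cst.
  - by rewrite -[X in _ --> X]oppr0; exact: cvgN.
have H : (p (t + h) i j - p t i j) / h @[h --> (0 : R)^'] -->
    a * p t (i + k)%N j + b * p t i.-1 j - (a + b) * p t i j.
  rewrite -(rhoE (p t ^~ j)) -[X in _ --> X]add0r.
  have -> : (fun h => (p (t + h) i j - p t i j) / h) =
      E \+ (fun h => \sum_(z <- r) u `|h| z * q h z).
    by apply/funext => h; rewrite /E /= subrK.
  apply: cvgD => //; apply: cvg_sum_seq => z; apply: cvgM; [exact: cvg_u|exact: cvg_q].
have H' : h^-1 *: (p (h *: (1 : R) + t) i j - p t i j) @[h --> (0 : R)^'] -->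
    a * p t (i + k)%N j + b * p t i.-1 j - (a + b) * p t i j.
  apply: cvg_trans H; apply: near_eq_cvg; apply: nearW => h.
  by rewrite /GRing.scale/= mulr1 (addrC h) mulrC.
apply: DeriveDef; first by apply/cvg_ex; eexists; exact: H'.
by apply/cvg_lim => //; exact: H'.
Unshelve. all: by end_near. Qed.

End ChainDerivative.

Lemma is_derive_cvg {R : realType} (f : R -> R) (x l : R) :
  is_derive x 1 f l -> f y @[y --> x] --> f x.
Proof.
by move=> [df _]; apply: differentiable_continuous; apply/derivable1_diffP.
Qed.

(** The mean value theorem for [g - f] and [g + f]; at [0] only limits from the right are assumed,
    as the backward equation is available for positive times. *)
Lemma derive_bound_le {R : realType} (f g f' g' : R -> R) (t : R) : 0 < t ->
  (forall x : R, 0 < x -> is_derive x 1 f (f' x)) ->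
  (forall x : R, 0 < x -> is_derive x 1 g (g' x)) ->
  f x @[x --> (0 : R)^'+] --> f 0 -> g x @[x --> (0 : R)^'+] --> g 0 ->
  f 0 = 0 -> g 0 = 0 ->
  (forall x : R, 0 < x -> x < t -> `|f' x| <= g' x) -> `|f t| <= g t.
Proof.
move=> t0 df dg cf cg f0 g0 fg.
have cont (h h' : R -> R) : (forall x : R, 0 < x -> is_derive x 1 h (h' x)) ->
    h x @[x --> (0 : R)^'+] --> h 0 -> {within `[0, t], continuous h}.
  move=> dh ch.
  have hc (x : R) : 0 < x -> h @ x --> h x.
    by move=> x0; exact: is_derive_cvg (dh _ x0).
  apply/continuous_within_itvP => //; split => //.
    by move=> x; rewrite in_itv/= => /andP[x0 _]; exact: hc.
  by apply: cvg_at_left_filter; exact: hc.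
have key (s : R) : `|s| = 1 -> s * f t <= g t.
  move=> s1.
  have dh (x : R) : 0 < x -> is_derive x 1 (g - s \*: f) (g' x - s * f' x).
    move=> x0; have := df _ x0; have := dg _ x0 => ? ?.
    by apply: is_derive_eq.
  have ch : (g - s \*: f) x @[x --> (0 : R)^'+] --> (g - s \*: f) 0.
    by apply: cvgB => //; exact: cvgZr.
  have [x] := MVT t0 (fun x xt => dh x (andP xt).1) (cont _ _ dh ch).
  rewrite in_itv/= => /andP[x0 xt]; rewrite subr0.
  have -> : (g - s \*: f) t = g t - s * f t by [].
  have -> : (g - s \*: f) 0 = 0 by rewrite !fctE/= f0 g0 scaler0 subr0.
  rewrite subr0 => gE; rewrite -subr_ge0 gE; apply: mulr_ge0; last exact: ltW.
  rewrite subr_ge0.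
  rewrite (le_trans (ler_norm _))// normrM s1 mul1r; exact: fg.
have := key 1 (normr1 _); have := key (-1) (normrN1 _).
by rewrite mulN1r mul1r ler_norml => ? ->; rewrite lerNl andbT.
Qed.

(** * Uniformization: power series of the transition probabilities *)

Section ChainTaylor.
Context {R : realType}.
Variables (a b : R) (k : nat) (p : R -> nat -> nat -> R).
Hypotheses (a_ge0 : 0 <= a) (b_ge0 : 0 <= b).
Hypothesis p_ge0 : forall (t : R) i j, 0 <= t -> 0 <= p t i j.
Hypothesis p_sum1 : forall (t : R) i, 0 <= t -> (\sum_(j <oo) (p t i j)%:E = 1)%E.
Hypothesis p_0 : forall i j, p 0 i j = (i == j)%:R.
Hypothesis p_semigroup : forall (s t : R) i j, 0 <= s -> 0 <= t ->
  ((p (s + t) i j)%:E = \sum_(z <oo) (p s i z * p t z j)%:E)%E.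
Hypothesis p_rate : forall i j, ((p h i j - (i == j)%:R) / h) @[h --> (0 : R)^'+] -->
  a * (j == i + k)%N%:R + b * (j == i.-1)%:R - (a + b) * (i == j)%:R.

Local Notation walk := (walk_step a b k).

Definition walk_taylor (j n : nat) (t : R) (i : nat) : R :=
  \sum_(m < n) t ^+ m / m`!%:R * iter m walk (fun l => (l == j)%:R) i.

Lemma walk_taylorS j n t i : walk_taylor j n.+1 t i =
  walk_taylor j n t i + t ^+ n / n`!%:R * iter n walk (fun l => (l == j)%:R) i.
Proof. by rewrite /walk_taylor big_ord_recr. Qed.

Lemma is_derive_monomial (n : nat) (c t : R) :
  is_derive t 1 (fun t : R => t ^+ n.+1 / (n.+1)`!%:R * c) (t ^+ n / n`!%:R * c).
Proof.
have -> : (fun t : R => t ^+ n.+1 / (n.+1)`!%:R * c) =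
    (c / (n.+1)`!%:R) \*: ((@id R) ^+ n.+1).
  by apply/funext => x; rewrite !fctE/= /GRing.scale/=; ring.
apply: is_derive_eq; rewrite /GRing.scale/= mulr1 factS natrM.
have : n.+1%:R != 0 :> R by rewrite pnatr_eq0.
have : n`!%:R != 0 :> R by rewrite pnatr_eq0 -lt0n fact_gt0.
by move=> ? ?; field; apply/andP.
Qed.

Lemma walk_taylor_derive j n (t : R) i :
  is_derive t 1 (fun t : R => walk_taylor j n.+1 t i) (walk (walk_taylor j n t) i).
Proof.
elim: n => [|n IH].
  have -> : (fun t : R => walk_taylor j 1 t i) = cst ((i == j)%:R).
    by apply/funext => x; rewrite /walk_taylor big_ord1 /= expr0 divr1 mul1r.
  by apply: is_derive_eq; rewrite /walk_step /walk_taylor !big_ord0 !mulr0 addr0.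
have -> : (fun t : R => walk_taylor j n.+2 t i) = (fun t : R => walk_taylor j n.+1 t i) +
    (fun t : R => t ^+ n.+1 / (n.+1)`!%:R * iter n.+1 walk (fun l => (l == j)%:R) i).
  by apply/funext => x; rewrite walk_taylorS.
have H := is_derive_monomial n (iter n.+1 walk (fun l => (l == j)%:R) i) t.
apply: is_derive_eq; rewrite iterS /walk_step !walk_taylorS; ring.
Qed.

(** The factor [expR ((a + b) * t)] cancels the diagonal of the generator, so the derivative of the
    remainder of order [n.+1] is [walk] applied to the remainder of order [n]. As [walk] has norm
    [a + b], the bound is integrated by induction; the fixed horizon [T] makes the exponential a
    constant in this integration. *)
Lemma chain_taylor_bound (T : R) j n i (t : R) : 0 <= t -> t <= T ->
  `|expR ((a + b) * t) * p t i j - walk_taylor j n t i|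
    <= expR ((a + b) * T) * ((a + b) ^+ n * (t ^+ n / n`!%:R)).
Proof.
have ab0 : 0 <= a + b by rewrite addr_ge0.
elim: n i t => [|n IH] i t t0 tT.
  rewrite /walk_taylor big_ord0 subr0 !expr0 divr1 !mulr1 ger0_norm.
    apply: (@le_trans _ _ (expR ((a + b) * t))).
      by rewrite ler_piMr ?expR_ge0//; exact: (chain_le1 p_ge0 p_sum1).
    by rewrite ler_expR ler_wpM2l.
  by rewrite mulr_ge0 ?expR_ge0// p_ge0.
have taylor0 m l : walk_taylor j m.+1 0 l = (l == j)%:R.
  rewrite /walk_taylor big_ord_recl/= expr0 divr1 mul1r big1 ?addr0// => x _.
  by rewrite expr0n/= !mul0r.
move: t0; rewrite le_eqVlt => /predU1P[<-|t0].
  by rewrite taylor0 p_0 mulr0 expR0 mul1r subrr normr0 expr0n/= mul0r !mulr0.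
pose f (t : R) := expR ((a + b) * t) * p t i j - walk_taylor j n.+1 t i.
pose f' (t : R) := walk (fun l => expR ((a + b) * t) * p t l j - walk_taylor j n t l) i.
pose C := expR ((a + b) * T) * (a + b) ^+ n.+1.
rewrite [leRHS]mulrA -/C [leRHS]mulrC.
apply: (@derive_bound_le _ f (fun t : R => t ^+ n.+1 / (n.+1)`!%:R * C) f'
  (fun t : R => t ^+ n / n`!%:R * C)) => //.
- move=> x x0.
  have -> : f = (expR \o ((a + b) \*: (@id R))) * (fun t => p t i j) -
      (fun t => walk_taylor j n.+1 t i) by [].
  have H1 := chain_derive p_ge0 p_sum1 p_semigroup p_rate i j x0.
  have H2 := walk_taylor_derive j n x i.
  apply: is_derive_eq; rewrite /f' /walk_step /GRing.scale/=; ring.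
- by move=> x _; exact: is_derive_monomial.
- have cp : p x i j @[x --> (0 : R)^'+] --> p 0 i j.
    apply/cvgrPdist_lt => e e0.
    have /cvgrPdist_lt/(_ e e0) H := cvg_chain_diag p_rate i.
    near=> h; have h0 : 0 < h by [].
    have He : `|1 - p h i i| < e by near: h.
    apply: le_lt_trans (le_lt_trans (ler_norm _) He).
    have := chain_modulus p_ge0 p_sum1 p_semigroup i j (lexx 0) (ltW h0).
    by rewrite add0r distrC.
  apply: cvgB.
    apply: cvgM => //; apply: cvg_at_right_filter.
    apply: (continuous_comp (f := fun x => (a + b) * x)).
      by apply: cvgM; [exact: cvg_cst|exact: cvg_id].
    exact: continuous_expR.
  exact: cvg_at_right_filter (is_derive_cvg (walk_taylor_derive j n 0 i)).
- exact: cvg_at_right_filter (is_derive_cvg (is_derive_monomial n C 0)).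
- by rewrite /f taylor0 p_0 mulr0 expR0 mul1r subrr.
- by rewrite expr0n/= !mul0r.
- move=> x x0 xt; rewrite /f' /walk_step.
  have xT : x <= T by exact: le_trans (ltW xt) tT.
  have := IH (i + k)%N x (ltW x0) xT; have := IH i.-1 x (ltW x0) xT.
  set B := expR ((a + b) * T) * _ => h1 h2.
  have -> : x ^+ n / n`!%:R * C = a * B + b * B by rewrite /B /C exprS; ring.
  by rewrite (le_trans (ler_normD _ _))// !normrM !(ger0_norm a_ge0) (ger0_norm b_ge0)
    lerD// ler_wpM2l.
Unshelve. all: by end_near. Qed.

Lemma chain_series (t : R) i j : 0 <= t ->
  series (fun m => t ^+ m / m`!%:R * iter m walk (fun l => (l == j)%:R) i) @ \oo
    --> expR ((a + b) * t) * p t i j.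
Proof.
move=> t0; set e := expR _ * _.
have H : (expR ((a + b) * t) * ((a + b) ^+ n * (t ^+ n / n`!%:R))) @[n --> \oo] --> (0 : R).
  rewrite -[X in _ --> X](mulr0 (expR ((a + b) * t))); apply: cvgM; first exact: cvg_cst.
  have -> : (fun n => (a + b) ^+ n * (t ^+ n / n`!%:R)) = exp_coeff ((a + b) * t).
    by apply/funext => n; rewrite /exp_coeff/= exprMn mulrA.
  exact: cvg_series_cvg_0 (is_cvg_series_exp_coeff ((a + b) * t)).
apply/cvgrPdist_le => d d0; near=> n.
rewrite /series/= big_mkord (le_trans (chain_taylor_bound _ _ _ t0 (lexx t)))//.
rewrite ltW//; near: n.
by move/cvgrPdist_lt : H => /(_ d d0); apply: filterS => n;
  rewrite sub0r normrN; exact/le_lt_trans/ler_norm.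
Unshelve. all: by end_near. Qed.

End ChainTaylor.

(* The integral of [s ^ j / j! * exp (- x s)] over [0 <= s <= u]. *)
Definition erlang_mass {R : realType} (x : R) (j : nat) (u : R) : R :=
  (1 - expR (- (x * u)) * \sum_(n < j.+1) (x * u) ^+ n / n`!%:R) / x ^+ j.+1.

Lemma nneseries_exp {R : realType} (x : R) : (\sum_(n <oo) (x ^+ n / n`!%:R)%:E = (expR x)%:E)%E.
Proof. by apply: cvg_nneseries; exact: is_cvg_series_exp_coeff. Qed.

(** * Mean position of the walk and of the chain *)

Section MeanWalk.
Context {R : realType}.
Variables (a b : R) (k : nat).
Hypotheses (a_gt0 : 0 < a) (b_ge0 : 0 <= b).

Local Notation walk := (walk_step a b k).
Local Notation theta := (a + b).

Lemma iter_walk_ge0 n (f : nat -> R) i : (forall l, 0 <= f l) -> 0 <= iter n walk f i.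
Proof.
move=> f0; elim: n i => [//|n IH] i.
by rewrite iterS /walk_step addr_ge0// mulr_ge0// ltW.
Qed.

Lemma iter_walkD n (f g : nat -> R) c i :
  iter n walk (fun l => c * f l + g l) i = c * iter n walk f i + iter n walk g i.
Proof.
elim: n i => [//|n IH] i.
by rewrite !iterS {1}/walk_step !IH /walk_step; ring.
Qed.

Lemma iter_walk_cst n c i : iter n walk (fun=> c) i = theta ^+ n * c.
Proof.
elim: n i => [|n IH] i; first by rewrite expr0 mul1r.
by rewrite iterS /walk_step !IH exprS; ring.
Qed.

Definition mean_weight n : R := iter n walk (fun l => l%:R) 0%N.
Local Notation weight := (return_weight a b k).

Lemma return_weight_ge0 n : 0 <= weight n.
Proof. by apply: iter_walk_ge0 => l. Qed.

Lemma return_weight_le n : weight n <= theta ^+ n.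
Proof.
rewrite -[leRHS]mulr1 -(iter_walk_cst n 1 0) -subr_ge0.
have := iter_walkD n (fun l => (l == 0)%N%:R) (fun=> 1) (-1) 0.
rewrite mulN1r addrC => <-; apply: iter_walk_ge0 => l.
by case: (l == 0)%N => /=; lra.
Qed.

Lemma mean_weight_ge0 n : 0 <= mean_weight n.
Proof. by apply: iter_walk_ge0 => l. Qed.

(** Conditioning on the last step: its drift is [a k - b], against the total weight [theta ^ n],
    except that at [0] the down-step moves nothing, which gives back [b] times the return weight. *)
Lemma mean_weightS n : mean_weight n.+1 =
  theta * mean_weight n + (a * k%:R - b) * theta ^+ n + b * weight n.
Proof.
rewrite /mean_weight iterSr.
have -> : walk (fun l => l%:R) = (fun l => theta * l%:R +
    (b * (l == 0)%N%:R + (a * k%:R - b))).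
  apply/funext => -[|l]; rewrite /walk_step/= natrD; first ring.
  by rewrite -(natr1 l); ring.
rewrite iter_walkD iter_walkD iter_walk_cst /return_weight; ring.
Qed.

(** The recursion solved, with the negative part [b] of the drift on the left, so that both sides
    consist of nonnegative terms and can be summed in the extended reals. *)
Lemma mean_weightE n : mean_weight n + b * (n%:R * theta ^+ n.-1) =
  a * k%:R * (n%:R * theta ^+ n.-1)
  + b * \sum_(j < n) theta ^+ (n.-1 - j) * weight j.
Proof.
elim: n => [|n IH].
  by rewrite big_ord0 /mean_weight/= mul0r !mulr0 !addr0.
have eS : n.+1%:R * theta ^+ n = theta * (n%:R * theta ^+ n.-1) + theta ^+ n.
  case: n {IH} => [|n]; first by rewrite mul1r mul0r mulr0 add0r.
  by rewrite -(natr1 n.+1) exprS/=; ring.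
rewrite mean_weightS big_ord_recr/= subnn expr0 mul1r eS.
have -> : \sum_(i < n) theta ^+ (n - i) * weight i =
    theta * \sum_(j < n) theta ^+ (n.-1 - j) * weight j.
  rewrite mulr_sumr; apply: eq_bigr => -[i /= lin] _.
  by rewrite mulrA -exprS; congr (_ ^+ _ * _); lia.
transitivity (theta * (mean_weight n + b * (n%:R * theta ^+ n.-1))
  + a * k%:R * theta ^+ n + b * weight n); first ring.
by rewrite IH; ring.
Qed.

(** Summing over the end point commutes with [walk], which combines only two values. *)
Lemma nneseries_iter_walk n i :
  (\sum_(j <oo) (j%:R * iter n walk (fun l => (l == j)%:R) i)%:E =
   (iter n walk (fun l => l%:R) i)%:E)%E.
Proof.
have w0 m j l : (0 <= (j%:R * iter m walk (fun l => (l == j)%:R) l)%:E)%E.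
  by rewrite lee_fin mulr_ge0// iter_walk_ge0.
elim: n i => [|n IH] i.
  rewrite (@nneseries_single _ _ i) /= ?eqxx ?mulr1// => j ij.
  by rewrite eq_sym (negbTE ij) mulr0.
have wS f : iter n.+1 walk f i =
  a * iter n walk f (i + k)%N + b * iter n walk f i.-1 by [].
rewrite wS EFinD !EFinM -!IH -!nneseriesZl// -nneseriesD; first last.
- by move=> j _ _; rewrite -EFinM lee_fin !mulr_ge0// iter_walk_ge0.
- by move=> j _ _; rewrite -EFinM lee_fin !mulr_ge0// ?iter_walk_ge0// ltW.
by apply: eq_eseriesr => j _; rewrite wS -!EFinM -EFinD; congr EFin; ring.
Qed.

(** The exponential series of [theta * u] without its first [j.+1] terms, divided by
    [theta ^+ j.+1]: up to normalization a Poisson tail, that is, an Erlang distribution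
    function. *)
Lemma nneseries_exp_tail (u : R) j :
  (\sum_(n <oo) ((j < n)%N%:R * (u ^+ n / n`!%:R * theta ^+ (n.-1 - j)))%:E =
   (expR (theta * u) * erlang_mass theta j u)%:E)%E.
Proof.
have th0 : theta != 0 by rewrite lt0r_neq0// ltr_wpDr.
have -> : expR (theta * u) * erlang_mass theta j u =
    (expR (theta * u) - \sum_(n < j.+1) (theta * u) ^+ n / n`!%:R) / theta ^+ j.+1.
  by rewrite /erlang_mass mulrA mulrBr mulrA -expRD subrr expR0 mulr1 mul1r.
apply: cvg_nneseries.
have H : series (exp_coeff (theta * u)) n @[n --> \oo] --> expR (theta * u).
  exact: is_cvg_series_exp_coeff.
have H' : (series (exp_coeff (theta * u)) n
    - \sum_(n < j.+1) (theta * u) ^+ n / n`!%:R) / theta ^+ j.+1 @[n --> \oo]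
    --> (expR (theta * u) - \sum_(n < j.+1) (theta * u) ^+ n / n`!%:R) / theta ^+ j.+1.
  by apply: cvgM; [apply: cvgB => //; exact: cvg_cst|exact: cvg_cst].
apply: cvg_trans H'; apply: near_eq_cvg; near=> n.
have jn : (j.+1 <= n)%N by near: n; exact: nbhs_infty_ge.
rewrite /series/= !(@big_cat_nat _ _ _ j.+1 0 n)//= [X in _ = X + _]big1_seq; last first.
  move=> i; rewrite mem_index_iota => /andP[_ /andP[_ ij]].
  by rewrite ltnNge -ltnS ij/= mul0r.
rewrite add0r big_mkord /exp_coeff/= addrAC subrr add0r mulr_suml;
  apply: eq_big_nat => i /andP[ij _].
rewrite ij mul1r exprMn.
have -> : theta ^+ i = theta ^+ j.+1 * theta ^+ (i.-1 - j).
  by rewrite -exprD; congr (_ ^+ _); lia.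
have fi : i`!%:R != 0 :> R by rewrite pnatr_eq0 -lt0n fact_gt0.
have tj : theta ^+ j.+1 != 0 by rewrite expf_neq0.
by field; apply/andP.
Unshelve. all: by end_near. Qed.

Lemma nneseries_exp_deriv (u : R) :
  (\sum_(n <oo) (u ^+ n / n`!%:R * (n%:R * theta ^+ n.-1))%:E =
   (expR (theta * u) * u)%:E)%E.
Proof.
apply: cvg_nneseries; rewrite -cvg_shiftS.
have H : u * series (exp_coeff (theta * u)) n @[n --> \oo] --> expR (theta * u) * u.
  rewrite [X in _ --> X]mulrC; apply: cvgM; first exact: cvg_cst.
  exact: is_cvg_series_exp_coeff.
apply: cvg_trans H; apply: near_eq_cvg; apply: nearW => n.
rewrite /series/= !big_mkord big_ord_recl/= mul0r mulr0 add0r mulr_sumr.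
apply: eq_bigr => i _; rewrite /bump/= add1n /exp_coeff/= exprMn exprS factS natrM.
have fi : i`!%:R != 0 :> R by rewrite pnatr_eq0 -lt0n fact_gt0.
have Si : i.+1%:R != 0 :> R by rewrite pnatr_eq0.
by field; apply/andP.
Qed.

End MeanWalk.

Section ChainMean.
Context {R : realType}.
Variables (a b : R) (k : nat) (p : R -> nat -> nat -> R).
Hypotheses (a_gt0 : 0 < a) (b_ge0 : 0 <= b).
Hypothesis p_ge0 : forall (t : R) i j, 0 <= t -> 0 <= p t i j.
Hypothesis p_sum1 : forall (t : R) i, 0 <= t -> (\sum_(j <oo) (p t i j)%:E = 1)%E.
Hypothesis p_0 : forall i j, p 0 i j = (i == j)%:R.
Hypothesis p_semigroup : forall (s t : R) i j, 0 <= s -> 0 <= t ->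
  ((p (s + t) i j)%:E = \sum_(z <oo) (p s i z * p t z j)%:E)%E.
Hypothesis p_rate : forall i j, ((p h i j - (i == j)%:R) / h) @[h --> (0 : R)^'+] -->
  a * (j == i + k)%N%:R + b * (j == i.-1)%:R - (a + b) * (i == j)%:R.

(** Multiplied by [expR ((a + b) * u)], every term becomes a power series in [u] with nonnegative
    coefficients; after Tonelli the claim is [mean_weightE] for each power. *)
Lemma chain_mean (u : R) : 0 <= u ->
  (\sum_(j <oo) (j%:R * p u 0 j)%:E + (b * u)%:E =
   (a * k%:R * u)%:E
   + b%:E * \sum_(j <oo) (return_weight a b k j * erlang_mass (a + b) j u)%:E)%E.
Proof.
move=> u0.
pose E := expR ((a + b) * u).
have E0 : 0 < E by rewrite expR_gt0.
have c0 n : 0 <= u ^+ n / n`!%:R :> R by rewrite divr_ge0// exprn_ge0.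
have mE : (E%:E * \sum_(j <oo) (j%:R * p u 0 j)%:E =
    \sum_(n <oo) (u ^+ n / n`!%:R * mean_weight a b k n)%:E)%E.
  rewrite -nneseriesZl; last by move=> j _; rewrite lee_fin mulr_ge0// p_ge0.
  transitivity (\sum_(j <oo) \sum_(n <oo) (j%:R * (u ^+ n / n`!%:R *
      iter n (walk_step a b k) (fun l => (l == j)%:R) 0%N))%:E)%E.
    apply: eq_eseriesr => j _.
    have w0 n : (0 <= (u ^+ n / n`!%:R *
        iter n (walk_step a b k) (fun l => (l == j)%:R) 0%N)%:E)%E.
      by rewrite lee_fin mulr_ge0// (iter_walk_ge0 _ a_gt0).
    under [RHS]eq_eseriesr do rewrite EFinM.
    rewrite nneseriesZl; last by move=> n _; exact: w0.
    rewrite (@cvg_nneseries _ _ (E * p u 0 j)) .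
      by rewrite -!EFinM; congr EFin; ring.
    exact: (chain_series (ltW a_gt0) b_ge0 p_ge0 p_sum1 p_0 p_semigroup p_rate).
  rewrite nneseries_interchange; last first.
    by move=> j n; rewrite lee_fin mulr_ge0// mulr_ge0// (iter_walk_ge0 _ a_gt0).
  apply: eq_eseriesr => n _; rewrite EFinM -(nneseries_iter_walk k a_gt0 b_ge0).
  rewrite -nneseriesZl; last first.
    by move=> j _; rewrite lee_fin mulr_ge0// (iter_walk_ge0 _ a_gt0).
  by apply: eq_eseriesr => j _; rewrite -EFinM; congr EFin; ring.
have w0 j : 0 <= return_weight a b k j by exact: return_weight_ge0.
have t0 j n : 0 <= (j < n)%N%:R * (u ^+ n / n`!%:R * (a + b) ^+ (n.-1 - j)).
  by rewrite !mulr_ge0// exprn_ge0// addr_ge0// ltW.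
have d0 n j : 0 <= return_weight a b k j *
    ((j < n)%N%:R * (u ^+ n / n`!%:R * (a + b) ^+ (n.-1 - j))).
  by rewrite mulr_ge0.
have g0 j : 0 <= return_weight a b k j * erlang_mass (a + b) j u.
  rewrite mulr_ge0// -(pmulr_rge0 _ E0) -lee_fin -nneseries_exp_tail//.
  by apply: nneseries_ge0 => n _ _; rewrite lee_fin t0.
have hE : (E%:E * \sum_(j <oo) (return_weight a b k j * erlang_mass (a + b) j u)%:E =
    \sum_(n <oo) (u ^+ n / n`!%:R *
      \sum_(j < n) (a + b) ^+ (n.-1 - j) * return_weight a b k j)%:E)%E.
  transitivity (\sum_(n <oo) \sum_(j <oo) (return_weight a b k j *
      ((j < n)%N%:R * (u ^+ n / n`!%:R * (a + b) ^+ (n.-1 - j))))%:E)%E; last first.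
    apply: eq_eseriesr => n _; rewrite (@nneseries_finite _ _ n); last first.
      by move=> j nj; rewrite ltnNge nj/= mul0r mulr0.
    rewrite sumEFin mulr_sumr; congr EFin; apply: eq_bigr => j _.
    by rewrite ltn_ord mul1r; ring.
  rewrite nneseries_interchange; last by move=> n j; rewrite lee_fin; exact: d0.
  rewrite -nneseriesZl; last first.
    by move=> j _; rewrite lee_fin g0.
  apply: eq_eseriesr => j _; under eq_eseriesr do rewrite EFinM.
  rewrite nneseriesZl; last by move=> n _; rewrite lee_fin t0.
  by rewrite nneseries_exp_tail// -!EFinM; congr EFin; rewrite -/E; ring.
have Eu := nneseries_exp_deriv a b u; rewrite -/E in Eu.
have X0 : (0 <= \sum_(j <oo) (j%:R * p u 0 j)%:E)%E.
  by apply: nneseries_ge0 => j _ _; rewrite lee_fin mulr_ge0// p_ge0.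
have Y0 : (0 <= \sum_(j <oo) (return_weight a b k j * erlang_mass (a + b) j u)%:E)%E.
  apply: nneseries_ge0 => j _ _; rewrite lee_fin; exact: g0.
have s0 n : 0 <= \sum_(j < n) (a + b) ^+ (n.-1 - j) * return_weight a b k j.
  by apply: sumr_ge0 => j _; rewrite mulr_ge0// exprn_ge0// addr_ge0// ltW.
have n0 n : 0 <= n%:R * (a + b) ^+ n.-1 by rewrite mulr_ge0// exprn_ge0// addr_ge0// ltW.
have ak0 : 0 <= a * k%:R by rewrite mulr_ge0// ltW.
have EI (x y : \bar R) : (E%:E * x = E%:E * y -> x = y)%E.
  by move=> /(congr1 (fun z => E^-1%:E * z)%E); rewrite !muleA -EFinM mulVf ?mul1e// lt0r_neq0.
apply: EI; rewrite !ge0_muleDr ?lee_fin ?mulr_ge0// ?mule_ge0// 1?ltW//.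
rewrite mE muleCA hE.
have -> : (E%:E * (b * u)%:E = b%:E * (E * u)%:E)%E.
  by rewrite -!EFinM; congr EFin; ring.
have -> : (E%:E * (a * k%:R * u)%:E = (a * k%:R)%:E * (E * u)%:E)%E.
  by rewrite -!EFinM; congr EFin; ring.
rewrite -Eu -!nneseriesZl; first last.
- by move=> n _; rewrite lee_fin mulr_ge0.
- by move=> n _; rewrite lee_fin mulr_ge0.
- by move=> n _; rewrite lee_fin mulr_ge0.
rewrite -!nneseriesD; first last.
- by move=> n _ _; rewrite -EFinM lee_fin; apply: mulr_ge0 => //; exact: mulr_ge0.
- by move=> n _ _; rewrite lee_fin mulr_ge0//; exact: (mean_weight_ge0 _ a_gt0 b_ge0).
- by move=> n _ _; rewrite -EFinM lee_fin; apply: mulr_ge0 => //; exact: mulr_ge0.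
- by move=> n _ _; rewrite -EFinM lee_fin; apply: mulr_ge0 => //; exact: mulr_ge0.
apply: eq_eseriesr => n _; rewrite -!EFinM -!EFinD; congr EFin.
rewrite (mulrCA b) -mulrDr mean_weightE// mulrDr.
by congr (_ + _); rewrite mulrCA.
Qed.

End ChainMean.

(** * Erlang densities and the Gamma function *)

Definition erlang_density {R : realType} (x : R) (j : nat) (s : R) : R :=
  s ^+ j / j`!%:R * expR (- (x * s)).

Section Erlang.
Context {R : realType}.
Variables (x : R).
Hypothesis x_gt0 : 0 < x.
Local Notation mu := (@lebesgue_measure R).

Let exp_poly n (u : R) : R := \sum_(m < n) u ^+ m / m`!%:R * x ^+ m.

Lemma is_derive_exp_poly n (u : R) : is_derive u 1 (exp_poly n.+1) (x * exp_poly n u).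
Proof.
elim: n => [|n IH].
  have -> : exp_poly 1 = cst 1.
    by apply/funext => y; rewrite /exp_poly big_ord1 !expr0 divr1 mul1r.
  by apply: is_derive_eq; rewrite /exp_poly big_ord0 mulr0.
have -> : exp_poly n.+2 =
    exp_poly n.+1 + (fun u : R => u ^+ n.+1 / (n.+1)`!%:R * x ^+ n.+1).
  by apply/funext => y; rewrite /exp_poly big_ord_recr.
have H := is_derive_monomial n (x ^+ n.+1) u.
apply: is_derive_eq; rewrite [in RHS]/exp_poly big_ord_recr/= -/(exp_poly n u).
by rewrite exprS; ring.
Qed.

Lemma is_derive_expRNM (u : R) :
  is_derive u 1 (fun u : R => expR (- (x * u))) (- x * expR (- (x * u))).
Proof.
have -> : (fun u : R => expR (- (x * u))) = expR \o ((- x) \*: (@id R)).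
  by apply/funext => y; rewrite /= /GRing.scale/= mulNr.
by apply: is_derive_eq; rewrite /GRing.scale/= mulr1 [LHS]mulrC; congr (_ * expR _); rewrite -mulNr.
Qed.

Let erlang_massE j : erlang_mass x j =
  (x ^+ j.+1)^-1 \*: (cst 1 - (fun u : R => expR (- (x * u))) * exp_poly j.+1).
Proof.
apply/funext => u; rewrite /erlang_mass !fctE /GRing.scale/= mulrC.
congr (_ * (_ - _ * _)); apply: eq_bigr => m _; rewrite exprMn; ring.
Qed.

(** The derivative telescopes: differentiating the exponential polynomial lowers its degree by one,
    and only the top term survives. *)
Lemma is_derive_erlang_mass j (u : R) :
  is_derive u 1 (erlang_mass x j) (erlang_density x j u).
Proof.
rewrite erlang_massE; have H1 := is_derive_expRNM u; have H2 := is_derive_exp_poly j u.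
apply: is_derive_eq; rewrite /erlang_density /GRing.scale/=.
have -> : exp_poly j.+1 u = exp_poly j u + u ^+ j / j`!%:R * x ^+ j.
  by rewrite /exp_poly big_ord_recr.
have xj : x ^+ j.+1 != 0 by rewrite expf_neq0// lt0r_neq0.
transitivity ((x ^+ j.+1)^-1 * (u ^+ j / j`!%:R * (x * x ^+ j) * expR (- (x * u)))).
  by ring.
by rewrite -exprS (mulrC _ (x ^+ j.+1)) -(mulrA (x ^+ j.+1)) mulKf.
Qed.

Lemma erlang_mass0 j : erlang_mass x j 0 = 0.
Proof.
rewrite /erlang_mass mulr0 oppr0 expR0 mul1r big_ord_recl/= expr0 divr1.
by rewrite big1 ?addr0 ?subrr ?mul0r// => i _; rewrite expr0n/= mul0r.
Qed.

Lemma cvg_erlang_mass j : erlang_mass x j u @[u --> +oo] --> (x ^+ j.+1)^-1.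
Proof.
have -> : (x ^+ j.+1)^-1 = (x ^+ j.+1)^-1 * (1 - 0) by rewrite subr0 mulr1.
have -> : erlang_mass x j =
    (fun u => (x ^+ j.+1)^-1 * (1 - expR (- (x * u)) * exp_poly j.+1 u)).
  by rewrite erlang_massE.
apply: cvgM; first exact: cvg_cst.
apply: cvgB; first exact: cvg_cst.
have -> : (fun u => expR (- (x * u)) * exp_poly j.+1 u) =
  (fun u => \sum_(m < j.+1) (x * u) ^+ m / m`!%:R * expR (- (x * u))).
  apply/funext => u; rewrite /exp_poly mulr_sumr; apply: eq_bigr => m _.
  by rewrite exprMn; ring.
have z : \sum_(m < j.+1) (0 : R) = 0 by rewrite big1.
rewrite -[X in _ --> X]z; apply: cvg_sum_seq => m.
apply/cvgrPdist_le => e e0; near=> u.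
have u0 : 0 < x * u by rewrite mulr_gt0//; near: u; exact: nbhs_pinfty_gt.
rewrite sub0r normrN ger0_norm; last first.
  by rewrite mulr_ge0 ?expR_ge0// divr_ge0// exprn_ge0// ltW.
(* One power more than in the term to be bounded, so that the quotient is of order [1 / (x * u)]. *)
have H : (x * u) ^+ m.+1 / (m.+1)`!%:R <= expR (x * u).
  have := @sum_seq_le_nneseries _ _ _ [:: m.+1] isT _ (nneseries_exp (x * u)).
  by rewrite big_seq1; apply => n; rewrite divr_ge0// exprn_ge0// ltW.
have E0 := expR_gt0 (x * u).
rewrite expRN ler_pdivrMr// (le_trans _ (ler_wpM2l (ltW e0) H))//.
rewrite exprS factS natrM.
have -> : e * (x * u * (x * u) ^+ m / (m.+1%:R * m`!%:R)) = 
   (e * (x * u) / m.+1%:R) * ((x * u) ^+ m / m`!%:R).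
  have fi : m`!%:R != 0 :> R by rewrite pnatr_eq0 -lt0n fact_gt0.
  have Si : m.+1%:R != 0 :> R by rewrite pnatr_eq0.
  by field; apply/andP.
apply: ler_peMl; first by rewrite divr_ge0// exprn_ge0// ltW.
rewrite ler_pdivlMr ?ltr0n// mul1r mulrA -ler_pdivrMl ?mulr_gt0//.
Unshelve. all: by end_near. Qed.

Lemma erlang_density_ge0 j (s : R) : 0 <= s -> 0 <= erlang_density x j s.
Proof.
by move=> s0; rewrite /erlang_density mulr_ge0 ?expR_ge0// divr_ge0// exprn_ge0.
Qed.

Lemma continuous_erlang_density j : continuous (erlang_density x j).
Proof.
move=> s; apply: cvgM; last first.
  exact: (is_derive_cvg (is_derive_expRNM s)).
by apply: cvgM; [exact: exprn_continuous|exact: cvg_cst].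
Qed.

Lemma integral_erlang_density j (u : R) : 0 <= u ->
  (\int[mu]_(s in `[0%R, u]) (erlang_density x j s)%:E = (erlang_mass x j u)%:E)%E.
Proof.
rewrite le_eqVlt => /predU1P[<-|u0].
  by rewrite set_itv1 integral_set1 erlang_mass0.
have dF := is_derive_erlang_mass j.
rewrite (continuous_FTC2 u0 (F := erlang_mass x j)) ?erlang_mass0 ?sube0//.
- by apply: continuous_subspaceT; exact: continuous_erlang_density.
- split; first by move=> s _; have [] := dF s.
    exact: cvg_at_right_filter (is_derive_cvg (dF 0)).
  exact: cvg_at_left_filter (is_derive_cvg (dF u)).
- by move=> s _; rewrite derive1E; have [] := dF s.
Qed.

Lemma integral_erlang_densityy j :
  (\int[mu]_(s in `[0%R, +oo[) (erlang_density x j s)%:E = (x ^+ j.+1)^-1%:E)%E.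
Proof.
have dF := is_derive_erlang_mass j.
rewrite (ge0_continuous_FTC2y (F := erlang_mass x j) (l := (x ^+ j.+1)^-1)) ?erlang_mass0 ?sube0//.
- exact: erlang_density_ge0.
- by apply: continuous_subspaceT; exact: continuous_erlang_density.
- exact: cvg_erlang_mass.
- rewrite -[X in _ --> X](erlang_mass0 j).
  exact: cvg_at_right_filter (is_derive_cvg (dF 0)).
- by move=> s _; rewrite derive1E; have [] := dF s.
Qed.

End Erlang.

(** * Gamma integrals and Laplace transforms of powers *)

Section GammaFunction.
Context {R : realType}.
Local Notation mu := (@lebesgue_measure R).
Implicit Types (a v : R).

Lemma measurable_powR_expR a (D : set R) :
  measurable_fun D (EFin \o (fun u : R => u `^ a * expR (- u))).
Proof.
apply: measurable_funTS; apply/measurable_EFinP.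
apply: measurable_funM; first exact: measurable_powR.
by apply: measurableT_comp => //; exact: measurable_funN.
Qed.

(** [Gamma] is the [fine] of its integral, so it carries the value only once finiteness is known;
    the endpoint [0] is a null set. *)
Lemma Gamma_integral a : (\int[mu]_(u in `[0%R, +oo[) (u `^ a * expR (- u))%:E)%E
    \is a fin_num ->
  (\int[mu]_(u in `[0%R, +oo[) (u `^ a * expR (- u))%:E = (Gamma (a + 1))%:E)%E.
Proof.
move=> afin; rewrite /Gamma addrK integral_itv_obnd_cbnd ?fineK//.
exact: measurable_powR_expR.
Qed.

Lemma integral_exprn_expR n :
  (\int[mu]_(u in `[0%R, +oo[) (u ^+ n * expR (- u))%:E = (n`!%:R)%:E)%E.
Proof.
have fn : n`!%:R != 0 :> R by rewrite pnatr_eq0 -lt0n fact_gt0.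
transitivity (\int[mu]_(u in `[0%R, +oo[) ((n`!%:R)%:E * (erlang_density 1 n u)%:E))%E.
  apply: eq_integral => u _; rewrite /erlang_density -EFinM mul1r; congr EFin.
  by field.
rewrite ge0_integralZl//.
- by rewrite integral_erlang_densityy// expr1n invr1 mule1.
- apply/measurable_EFinP; apply: measurable_funTS.
  by apply: continuous_measurable_fun; exact: continuous_erlang_density.
- by move=> u; rewrite /= in_itv/= andbT => u0; rewrite lee_fin erlang_density_ge0.
Qed.

(** [u ^ a <= u ^ 0 + u ^ n] for an integer [n > a], and the integer powers are Erlang integrals. *)
Lemma powR_expR_fin_num a : 0 < a ->
  (\int[mu]_(u in `[0%R, +oo[) (u `^ a * expR (- u))%:E)%E \is a fin_num.
Proof.
move=> a0; have mp : measurable_fun (`[0%R, +oo[%classic : set R)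
    (EFin \o (fun u : R => u `^ a * expR (- u))).
  exact: measurable_powR_expR.
have me n : measurable_fun (`[0%R, +oo[%classic : set R)
    (EFin \o (fun u : R => u ^+ n * expR (- u))).
  apply/measurable_EFinP; apply: measurable_funTS; apply: measurable_funM.
    exact: exprn_measurable.
  by apply: measurableT_comp => //; exact: measurable_funN.
have ge n (u : R) : `[0%R, +oo[%classic u -> (0 <= (u ^+ n * expR (- u))%:E)%E.
  by rewrite /= in_itv/= andbT lee_fin => u0; rewrite mulr_ge0 ?exprn_ge0 ?expR_ge0.
pose n := (Num.truncn a).+1.
rewrite ge0_fin_numE; last first.
  by apply: integral_ge0 => u _; rewrite lee_fin mulr_ge0 ?powR_ge0 ?expR_ge0.
apply: (@le_lt_trans _ _ ((0`!%:R)%:E + (n`!%:R)%:E)%E); last exact: ltry.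
rewrite -!integral_exprn_expR -ge0_integralD//; [|exact: ge|exact: me|exact: ge|exact: me].
apply: ge0_le_integral => //.
- by move=> u _; rewrite lee_fin mulr_ge0 ?powR_ge0 ?expR_ge0.
- by apply: emeasurable_funD; exact: me.
move=> u; rewrite /= in_itv/= andbT => u0.
rewrite -EFinD -mulrDl lee_fin ler_wpM2r ?expR_ge0// expr0.
have [u1|u1] := leP u 1.
  apply: (@le_trans _ _ 1); last by rewrite lerDl exprn_ge0.
  have <- : 1 `^ a = 1 :> R by rewrite powR1.
  by apply: ge0_ler_powR => //; rewrite ?nnegrE// ltW.
apply: (@le_trans _ _ (u ^+ n)); last by rewrite lerDr.
rewrite -powR_mulrn//; apply: ler_powR; first exact: ltW.
by rewrite ltW// Num.Theory.truncnS_gt.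
Qed.

Lemma GammaS_nat n : Gamma (n%:R + 1 : R) = n`!%:R.
Proof.
have H : (\int[mu]_(u in `[0%R, +oo[) (u `^ n%:R * expR (- u))%:E = (n`!%:R)%:E)%E.
  rewrite -integral_exprn_expR; apply: eq_integral => u; rewrite inE/= in_itv/= andbT => u0.
  by rewrite powR_mulrn.
by apply: EFin_inj; rewrite -H Gamma_integral// H.
Qed.

(** The substitution [u = v * t] in Euler's integral. *)
Lemma laplace_powR a v : 0 < a -> 0 < v ->
  (\int[mu]_(t in `[0%R, +oo[) (t `^ a * expR (- (v * t)))%:E =
   (Gamma (a + 1) * (v `^ (a + 1))^-1)%:E)%E.
Proof.
move=> a0 v0.
pose F (t : R) := v * t; pose G (u : R) := u `^ a * expR (- u).
have dF (t : R) : is_derive t 1 F v.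
  have -> : F = v \*: (@id R) by [].
  by apply: is_derive_eq; rewrite /GRing.scale/= mulr1.
have F'E : F^`()%classic = cst v by apply/funext => t; rewrite derive1E; have [] := dF t.
have F0 : F 0 = 0 by rewrite /F mulr0.
have G0 u : 0 <= G u by rewrite mulr_ge0 ?powR_ge0 ?expR_ge0.
have cE (u : R) : expR (- y) @[y --> u] --> expR (- u).
  apply: (continuous_comp (f := -%R) (g := expR)); first exact: oppr_continuous.
  exact: continuous_expR.
have cG : {within `[0%R, +oo[, continuous G}.
  apply/continuous_within_itvcyP; split.
    move=> u u0; apply: cvgM; last exact: cE.
    have D : derivable (fun y : R => y `^ a) u 1 by exact: derivable_powR.
    exact: (is_derive_cvg (derivableP D)).
  rewrite [X in _ --> X](_ : _ = 0 * expR (- 0)); last by rewrite /G powR0 ?gt_eqF.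
  by apply: cvgM; [exact: powR_cvg0|exact: cvg_at_right_filter (cE 0)].
have key : (\int[mu]_(x in `[F 0%R, +oo[) (G x)%:E =
    \int[mu]_(x in `[0%R, +oo[) (((G \o F) * F^`()%classic)%R x)%:E)%E.
  apply: increasing_ge0_integration_by_substitutiony.
  - by move=> x y _ _ xy; rewrite ltr_pM2l.
  - by rewrite F'E => x _; exact: cst_continuous.
  - by rewrite F'E; exact: is_cvg_cst.
  - by rewrite F'E; exact: is_cvg_cst.
  - split; first by move=> x _; have [] := dF x.
    exact: cvg_at_right_filter (is_derive_cvg (dF 0)).
  - by apply: gt0_cvgMry => //; exact: cvg_id.
  - by rewrite F0.
  - by move=> x _; exact: G0.
rewrite F0 /G Gamma_integral in key; last exact: powR_expR_fin_num.
have va0 : 0 < v `^ (a + 1) by exact: powR_gt0.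
rewrite mulrC EFinM key -ge0_integralZl//.
- apply: eq_integral => t; rewrite inE/= in_itv/= andbT => t0.
  rewrite -EFinM F'E fctE/= /F powRM ?(ltW v0)//; congr EFin.
  rewrite powRD ?powRr1 ?(ltW v0)//; last by rewrite (gt_eqF v0) implybT.
  have v0' : v != 0 by rewrite gt_eqF.
  have va : v `^ a != 0 by rewrite gt_eqF// powR_gt0.
  by field; apply/andP.
- apply/measurable_EFinP; rewrite F'E; apply: measurable_funTS; apply: measurable_funM => //.
  apply: (measurableT_comp (f := G)).
    by apply/measurable_EFinP; exact: measurable_powR_expR.
  exact: measurable_funM.
- by move=> t _; rewrite lee_fin F'E; exact: mulr_ge0 (G0 _) (ltW v0).
- by rewrite lee_fin invr_ge0 ltW.
Qed.

End GammaFunction.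

(** * Uniqueness of Laplace transforms *)

Section StepKernel.
Context {R : realType}.
Implicit Types (y : R).

Lemma bernoulli_le y N : 0 <= y -> y <= 1 -> 1 - N%:R * y <= (1 - y) ^+ N.
Proof.
move=> y0 y1; elim: N => [|N IH]; first by rewrite mul0r subr0 expr0.
rewrite exprS -natr1; have N0 : 0 <= N%:R :> R by [].
have : (1 - y) * (1 - N%:R * y) <= (1 - y) * (1 - y) ^+ N.
  by rewrite ler_wpM2l// subr_ge0.
by nra.
Qed.

Lemma step_kernel_bounds y n : 0 <= y -> y <= 1 ->
  0 <= (1 - y ^+ n) ^+ (2 ^ n) <= 1.
Proof.
move=> y0 y1; have : 0 <= y ^+ n <= 1 by rewrite exprn_ge0//= exprn_ile1.
move=> /andP[h0 h1]; apply/andP; split.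
  by rewrite exprn_ge0// subr_ge0.
by rewrite exprn_ile1 ?subr_ge0// lerBlDr lerDl.
Qed.

(** [2 ^ n * y ^ n = (2 y) ^ n] places the threshold at [y = 1 / 2]; below it, Bernoulli's
    inequality bounds the kernel from below by [1 - (2 y) ^ n]. *)
Lemma step_kernel_cvg1 y : 0 <= y -> 2 * y < 1 ->
  (1 - y ^+ n) ^+ (2 ^ n) @[n --> \oo] --> (1 : R).
Proof.
move=> y0 y1; have y1' : y <= 1 by lra.
apply: (@squeeze_cvgr _ _ _ _ (fun n => 1 - (2 * y) ^+ n) (cst 1)).
- near=> n; have /andP[_ ->] := step_kernel_bounds n y0 y1'; rewrite andbT.
  rewrite exprMn -natrX; apply: bernoulli_le; first by rewrite exprn_ge0.
  by rewrite exprn_ile1.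
- rewrite -[X in _ --> X]subr0; apply: cvgB; first exact: cvg_cst.
  by apply: cvg_expr; rewrite ger0_norm// mulr_ge0.
- exact: cvg_cst.
Unshelve. all: by end_near. Qed.

(** Above the threshold, [1 - z <= exp (- z)] bounds the kernel by [exp (- (2 y) ^ n)], which is at
    most [(2 y) ^ (- n)]. *)
Lemma step_kernel_cvg0 y : 1 < 2 * y -> y <= 1 ->
  (1 - y ^+ n) ^+ (2 ^ n) @[n --> \oo] --> (0 : R).
Proof.
move=> y0 y1; have yp : 0 < y by lra.
apply: (@squeeze_cvgr _ _ _ _ (cst 0) (fun n => (2 * y)^-1 ^+ n)).
- near=> n; have /andP[-> _] /= := step_kernel_bounds n (ltW yp) y1.
  have z0 : 0 < (2 * y) ^+ n by rewrite exprn_gt0// mulr_gt0.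
  apply: (@le_trans _ _ (expR (- (2 * y) ^+ n))).
    rewrite exprMn -natrX -mulrN expRM_natl lerXn2r ?nnegrE ?expR_ge0//.
      by rewrite subr_ge0 exprn_ile1// ltW.
    exact: expR_ge1Dx.
  rewrite expRN exprVn lef_pV2 ?posrE ?expR_gt0//.
  by rewrite (le_trans _ (expR_ge1Dx _))// lerDr.
- exact: cvg_cst.
- by apply: cvg_expr; rewrite ger0_norm ?invr_ge0 ?mulr_ge0 ?ltW// invf_lt1// mulr_gt0.
Unshelve. all: by end_near. Qed.

End StepKernel.

Section LaplaceUniqueness.
Context {R : realType}.
Local Notation mu := (@lebesgue_measure R).
Local Notation Rpos := (`[0%R, +oo[%classic : set R).

(* The kernels [(1 - exp (- n b t)) ^ (2 ^ n)] with [b = ln 2 / a] are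
   combinations of exponentials and converge to the indicator of [t > a]. *)
Lemma laplace_tail_eq0 (h : R -> R) (a : R) : 0 < a -> measurable_fun setT h ->
  (forall v : R, 0 < v -> mu.-integrable Rpos (fun t => (expR (- (v * t)) * h t)%:E)) ->
  (forall v : R, 0 < v -> (\int[mu]_(t in Rpos) (expR (- (v * t)) * h t)%:E = 0)%E) ->
  (\int[mu]_(t in Rpos) ((a < t)%R%:R * (expR (- t) * h t))%:E = 0)%E.
Proof.
move=> a0 mh ih h0.
pose b := ln 2 / a.
have ln2 : 0 < ln 2 :> R by rewrite ln_gt0// ltr1n.
have b0 : 0 < b by rewrite divr_gt0.
pose E (t : R) := expR (- t) * h t.
pose f n (t : R) := (1 - expR (- (b * t)) ^+ n) ^+ (2 ^ n) * E t.
have mexp (v : R) : measurable_fun setT (fun t : R => expR (- (v * t))).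
  by apply: continuous_measurable_fun => t; exact: is_derive_cvg (is_derive_expRNM v t).
have mE : measurable_fun setT E.
  apply: measurable_funM => //.
  by have := mexp 1; apply: eq_measurable_fun => t _; rewrite mul1r.
(* Binomial expansion: only the transforms at the points [1 + b * n * i] occur, and they vanish; the
   factor [expR (- t)] in [E] keeps these points away from [0]. *)
have fsum n t : f n t = \sum_(i < (2 ^ n).+1) (-1) ^+ i *+ 'C(2 ^ n, i) *
    (expR (- ((1 + b * (n * i)%:R) * t)) * h t).
  rewrite /f exprBn mulr_suml; apply: eq_bigr => i _.
  rewrite expr1n mulr1 mulrnAl mulrnAl; congr (_ *+ _).
  have -> : expR (- ((1 + b * (n * i)%:R) * t)) = expR (- t) * (expR (- (b * t)) ^+ n) ^+ i.
    by rewrite -exprM -expRM_natl -expRD; congr expR; ring.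
  by rewrite /E; ring.
have vpos n i : 0 < 1 + b * (n * i)%:R by rewrite ltr_pwDl// mulr_ge0// ltW.
have f0 n : (\int[mu]_(t in Rpos) (f n t)%:E = 0)%E.
  transitivity (\int[mu]_(t in Rpos) \sum_(i < (2 ^ n).+1)
      (((-1) ^+ i *+ 'C(2 ^ n, i))%:E *
      (expR (- ((1 + b * (n * i)%:R) * t)) * h t)%:E))%E.
    by apply: eq_integral => t _; rewrite fsum -sumEFin.
  rewrite integral_sum//.
    by apply: big1 => i _; rewrite integralZl ?h0 ?mule0//; exact: ih.
  by move=> i; apply: integrableZl => //; exact: ih.
have Erest : mu.-integrable Rpos (EFin \o E).
  by have := ih 1 ltr01; apply: eq_integrable => // t _; rewrite /E mul1r.
have mf n : measurable_fun setT (f n).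
  apply: measurable_funM => //; apply: measurable_funX.
  apply: measurable_funB => //; apply: measurable_funX; exact: mexp.
have mlt : measurable_fun setT (fun t : R => (a < t)%R%:R * E t).
  apply: measurable_funM => //.
  apply: (eq_measurable_fun (\1_(`]a, +oo[%classic : set R) : R -> R));
    last exact: measurable_indic.
  by move=> t _; rewrite indicE mem_setE in_itv/= andbT.
have ble t : 0 <= t -> expR (- (b * t)) <= 1.
  by move=> t0; rewrite -expR0 ler_expR lerNl oppr0 mulr_ge0// ltW.
have lim t : 0 <= t -> t != a -> f n t @[n --> \oo] --> (a < t)%R%:R * E t.
  move=> t0 ta; apply: cvgM; last exact: cvg_cst.
  have ble' := ble t t0.
  have two : expR (b * a) = 2 :> R by rewrite /b divfK ?lnK ?posrE// gt_eqF.
  have twoE : 2 * expR (- (b * t)) = expR (b * (a - t)).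
    by rewrite -two -expRD; congr expR; ring.
  have [at_|ta_] := ltP a t.
    apply: step_kernel_cvg1; first exact: expR_ge0.
    by rewrite twoE -expR0 ltr_expR pmulr_rlt0// subr_lt0.
  apply: step_kernel_cvg0 => //.
  by rewrite twoE -expR0 ltr_expR pmulr_rgt0// subr_gt0 lt_neqAle ta.
have [||||| _ _] := @dominated_convergence _ _ _ mu Rpos (measurable_itv _)
  (fun n t => (f n t)%:E) (fun t => ((a < t)%R%:R * E t)%:E) (fun t => `|E t|%:E).
- by move=> n; apply/measurable_EFinP; exact: (measurable_funTS (mf n)).
- by apply/measurable_EFinP; exact: (measurable_funTS mlt).
(* At [t = a] the kernel sits on its threshold; a single point is null. *)
- exists [set a]; split=> //; first exact: lebesgue_measure_set1.
  move=> t /= H; apply: contrapT => ta; apply: H => t0.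
  apply: cvg_EFin; first exact: nearW.
  by apply: lim; [move: t0; rewrite in_itv/= andbT|exact/eqP].
- exact: integrable_norm.
- apply: aeW => t n; rewrite /= in_itv/= andbT => t0.
  rewrite lee_fin normrM ler_piMl//.
  have /andP[k0 k1] := step_kernel_bounds n (expR_ge0 _) (ble t t0).
  by rewrite ger0_norm.
under eq_fun do rewrite f0.
by move=> /(cvg_unique _ (cvg_cst _)) <-.
Qed.

(** Differences of tails show that [expR (- t) * (f t - g t)] has integral [0] over []a, b]]
    whenever [0 < a < b]. If [f t > g t], monotonicity of [f] and continuity of [g] keep the
    difference positive just to the right of [t]; if [f t < g t], it stays negative just to the
    left. Hence equality at every positive point, not only almost everywhere. *)
Lemma laplace_unique (f g : R -> R) :
  measurable_fun setT f -> measurable_fun setT g ->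
  (forall s t : R, 0 <= s -> s <= t -> f s <= f t) ->
  (forall t : R, 0 <= t -> 0 <= f t) -> (forall t : R, 0 <= t -> 0 <= g t) ->
  (forall t : R, 0 < t -> {for t, continuous g}) ->
  (forall v : R, 0 < v -> (\int[mu]_(t in Rpos) (expR (- (v * t)) * f t)%:E < +oo)%E) ->
  (forall v : R, 0 < v -> (\int[mu]_(t in Rpos) (expR (- (v * t)) * f t)%:E =
    \int[mu]_(t in Rpos) (expR (- (v * t)) * g t)%:E)%E) ->
  forall t : R, 0 < t -> f t = g t.
Proof.
move=> mf mg ndf f0 g0 cg If Ifg.
pose h t := f t - g t.
have mh : measurable_fun setT h by exact: measurable_funB.
have mexp (v : R) : measurable_fun setT (fun t : R => expR (- (v * t))).
  by apply: continuous_measurable_fun => t; exact: is_derive_cvg (is_derive_expRNM v t).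
have iw (w : R -> R) : measurable_fun setT w -> (forall t, 0 <= t -> 0 <= w t) ->
    (forall v : R, 0 < v -> (\int[mu]_(t in Rpos) (expR (- (v * t)) * w t)%:E < +oo)%E) ->
    forall v : R, 0 < v -> mu.-integrable Rpos (fun t => (expR (- (v * t)) * w t)%:E).
  move=> mw w0 Iw v v0; apply/integrableP; split.
    apply/measurable_EFinP; apply: measurable_funTS; apply: measurable_funM => //.
    exact: mexp.
  apply: le_lt_trans (Iw v v0); apply: ge0_le_integral => //.
  - apply: measurableT_comp => //; apply/measurable_EFinP; apply: measurable_funTS.
    by apply: measurable_funM => //; exact: mexp.
  - apply/measurable_EFinP; apply: measurable_funTS.
    by apply: measurable_funM => //; exact: mexp.
  - move=> t; rewrite /= in_itv/= andbT => t0.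
    by rewrite ger0_norm// mulr_ge0 ?expR_ge0// w0.
have iff := iw f mf f0 If.
have ig : forall v : R, 0 < v -> mu.-integrable Rpos (fun t => (expR (- (v * t)) * g t)%:E).
  by apply: iw => // v v0; rewrite -Ifg// If.
have hE (v t : R) : ((expR (- (v * t)) * h t)%:E =
    (expR (- (v * t)) * f t)%:E - (expR (- (v * t)) * g t)%:E)%E.
  by rewrite -EFinB /h mulrBr.
have ih (v : R) : 0 < v -> mu.-integrable Rpos (fun t => (expR (- (v * t)) * h t)%:E).
  move=> v0; have := @integrableB _ _ _ mu Rpos (measurable_itv _) _ _ (iff v v0) (ig v v0).
  by apply: eq_integrable => // t _; rewrite hE.
have h0 (v : R) : 0 < v -> (\int[mu]_(t in Rpos) (expR (- (v * t)) * h t)%:E = 0)%E.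
  move=> v0; transitivity (\int[mu]_(t in Rpos) ((expR (- (v * t)) * f t)%:E -
      (expR (- (v * t)) * g t)%:E))%E; first by apply: eq_integral => t _; rewrite hE.
  rewrite (integralB _ (iff v v0) (ig v v0))// Ifg// subee//.
  by apply: integrable_fin_num => //; exact: ig.
have iE : mu.-integrable Rpos (fun t => (expR (- t) * h t)%:E).
  by have := ih 1 ltr01; apply: eq_integrable => // t _; rewrite mul1r.
have mlt (c : R) : measurable_fun setT (fun t : R => (c < t)%R%:R : R).
  apply: (eq_measurable_fun (\1_(`]c, +oo[%classic : set R) : R -> R));
    last exact: measurable_indic.
  by move=> t _; rewrite indicE mem_setE in_itv/= andbT.
have itail (c : R) : mu.-integrable Rpos (fun t => ((c < t)%R%:R * (expR (- t) * h t))%:E).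
  apply: (le_integrable _ _ _ iE) => //.
    apply/measurable_EFinP; apply: measurable_funTS; apply: measurable_funM; first exact: mlt.
    apply: measurable_funM; last exact: mh.
    by have := mexp 1; apply: eq_measurable_fun => t _; rewrite mul1r.
  move=> t _; rewrite lee_fin normrM ler_piMl//.
  by case: (c < t)%R; rewrite ?normr1 ?normr0.
have iab (a b : R) : mu.-integrable Rpos (fun t => ((a < t)%R%:R * (expR (- t) * h t) -
      (b < t)%R%:R * (expR (- t) * h t))%:E).
  have := @integrableB _ _ _ mu Rpos (measurable_itv _) _ _ (itail a) (itail b).
  by apply: eq_integrable => // t _; rewrite EFinB.
(* [s] will be [1] or [-1], for the two possible signs of the difference. *)
have nosign (a b e s : R) : 0 < a -> a < b -> 0 < e ->
    (forall t, a < t -> t <= b -> e <= s * h t) -> False.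
  move=> a0 ab e0 H.
  have I0 : (\int[mu]_(t in Rpos) ((a < t)%R%:R * (expR (- t) * h t) -
      (b < t)%R%:R * (expR (- t) * h t))%:E = 0)%E.
    transitivity (\int[mu]_(t in Rpos) (((a < t)%R%:R * (expR (- t) * h t))%:E -
      ((b < t)%R%:R * (expR (- t) * h t))%:E))%E.
      by apply: eq_integral => t _; rewrite EFinB.
    rewrite (integralB _ (itail a) (itail b))//.
    by rewrite !(laplace_tail_eq0 _ mh ih h0) ?sube0//; lra.
  have mab : measurable (`]a, b]%classic : set R) by exact: measurable_itv.
  have : (\int[mu]_(t in Rpos) (expR (- b) * e * \1_(`]a, b]%classic) t)%:E <=
     \int[mu]_(t in Rpos) (s%:E * ((a < t)%R%:R * (expR (- t) * h t) -
      (b < t)%R%:R * (expR (- t) * h t))%:E))%E.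
    apply: ge0_le_integral => //.
    - by move=> t _; rewrite lee_fin mulr_ge0// mulr_ge0 ?expR_ge0// ltW.
    - apply/measurable_EFinP; apply: measurable_funTS; apply: measurable_funM => //.
    - by apply: (measurable_int mu); apply: integrableZl => //; exact: iab.
    move=> t _; rewrite -EFinM lee_fin indicE mem_setE in_itv/=.
    have [at_|ta_] := ltP a t; last first.
      by rewrite ltNge (le_trans ta_ (ltW ab))/= !mul0r subrr !mulr0.
    have [bt|tb] := ltP b t; first by rewrite subrr !mulr0.
    rewrite mulr1 mul1r mul0r subr0 mulrCA.
    apply: ler_pM => //; [exact: ltW|by rewrite ler_expR lerN2|exact: H].
  rewrite (integralZl _ (iab a b))// I0 mule0.
  under eq_integral do rewrite EFinM.
  rewrite ge0_integralZl_EFin//; last 2 first.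
  - by apply/measurable_EFinP; exact: measurable_indic.
  - by rewrite mulr_ge0 ?expR_ge0// ltW.
  rewrite integral_indic//.
  have -> : `]a, b]%classic `&` Rpos = `]a, b]%classic.
    apply: setIidl => t; rewrite /= !in_itv/= andbT => /andP[at_ _].
    exact: ltW (lt_trans a0 at_).
  have muab : mu (`]a, b]%classic : set R) = (b - a)%:E.
    by rewrite lebesgue_measure_itv/= lte_fin ab.
  move=> H1; have : ((expR (- b) * e)%:E * (b - a)%:E <= 0)%E by rewrite -muab.
  rewrite -EFinM lee_fin leNgt.
  by rewrite !mulr_gt0 ?expR_gt0// subr_gt0.
move=> t t0; apply/eqP; rewrite eq_le; apply/andP; split; rewrite leNgt; apply/negP => fg.
  pose e := (f t - g t) / 2.
  have e0 : 0 < e by rewrite divr_gt0// subr_gt0.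
  have /cvgrPdist_lt/(_ e e0)[d /= d0 Hd] := cg t t0.
  apply: (@nosign t (t + d / 2) e 1) => //; first by rewrite ltrDl divr_gt0.
  move=> y ty yt; have : `|g t - g y| < e.
    by apply: Hd; rewrite /= distrC ger0_norm; lra.
  have := ndf t y (ltW t0) (ltW ty); rewrite mul1r /h ltr_norml => ? /andP[? ?].
  have : 2 * e = f t - g t by rewrite /e; field.
  lra.
pose e := (g t - f t) / 2.
have e0 : 0 < e by rewrite divr_gt0// subr_gt0.
have /cvgrPdist_lt/(_ e e0)[d /= d0 Hd] := cg t t0.
(* The maximum with [t / 2] keeps the interval inside the positive reals. *)
pose m := Num.max (t / 2) (t - d / 2).
have mt : m < t by rewrite /m gt_max; apply/andP; split; lra.
have m0 : 0 < m by rewrite /m lt_max divr_gt0.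
apply: (@nosign m t e (-1)) => // y my yt.
have : t - d / 2 <= m by rewrite /m le_max lexx orbT.
move=> dm; have : `|g t - g y| < e.
  by apply: Hd; rewrite /= ger0_norm; lra.
have := ndf y t (ltW (lt_trans m0 my)) yt; rewrite mulN1r /h ltr_norml => ? /andP[? ?].
have : 2 * e = g t - f t by rewrite /e; field.
lra.
Qed.

End LaplaceUniqueness.

(** * Stable subordinators and the occupation measure of their inverses *)

Section HalfLine.
Context {R : realType}.
Local Notation mu := (@lebesgue_measure R).
Local Notation Rpos := (`[0%R, +oo[%classic : set R).

(** Trading the half line for an indicator lets Tonelli be used on full product spaces. *)
Lemma integral_half_line (g : R -> \bar R) :
  (\int[mu]_(t in Rpos) g t = \int[mu]_t (((0 <= t)%R%:R)%:E * g t))%E.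
Proof.
rewrite integral_mkcond; apply: eq_integral => t _.
rewrite patchE mem_setE in_itv/= andbT; case: (0 <= t); by rewrite ?mul1e ?mul0e.
Qed.

Lemma measurable_half_line : measurable_fun setT (fun t : R => ((0 <= t)%R%:R : R)%:E).
Proof.
apply/measurable_EFinP.
apply: (eq_measurable_fun (\1_(`[0, +oo[%classic : set R) : R -> R)); last exact: measurable_indic.
by move=> t _; rewrite indicE mem_setE in_itv/= andbT.
Qed.

Lemma measurable_expRNM (v : R) : measurable_fun setT (fun t : R => expR (- (v * t))).
Proof.
by apply: continuous_measurable_fun => t; exact: is_derive_cvg (is_derive_expRNM v t).
Qed.

Lemma integral_expR_tail (a v : R) : 0 < v ->
  (\int[mu]_(t in `[a, +oo[) (expR (- (v * t)))%:E = (expR (- (v * a)) / v)%:E)%E.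
Proof.
move=> v0; pose F (t : R) := - v^-1 * expR (- (v * t)).
have dF (t : R) : is_derive t 1 F (expR (- (v * t))).
  have H := is_derive_expRNM v t.
  have -> : F = (- v^-1) \*: (fun t : R => expR (- (v * t))) by [].
  apply: is_derive_eq; rewrite /GRing.scale/= mulrA mulrNN mulVf ?mul1r//.
  by rewrite gt_eqF.
rewrite (@ge0_continuous_FTC2y _ (fun t => expR (- (v * t))) F a 0).
- by rewrite sub0e /F -EFinN mulNr opprK mulrC.
- by move=> t _; exact: expR_ge0.
- by apply: continuous_subspaceT => t; exact: is_derive_cvg (is_derive_expRNM v t).
- rewrite -[X in _ --> X](mulr0 (- v^-1)); apply: cvgM; first exact: cvg_cst.
  have /= := @cvg_comp _ _ _ (fun t : R => v * t) (fun x => expR (- x)) _ _ _ _ (@cvgr_expR R).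
  by apply; apply: gt0_cvgMry => //; exact: cvg_id.
- by move=> t _; have [] := dF t.
- exact: cvg_at_right_filter (is_derive_cvg (dF a)).
- by move=> t _; rewrite derive1E; have [] := dF t.
Qed.

End HalfLine.

Section Subordinator.
Context {d : measure_display} {T : measurableType d} {R : realType}.
Variables (P : probability T R) (nu : R) (sigma : R -> {RV P >-> R}).
Hypothesis Hsigma : stable_subordinator nu sigma.
Local Notation mu := (@lebesgue_measure R).
Local Notation Rpos := (`[0%R, +oo[%classic : set R).

(** Frozen at its initial value for negative [s], so that monotonicity and joint measurability hold
    on the whole line. *)
Let sig (s : R) (w : T) : R := sigma (Num.max s 0) w.

Let sig_ge0 s w : 0 <= sig s w.
Proof.
rewrite -(subordinator_0 Hsigma w); apply: (subordinator_nondecreasing Hsigma) => //.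
by rewrite le_max lexx orbT.
Qed.

Let sig_nd s t w : s <= t -> sig s w <= sig t w.
Proof.
move=> st; apply: (subordinator_nondecreasing Hsigma); first by rewrite le_max lexx orbT.
by rewrite ge_max !le_max st lexx orbT.
Qed.

Let sigE s w : 0 <= s -> sig s w = sigma s w.
Proof. by move=> s0; rewrite /sig max_l. Qed.

Let measurable_sig s : measurable_fun setT (sig s).
Proof. exact: measurable_funPT. Qed.

(* Right continuity: [sig s w < a] iff [sig q w < a] for some rational [q > s]. *)
Lemma measurable_subordinator2 :
  measurable_fun setT (fun z : R * T => sig z.1 z.2).
Proof.
apply: (measurability _ (RGenInftyO.measurableE R)) => _ [_ [a ->] <-].
rewrite setTI.
rewrite (_ : _ @^-1` _ = \bigcup_(q : rat) ([set s : R | s < ratr q] `*`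
    [set w : T | sig (ratr q) w < a])).
  apply: bigcupT_measurable_rat => q; apply: measurableX.
    by rewrite -set_itvNyo.
  have := measurable_sig (ratr q) measurableT (measurable_itv `]-oo, a[).
  by rewrite setTI; congr (measurable _); apply/seteqP; split => w; rewrite /= in_itv.
apply/seteqP; split => -[s w]/=; last first.
  move=> [q _ [/= sq qa]]; rewrite in_itv/=.
  by apply: le_lt_trans qa; exact: sig_nd (ltW sq).
rewrite in_itv/= => sa.
have m0 : 0 <= Num.max s 0 by rewrite le_max lexx orbT.
have H : sigma u w @[u --> (Num.max s 0)^'+] --> sig s w.
  exact: (subordinator_right_continuous Hsigma).
have as0 : 0 < a - sig s w by rewrite subr_gt0.
have /cvgrPdist_lt/(_ _ as0)[e /= e0 He] := H.
have mlt : Num.max s 0 < Num.max s 0 + e by rewrite ltrDl.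
have [q] := rat_in_itvoo mlt; rewrite in_itv/= => /andP[mq qe].
exists q => //=; split; first by apply: le_lt_trans mq; rewrite le_max lexx.
have q0 : 0 <= ratr q :> R by exact: le_trans m0 (ltW mq).
have := He (ratr q); rewrite /= ltr0_norm; last by rewrite subr_lt0.
rewrite opprB ltrBlDl => /(_ qe mq); rewrite [sig (ratr q) w]sigE//.
by rewrite distrC ltr_norml => /andP[_]; rewrite ltrD2r.
Qed.

Definition subordinator_le (s t : R) : set T := [set w | sig s w <= t].

Lemma measurable_subordinator_le s t : measurable (subordinator_le s t).
Proof.
have := measurable_sig s measurableT (measurable_itv `]-oo, t]).
by rewrite setTI; congr (measurable _); apply/seteqP; split => w; rewrite /= in_itv.
Qed.

Let A : set ((R * R) * T) := [set z | sig z.1.1 z.2 <= z.1.2].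

Let measurable_A : measurable A.
Proof.
have m1 : measurable_fun setT (fun z : (R * R) * T => sig z.1.1 z.2).
  apply: (measurableT_comp (f := fun z : R * T => sig z.1 z.2)
     (g := fun z : (R * R) * T => (z.1.1, z.2))); first exact: measurable_subordinator2.
  apply/measurable_fun_pair => //; exact: measurableT_comp.
have m2 : measurable_fun setT (fun z : (R * R) * T => z.1.2) by exact: measurableT_comp.
have := measurable_fun_ler m1 m2 measurableT (Y := [set true]) I.
by rewrite setTI.
Qed.

Lemma measurable_subordinator_cdf :
  measurable_fun setT (fun z : R * R => P (subordinator_le z.1 z.2)).
Proof.
have := measurable_fun_xsection P measurable_A; apply: eq_measurable_fun => -[s t] _ /=.
by congr (P _); apply/seteqP; split => w; rewrite /xsection /= inE.
Qed.

Lemma integral_subordinator_expR s v : 0 <= s -> 0 < v ->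
  (\int[P]_w (expR (- (v * sig s w)))%:E = (expR (- (s * v `^ nu)))%:E)%E.
Proof.
move=> s0 v0; rewrite -(subordinator_laplace Hsigma s0 v0) unlock.
by apply: eq_integral => w _; rewrite sigE.
Qed.

Lemma measurable_expR_sig v s : measurable_fun setT (fun w => expR (- (v * sig s w))).
Proof.
apply: (measurableT_comp (f := fun x : R => expR (- (v * x)))); first exact: measurable_expRNM.
exact: measurable_sig.
Qed.

(** Markov's inequality: on the event, [1 <= expR (v * (t - sig s w))]. As [v] is free, the
    exponential decay in [s] can be made as fast as desired. *)
Lemma subordinator_chernoff s t v : 0 <= s -> 0 < v ->
  (P (subordinator_le s t) <= (expR (v * t) * expR (- (s * v `^ nu)))%:E)%E.
Proof.
move=> s0 v0; rewrite EFinM -integral_subordinator_expR//.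
rewrite -ge0_integralZl//; last by apply/measurable_EFinP; exact: measurable_expR_sig.
rewrite -(setIT (subordinator_le s t)) -integral_indic//; last exact: measurable_subordinator_le.
apply: ge0_le_integral => //.
- by apply/measurable_EFinP; exact: measurable_indic (measurable_subordinator_le s t).
- by apply/measurable_EFinP; apply: measurable_funM => //; exact: measurable_expR_sig.
move=> w _; rewrite -EFinM lee_fin -expRD indicE.
have [|] := boolP (w \in subordinator_le s t); rewrite ?expR_ge0// inE => h.
by rewrite -expR0 ler_expR -mulrBr mulr_ge0 ?(ltW v0)// subr_ge0.
Qed.

(** By Tonelli the integral over [t] is taken inside: from [sig s w] on, [expR (- (v * t))]
    integrates to [expR (- (v * sig s w)) / v]. *)
Lemma laplace_subordinator_cdf s v : 0 <= s -> 0 < v ->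
  (\int[mu]_(t in Rpos) ((expR (- (v * t)))%:E * P (subordinator_le s t)) =
   (expR (- (s * v `^ nu)) / v)%:E)%E.
Proof.
move=> s0 v0.
pose f (z : R * T) := ((expR (- (v * z.1)) * \1_A ((s, z.1), z.2)))%:E.
have mf : measurable_fun setT f.
  apply/measurable_EFinP; apply: measurable_funM.
    by apply: (measurableT_comp (f := fun x : R => expR (- (v * x)))) => //; exact: measurable_expRNM.
  apply: (measurableT_comp (f := \1_A : (R * R) * T -> R)
    (g := fun z : R * T => ((s, z.1), z.2))); first exact: measurable_indic.
  by apply/measurable_fun_pair => //; apply/measurable_fun_pair.
have f0 z : (0 <= f z)%E by rewrite lee_fin mulr_ge0 ?expR_ge0.
transitivity (\int[mu]_t \int[P]_w f (t, w))%E.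
  rewrite integral_half_line; apply: eq_integral => t _.
  rewrite /f/=; under eq_integral do rewrite EFinM.
  rewrite ge0_integralZl//; last first.
    apply/measurable_EFinP.
    apply: (eq_measurable_fun (\1_(subordinator_le s t) : T -> R)).
      by move=> w _; rewrite !indicE; congr ((_ : bool)%:R); apply/idP/idP; rewrite !inE.
    exact: measurable_indic (measurable_subordinator_le s t).
  have -> : (\int[P]_w (\1_A ((s, t), w))%:E = P (subordinator_le s t))%E.
    transitivity (\int[P]_w (\1_(subordinator_le s t) w)%:E)%E; last first.
      by rewrite integral_indic ?setIT//; exact: measurable_subordinator_le.
    by apply: eq_integral => w _; rewrite !indicE.
  (* For [t < 0] the event is empty, since the subordinator is nonnegative. *)
  have [t0|t0] := leP 0 t; first by rewrite mul1e.
  rewrite mul0e [P _](_ : _ = 0%E) ?mule0//.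
  rewrite (_ : subordinator_le s t = set0) ?measure0// -subset0 => w.
  by rewrite /subordinator_le/= leNgt (lt_le_trans t0)// sig_ge0.
rewrite fubini_tonelli//.
transitivity (\int[P]_w ((v^-1)%:E * (expR (- (v * sig s w)))%:E))%E; last first.
  rewrite ge0_integralZl//; first last.
  - by rewrite lee_fin invr_ge0 ltW.
  - by apply/measurable_EFinP; exact: measurable_expR_sig.
  by rewrite integral_subordinator_expR// -EFinM mulrC.
apply: eq_integral => w _; rewrite -EFinM mulrC -integral_expR_tail//.
rewrite [in RHS]integral_mkcond; apply: eq_integral => t _.
rewrite /f/= patchE mem_setE in_itv/= andbT indicE.
have -> : (((s, t), w) \in A) = (sig s w <= t) by apply/idP/idP; rewrite inE.
by case: (sig s w <= t); rewrite ?mulr1 ?mulr0.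
Qed.

End Subordinator.

(** * Occupation integrals and their Laplace transforms *)

Section Occupation.
Context {d : measure_display} {T : measurableType d} {R : realType}.
Variables (P : probability T R) (nu : R) (sigma : R -> {RV P >-> R}).
Hypothesis nu_gt0 : 0 < nu.
Hypothesis Hsigma : stable_subordinator nu sigma.
Local Notation mu := (@lebesgue_measure R).
Local Notation Rpos := (`[0%R, +oo[%classic : set R).
Local Notation F s t := (P (subordinator_le sigma s t)).

(* The expectation of the integral of [phi] over [0, L], where [L] is the
   inverse subordinator at time [t]. *)
Definition occupation (phi : R -> R) (t : R) : \bar R :=
  (\int[mu]_(s in Rpos) ((phi s)%:E * F s t))%E.

Lemma measurable_cdf_left t : measurable_fun setT (fun s => F s t).
Proof.
apply: (measurableT_comp (f := fun z : R * R => F z.1 z.2) (g := fun s => (s, t))).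
  exact: measurable_subordinator_cdf Hsigma.
by apply/measurable_fun_pair.
Qed.

Lemma measurable_cdf_right s : measurable_fun setT (fun t => F s t).
Proof.
apply: (measurableT_comp (f := fun z : R * R => F z.1 z.2) (g := fun t => (s, t))).
  exact: measurable_subordinator_cdf Hsigma.
by apply/measurable_fun_pair.
Qed.

Lemma measurable_occupation_integrand (phi : R -> R) (t : R) : measurable_fun setT phi ->
  measurable_fun setT (fun s => (phi s)%:E * F s t)%E.
Proof.
move=> mphi; apply: emeasurable_funM; first exact/measurable_EFinP.
exact: measurable_cdf_left.
Qed.

Let phiR (phi : R -> R) (s : R) : R := (0 <= s)%R%:R * phi s.

Let occupationE (phi : R -> R) (t : R) : (forall s : R, 0 <= s -> 0 <= phi s) ->
  (occupation phi t = \int[mu]_s ((phiR phi s)%:E * F s t))%E.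
Proof.
move=> phi0; rewrite /occupation integral_half_line; apply: eq_integral => s _.
by rewrite /phiR EFinM muleA.
Qed.

Let phiR_ge0 (phi : R -> R) (s : R) : (forall s : R, 0 <= s -> 0 <= phi s) -> 0 <= phiR phi s.
Proof.
move=> phi0; rewrite /phiR; have [s0|s0] := leP 0 s; last by rewrite mul0r.
by rewrite mul1r phi0.
Qed.

Let measurable_phiR (phi : R -> R) : measurable_fun setT phi -> measurable_fun setT (phiR phi).
Proof.
move=> mphi; apply: measurable_funM => //.
by apply/measurable_EFinP; exact: measurable_half_line.
Qed.

Let measurable_kernel (phi : R -> R) : measurable_fun setT phi ->
  measurable_fun setT (fun z : R * R => (phiR phi z.2)%:E * F z.2 z.1)%E.
Proof.
move=> mphi; apply: emeasurable_funM.
  apply/measurable_EFinP.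
  by apply: (measurableT_comp (f := phiR phi)) => //; exact: measurable_phiR.
apply: (measurableT_comp (f := fun z : R * R => F z.1 z.2) (g := fun z => (z.2, z.1))).
  exact: measurable_subordinator_cdf Hsigma.
by apply/measurable_fun_pair.
Qed.

Lemma measurable_occupation (phi : R -> R) : measurable_fun setT phi ->
  (forall s : R, 0 <= s -> 0 <= phi s) -> measurable_fun setT (occupation phi).
Proof.
move=> mphi phi0.
have := @measurable_fun_fubini_tonelli_F _ _ _ _ _ mu _ (measurable_kernel mphi).
have k0 z : (0 <= (phiR phi z.2)%:E * F z.2 z.1)%E.
  by rewrite mule_ge0// lee_fin phiR_ge0.
move=> /(_ k0); apply: eq_measurable_fun => t _.
by rewrite /fubini_F/= occupationE.
Qed.

Lemma occupation_ge0 (phi : R -> R) (t : R) : (forall s : R, 0 <= s -> 0 <= phi s) ->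
  (0 <= occupation phi t)%E.
Proof.
move=> phi0; apply: integral_ge0 => s; rewrite /= in_itv/= andbT => s0.
by rewrite mule_ge0// lee_fin phi0.
Qed.

Lemma laplace_occupation (phi : R -> R) (v : R) : 0 < v -> measurable_fun setT phi ->
  (forall s : R, 0 <= s -> 0 <= phi s) ->
  (\int[mu]_(t in Rpos) ((expR (- (v * t)))%:E * occupation phi t) =
   \int[mu]_(s in Rpos) (phi s * (expR (- (s * v `^ nu)) / v))%:E)%E.
Proof.
move=> v0 mphi phi0.
pose e (t : R) := (0 <= t)%R%:R * expR (- (v * t)).
have e0 t : 0 <= e t by rewrite mulr_ge0 ?expR_ge0.
have me : measurable_fun setT e.
  apply: measurable_funM; last exact: measurable_expRNM.
  by apply/measurable_EFinP; exact: measurable_half_line.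
pose f (z : R * R) := ((e z.1)%:E * ((phiR phi z.2)%:E * F z.2 z.1))%E.
have f0 z : (0 <= f z)%E by rewrite !mule_ge0 ?lee_fin// phiR_ge0.
have mf : measurable_fun setT f.
  apply: emeasurable_funM; last exact: measurable_kernel.
  by apply/measurable_EFinP; apply: (measurableT_comp (f := e)).
transitivity (\int[mu]_t \int[mu]_s f (t, s))%E.
  rewrite integral_half_line; apply: eq_integral => t _.
  rewrite occupationE// muleA -EFinM -ge0_integralZl//.
  - by apply: measurable_occupation_integrand; exact: measurable_phiR.
  - by move=> s _; rewrite mule_ge0// lee_fin phiR_ge0.
rewrite fubini_tonelli// [in RHS]integral_half_line; apply: eq_integral => s _.
have [s0|s0] := leP 0 s; last first.
  rewrite mul0e; apply: integral0_eq => t _.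
  by rewrite /f/= /phiR leNgt s0/= mul0r mul0e mule0.
rewrite mul1e EFinM -(laplace_subordinator_cdf Hsigma s0 v0) -ge0_integralZl//; last 3 first.
- apply: measurable_funTS; apply: emeasurable_funM.
    by apply/measurable_EFinP; exact: measurable_expRNM.
  exact: measurable_cdf_right.
- by move=> t _; rewrite mule_ge0// lee_fin expR_ge0.
- by rewrite lee_fin phi0.
rewrite [in RHS]integral_half_line; apply: eq_integral => t _.
by rewrite /f/= /e /phiR s0 mul1r EFinM -!muleA; congr (_ * _)%E; rewrite muleCA.
Qed.

End Occupation.

Section OccupationMoments.
Context {d : measure_display} {T : measurableType d} {R : realType}.
Variables (P : probability T R) (nu : R) (sigma : R -> {RV P >-> R}).
Hypothesis nu_gt0 : 0 < nu.
Hypothesis Hsigma : stable_subordinator nu sigma.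
Local Notation mu := (@lebesgue_measure R).
Local Notation Rpos := (`[0%R, +oo[%classic : set R).
Local Notation F s t := (P (subordinator_le sigma s t)).
Local Notation occ := (occupation sigma).

Lemma erlang_densityM (x y : R) j s :
  erlang_density x j s * expR (- (s * y)) = erlang_density (x + y) j s.
Proof.
rewrite /erlang_density -mulrA -expRD; congr (_ * expR _); ring.
Qed.

Lemma measurable_erlang_density (x : R) j : measurable_fun setT (erlang_density x j).
Proof. by apply: continuous_measurable_fun; exact: continuous_erlang_density. Qed.

(** The rate [x] may be negative: with [v ^ nu = |x| + 1] the Chernoff factor turns the density into
    one of positive rate [x + v ^ nu]. Negative rates supply the dominating function of the
    Mittag-Leffler expansion. *)
Lemma occupation_erlang_lty (x t : R) j : (occ (erlang_density x j) t < +oo)%E.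
Proof.
pose v := (`|x| + 1) `^ nu^-1.
have x1 : 0 < `|x| + 1 by rewrite ltr_wpDl.
have v0 : 0 < v by exact: powR_gt0.
have vnu : v `^ nu = `|x| + 1 by rewrite /v -powRrM mulVf ?gt_eqF// powRr1// ltW.
have xv : 0 < x + v `^ nu by rewrite vnu; have := lerNnormlW (lexx `|x|); lra.
have me := measurable_erlang_density.
apply: (@le_lt_trans _ _ (\int[mu]_(s in Rpos)
    ((expR (v * t))%:E * (erlang_density (x + v `^ nu) j s)%:E))%E).
  apply: ge0_le_integral => //.
  - move=> s; rewrite /= in_itv/= andbT => s0.
    by rewrite mule_ge0// lee_fin erlang_density_ge0.
  - by apply: measurable_funTS; apply: (measurable_occupation_integrand Hsigma); exact: me.
  - apply: measurable_funTS; apply: emeasurable_funM => //.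
    by apply/measurable_EFinP; exact: me.
  move=> s; rewrite /= in_itv/= andbT => s0.
  apply: (le_trans (lee_wpmul2l _ (subordinator_chernoff Hsigma t s0 v0))).
    by rewrite lee_fin erlang_density_ge0.
  by rewrite -!EFinM lee_fin -erlang_densityM mulrCA.
rewrite ge0_integralZl//.
- by rewrite integral_erlang_densityy// -EFinM ltry.
- by apply: measurable_funTS; apply/measurable_EFinP; exact: me.
- by move=> s; rewrite /= in_itv/= andbT => s0; rewrite lee_fin erlang_density_ge0.
Qed.

Lemma laplace_occupation_erlang (x v : R) j : 0 <= x -> 0 < v ->
  (\int[mu]_(t in Rpos) ((expR (- (v * t)))%:E * occ (erlang_density x j) t) =
   (v^-1 * ((x + v `^ nu) ^+ j.+1)^-1)%:E)%E.
Proof.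
move=> x0 v0; have xv : 0 < x + v `^ nu by rewrite ltr_wpDl// powR_gt0.
rewrite (laplace_occupation Hsigma v0 (measurable_erlang_density x j)); last first.
  by move=> s s0; exact: erlang_density_ge0.
rewrite EFinM -(integral_erlang_densityy xv) -ge0_integralZl//.
- by apply: eq_integral => s _; rewrite mulrA erlang_densityM -EFinM mulrC.
- by apply: measurable_funTS; apply/measurable_EFinP; exact: measurable_erlang_density.
- by move=> s; rewrite /= in_itv/= andbT => s0; rewrite lee_fin erlang_density_ge0.
- by rewrite lee_fin invr_ge0 ltW.
Qed.

Lemma occupation_nd (phi : R -> R) (s t : R) : measurable_fun setT phi ->
  (forall u : R, 0 <= u -> 0 <= phi u) -> s <= t -> (occ phi s <= occ phi t)%E.
Proof.
move=> mphi phi0 st; apply: ge0_le_integral => //.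
- by move=> u; rewrite /= in_itv/= andbT => u0; rewrite mule_ge0// lee_fin phi0.
- by apply: measurable_funTS; exact: (measurable_occupation_integrand Hsigma).
- by apply: measurable_funTS; exact: (measurable_occupation_integrand Hsigma).
move=> u; rewrite /= in_itv/= andbT => u0; apply: lee_wpmul2l; first by rewrite lee_fin phi0.
apply: le_measure; rewrite ?inE; try exact: measurable_subordinator_le.
by move=> w; rewrite /subordinator_le/= => /le_trans; exact.
Qed.

(** The left side is nondecreasing and the right side continuous in [t], as uniqueness of transforms
    demands. [Gamma] stays a factor on the left side in the comparison, because its nonvanishing is
    a consequence: the product equals [1] at time [1]. *)
Lemma occupation_moment j (t : R) : 0 <= t ->
  occ (erlang_density 0 j) t =
    (t `^ (nu * j.+1%:R) / Gamma (nu * j.+1%:R + 1))%:E.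
Proof.
pose a := nu * j.+1%:R; pose G := Gamma (a + 1).
have a0 : 0 < a by rewrite mulr_gt0.
have e0 (s : R) : 0 <= s -> 0 <= erlang_density (0 : R) j s by exact: erlang_density_ge0.
have me := @measurable_erlang_density 0 j.
have ofin u : occ (erlang_density 0 j) u \is a fin_num.
  by rewrite ge0_fin_numE ?occupation_erlang_lty// occupation_ge0.
pose h u := fine (occ (erlang_density 0 j) u).
have h0 u : 0 <= h u by apply: fine_ge0; exact: occupation_ge0.
have hnd (s u : R) : s <= u -> h s <= h u.
  by move=> su; apply: fine_le => //; exact: occupation_nd.
have G0 : 0 <= G.
  by apply: fine_ge0; apply: integral_ge0 => u _; rewrite lee_fin mulr_ge0 ?powR_ge0 ?expR_ge0.
have mh : measurable_fun setT h.
  by apply: measurableT_comp => //; exact: (measurable_occupation Hsigma).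
have Lh (v : R) : 0 < v -> (\int[mu]_(u in Rpos) (expR (- (v * u)) * (G * h u))%:E =
    (G * (v `^ (a + 1))^-1)%:E)%E.
  move=> v0; transitivity (\int[mu]_(u in Rpos) (G%:E * ((expR (- (v * u)))%:E *
      occ (erlang_density 0 j) u)))%E.
    by apply: eq_integral => u _; rewrite -(fineK (ofin u)) -!EFinM mulrCA.
  rewrite ge0_integralZl//.
  - rewrite laplace_occupation_erlang// -EFinM add0r -powR_mulrn ?powR_ge0//.
    rewrite -powRrM -/a powRD ?powRr1 ?(ltW v0)// ?(gt_eqF v0) ?implybT// invfM.
    by rewrite (mulrC (v^-1)).
  - apply: measurable_funTS; apply: emeasurable_funM; last exact: (measurable_occupation Hsigma).
    by apply/measurable_EFinP; exact: measurable_expRNM.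
  - by move=> u _; rewrite mule_ge0 ?lee_fin ?expR_ge0// occupation_ge0.
have Gh (u : R) : 0 < u -> G * h u = u `^ a.
  move=> u0; apply: (@laplace_unique R (fun u => G * h u) (fun u => u `^ a)) => //.
  - exact: measurable_funM.
  - by move=> s s' s0 ss'; apply: ler_wpM2l => //; exact: hnd.
  - by move=> s _; rewrite mulr_ge0.
  - by move=> s _; exact: powR_ge0.
  - move=> s s0; have D : derivable (fun y : R => y `^ a) s 1.
      by apply: derivable_powR; rewrite in_itv/= s0.
    exact: (is_derive_cvg (derivableP D)).
  - by move=> v v0; rewrite Lh// ltry.
  - move=> v v0; rewrite Lh// -laplace_powR//.
    by apply: eq_integral => s _; rewrite mulrC.
have G0' : G != 0.
  by apply/eqP => G00; have := Gh 1 ltr01; rewrite G00 mul0r powR1 => /eqP; rewrite eq_sym oner_eq0.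
move=> t0; rewrite -(fineK (ofin t)) -/(h t) -/a -/G; congr EFin.
have [t_gt0|] := ltP 0 t; first by rewrite -Gh// mulrC mulKf.
(* Uniqueness covers positive times only; at [0] the value is squeezed by monotonicity and the limit
   of [u ^ a]. *)
move=> t_le0; have -> : t = 0 by apply/eqP; rewrite eq_le t0 t_le0.
rewrite powR0 ?gt_eqF// mul0r; apply/eqP; rewrite eq_le h0 andbT.
have Gp : 0 < G by rewrite lt_neqAle eq_sym G0'.
rewrite -(pmulr_rle0 _ Gp).
apply: (cvgr_to_ge (powR_cvg0 a0)); near=> u.
have u0 : 0 < u by [].
by rewrite -Gh//; apply: ler_wpM2l => //; apply: hnd; exact: ltW.
Unshelve. all: by end_near. Qed.

End OccupationMoments.

(** * Mittag-Leffler form of the occupation integrals *)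

Section OccupationMittagLeffler.
Context {d : measure_display} {T : measurableType d} {R : realType}.
Variables (P : probability T R) (nu : R) (sigma : R -> {RV P >-> R}).
Hypothesis nu_gt0 : 0 < nu.
Hypothesis Hsigma : stable_subordinator nu sigma.
Local Notation mu := (@lebesgue_measure R).
Local Notation Rpos := (`[0%R, +oo[%classic : set R).
Local Notation F s t := (P (subordinator_le sigma s t)).
Local Notation occ := (occupation sigma).

Let f (t s : R) : R := fine (F s t).

Let fE t s : F s t = (f t s)%:E.
Proof. by rewrite fineK// fin_num_measure//; exact: measurable_subordinator_le. Qed.

Let f_ge0 t s : 0 <= f t s.
Proof. exact: fine_ge0. Qed.

Let measurable_f t : measurable_fun setT (f t).
Proof. by apply: measurableT_comp => //; exact: (measurable_cdf_left Hsigma). Qed.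

Lemma integrable_occupation_erlang (x t : R) j :
  mu.-integrable Rpos (fun s => (erlang_density x j s * f t s)%:E).
Proof.
apply/integrableP; split.
  apply: measurable_funTS; apply/measurable_EFinP;
    apply: measurable_funM; [exact: measurable_erlang_density|exact: measurable_f].
apply: le_lt_trans (occupation_erlang_lty nu_gt0 Hsigma x t j).
rewrite le_eqVlt; apply/orP; left; apply/eqP; apply: eq_integral => s.
rewrite inE/= in_itv/= andbT => s0.
rewrite ger0_norm; first by rewrite (EFinM (erlang_density x j s)) -fE.
by rewrite mulr_ge0 ?f_ge0// erlang_density_ge0.
Qed.

Lemma occupation_erlangE (x t : R) j : occ (erlang_density x j) t =
  (\int[mu]_(s in Rpos) (erlang_density x j s * f t s)%:E)%E.
Proof. by apply: eq_integral => s _; rewrite (EFinM (erlang_density x j s)) -fE. Qed.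

Lemma occupation_erlang_fin_num (x t : R) j : occ (erlang_density x j) t \is a fin_num.
Proof.
by rewrite occupation_erlangE; apply: integrable_fin_num => //; exact: integrable_occupation_erlang.
Qed.

Lemma exp_partial_sum_le (y : R) n : 0 <= y -> \sum_(i < n) y ^+ i / i`!%:R <= expR y.
Proof.
move=> y0; rewrite -(big_mkord xpredT (fun i => y ^+ i / i`!%:R)).
apply: (sum_seq_le_nneseries (h := fun i => y ^+ i / i`!%:R)) (nneseries_exp y).
  exact: iota_uniq.
by move=> i; rewrite divr_ge0// exprn_ge0.
Qed.

(** Expanding [expR (- (x * s))] turns the integrand into multiples of the densities of rate [0],
    whose occupation integrals are known. The terms alternate in sign, and the partial sums are
    dominated by the density of rate [- x]. *)
Lemma occupation_erlang_series (x t : R) j : 0 <= x -> 0 <= t ->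
  series (fun i => (- x) ^+ i * (i + j)`!%:R / (i`!%:R * j`!%:R) *
    (t `^ (nu * (i + j).+1%:R) / Gamma (nu * (i + j).+1%:R + 1))) @ \oo
  --> fine (occ (erlang_density x j) t).
Proof.
move=> x0 t0.
have fact_neq0 n : n`!%:R != 0 :> R by rewrite pnatr_eq0 -lt0n fact_gt0.
pose c i : R := (- x) ^+ i * (i + j)`!%:R / (i`!%:R * j`!%:R).
pose g n (s : R) : R := (\sum_(i < n) (- (x * s)) ^+ i / i`!%:R) * (s ^+ j / j`!%:R) * f t s.
have gE n s : g n s = \sum_(i < n) c i * (erlang_density 0 (i + j) s * f t s).
  rewrite /g !mulr_suml; apply: eq_bigr => i _.
  rewrite /c /erlang_density mul0r oppr0 expR0 mulr1 exprD -mulNr exprMn.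
  have f1 := fact_neq0 i; have f2 := fact_neq0 j; have f3 := fact_neq0 (i + j)%N.
  by field; rewrite f1 f2 f3.
have ig := integrable_occupation_erlang.
have int_g n : (\int[mu]_(s in Rpos) (g n s)%:E = (\sum_(i < n) c i *
    (t `^ (nu * (i + j).+1%:R) / Gamma (nu * (i + j).+1%:R + 1)))%:E)%E.
  transitivity (\int[mu]_(s in Rpos) \sum_(i < n)
      ((c i)%:E * (erlang_density 0 (i + j) s * f t s)%:E))%E.
    by apply: eq_integral => s _; rewrite gE -sumEFin.
  rewrite integral_sum//.
    rewrite -sumEFin; apply: eq_bigr => i _.
    by rewrite integralZl// -occupation_erlangE (occupation_moment nu_gt0 Hsigma)// -EFinM.
  by move=> i; exact: integrableZl.
have [||||| _ _ H] := @dominated_convergence _ _ _ mu Rpos (measurable_itv _)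
  (fun n s => (g n s)%:E) (fun s => (erlang_density x j s * f t s)%:E)
  (fun s => (erlang_density (- x) j s * f t s)%:E).
- move=> n; apply: measurable_funTS; apply/measurable_EFinP.
  apply: (eq_measurable_fun (fun s => \sum_(i < n) c i * (erlang_density 0 (i + j) s * f t s))).
    by move=> s _; rewrite gE.
  apply: measurable_sum => i; apply: measurable_funM => //;
    apply: measurable_funM; [exact: measurable_erlang_density|exact: measurable_f].
- apply: measurable_funTS; apply/measurable_EFinP;
    apply: measurable_funM; [exact: measurable_erlang_density|exact: measurable_f].
- apply: aeW => s _; apply: cvg_EFin; first exact: nearW.
  apply: cvgM; last exact: cvg_cst.
  rewrite /erlang_density [X in _ --> X]mulrC; apply: cvgM; last exact: cvg_cst.
  have -> : (fun n => \sum_(i < n) (- (x * s)) ^+ i / i`!%:R) =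
      series (exp_coeff (- (x * s))).
    by apply/funext => n; rewrite /series/= big_mkord.
  exact: is_cvg_series_exp_coeff.
- exact: ig.
- apply: aeW => s n; rewrite /= in_itv/= andbT => s0.
  rewrite lee_fin /g /erlang_density mulNr opprK 2!normrM !(ger0_norm (f_ge0 _ _)).
  rewrite (ger0_norm (x := s ^+ j / _)) ?divr_ge0 ?exprn_ge0// ler_wpM2r//.
  rewrite mulrC ler_wpM2l ?divr_ge0 ?exprn_ge0//.
  apply: le_trans (exp_partial_sum_le n (mulr_ge0 x0 s0)).
  apply: le_trans (ler_norm_sum _ _ _) _; apply: ler_sum => i _.
  by rewrite normf_div normrX normrN (ger0_norm (mulr_ge0 x0 s0)) (ger0_norm (ler0n _ _)).
rewrite occupation_erlangE.
have /fine_cvgP[_] : (\int[mu]_(s in Rpos) (g n s)%:E)%E @[n --> \oo] -->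
    (fine (\int[mu]_(s in Rpos) (erlang_density x j s * f t s)%:E))%:E.
  by rewrite fineK// -occupation_erlangE occupation_erlang_fin_num.
apply: cvg_trans; apply: near_eq_cvg; apply: nearW => n /=.
by rewrite int_g /series/= big_mkord.
Qed.

(** [mittag_leffler] is a [limn], so the equality is read off from the convergent moment series
    divided by [t ^ (nu * j.+1)]. The division requires [t > 0]; at [t = 0] both sides vanish. *)
Lemma occupation_mittag_leffler (x t : R) j : 0 <= x -> 0 <= t ->
  occ (erlang_density x j) t =
  (t `^ (nu * j.+1%:R) *
   mittag_leffler nu (nu * j.+1%:R + 1) j.+1%:R (- x * t `^ nu))%:E.
Proof.
move=> x0 t0; rewrite -(fineK (occupation_erlang_fin_num x t j)); congr EFin.
have [t_gt0|t_le0] := ltP 0 t; last first.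
  have -> : t = 0 by apply/eqP; rewrite eq_le t0 t_le0.
  have a0 : nu * j.+1%:R != 0 by rewrite gt_eqF// mulr_gt0.
  rewrite powR0// mul0r; apply/eqP; rewrite eq_le fine_ge0 ?andbT; last first.
    by apply: occupation_ge0 => s; exact: erlang_density_ge0.
  rewrite -lee_fin fineK ?occupation_erlang_fin_num//.
  (* The density of rate [0] dominates that of rate [x], and its occupation integral is explicit. *)
  rewrite -[leRHS](_ : occ (erlang_density 0 j) 0 = 0%E); last first.
    by rewrite (occupation_moment nu_gt0 Hsigma)// powR0// mul0r.
  rewrite !occupation_erlangE; apply: ge0_le_integral => //.
  - by move=> s; rewrite /= in_itv/= andbT => s0; rewrite lee_fin mulr_ge0 ?erlang_density_ge0 ?f_ge0.
  - apply: measurable_funTS; apply/measurable_EFinP;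
    apply: measurable_funM; [exact: measurable_erlang_density|exact: measurable_f].
  - apply: measurable_funTS; apply/measurable_EFinP;
    apply: measurable_funM; [exact: measurable_erlang_density|exact: measurable_f].
  move=> s; rewrite /= in_itv/= andbT => s0; rewrite lee_fin ler_wpM2r ?f_ge0//.
  rewrite /erlang_density ler_wpM2l ?divr_ge0 ?exprn_ge0//.
  by rewrite mul0r oppr0 ler_expR lerNl oppr0 mulr_ge0.
pose e := nu * j.+1%:R.
have te : t `^ e != 0 by rewrite gt_eqF// powR_gt0.
have fact_neq0 n : n`!%:R != 0 :> R by rewrite pnatr_eq0 -lt0n fact_gt0.
have H := @occupation_erlang_series x t j x0 t0.
apply: (mulfI (invr_neq0 te)); rewrite mulKf//.
apply/esym/cvg_lim => //.
have {}H : (t `^ e)^-1 * series (fun i => (- x) ^+ i * (i + j)`!%:R / (i`!%:R * j`!%:R) *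
    (t `^ (nu * (i + j).+1%:R) / Gamma (nu * (i + j).+1%:R + 1))) n @[n --> \oo]
  --> (t `^ e)^-1 * fine (occ (erlang_density x j) t).
  by apply: cvgM => //; exact: cvg_cst.
apply: cvg_trans H; apply: near_eq_cvg; apply: nearW => n.
rewrite /series/= mulr_sumr; apply: eq_bigr => i _.
have -> : nu * (i + j).+1%:R = nu * i%:R + e.
  by rewrite /e -mulrDr -natrD addnS.
have -> : nu * i%:R + (nu * j.+1%:R + 1) = nu * i%:R + e + 1 by rewrite addrA.
have -> : j.+1%:R + i%:R = (i + j)%:R + 1 :> R by rewrite natr1 -natrD addSn addnC.
have -> : Gamma j.+1%:R = j`!%:R :> R by rewrite -natr1 GammaS_nat.
rewrite GammaS_nat powRD; last by rewrite (gt_eqF t_gt0) implybT.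
rewrite exprMn powRrM powR_mulrn ?powR_ge0//.
move: (Gamma _) => G.
transitivity (((t `^ e)^-1 * t `^ e) *
   ((- x) ^+ i * (i + j)`!%:R / (i`!%:R * j`!%:R) * (t `^ nu ^+ i / G))).
  by ring.
by rewrite mulVf// mul1r !invfM; ring.
Qed.

End OccupationMittagLeffler.

(** * Sampling at an independent random time *)

Lemma measurable_nneseries {d : measure_display} {T : measurableType d} {R : realType}
    (h : nat -> T -> \bar R) : (forall k x, 0 <= h k x)%E ->
  (forall k, measurable_fun setT (h k)) ->
  measurable_fun setT (fun x => \sum_(k <oo) h k x)%E.
Proof.
move=> h0 mh; apply: (emeasurable_fun_cvg (fun n x => \sum_(0 <= k < n) h k x)%E).
  by move=> n; exact: emeasurable_sum.
by move=> x _; apply: is_cvg_nneseries => k _ _.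
Qed.

Section RandomTime.
Context {d : measure_display} {T : measurableType d} {R : realType}.
Variables (P : probability T R) (L : T -> R) (J : nat -> T -> nat).
Let grid n j : R := j%:R / 2 ^+ n.
Hypothesis L_ge0 : forall w, 0 <= L w.
Hypothesis JL : forall n w, L w <= grid n (J n w) <= L w + (2 ^+ n)^-1.
Hypothesis measurable_J : forall n j, measurable [set w | J n w = j].

Let cvg_grid w : grid n (J n w) @[n --> \oo] --> L w.
Proof.
apply: (@squeeze_cvgr _ _ _ _ (cst (L w)) (fun n => L w + (2 ^+ n)^-1)).
- by apply: nearW => n; exact: JL.
- exact: cvg_cst.
- rewrite -[X in _ --> X]addr0; apply: cvgD; first exact: cvg_cst.
  under eq_fun do rewrite -exprVn.
  by apply: cvg_expr; rewrite ger0_norm ?invr_ge0// invf_lt1// ltr1n.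
Qed.

(* Right continuity transfers from the real line to the grid points, which
   approach [L w] from the right or hit it. *)
Let near_grid w (A : R -> Prop) : A (L w) -> (\forall s \near (L w)^'+, A s) ->
  \forall n \near \oo, A (grid n (J n w)).
Proof.
move=> AL [e /= e0 He].
have /cvgrPdist_lt/(_ e e0) := @cvg_grid w; apply: filterS => n Hn.
have /andP[Ln _] := JL n w; move: Ln; rewrite le_eqVlt => /predU1P[<-//|Ln].
exact: He.
Qed.

(** A value read at the random index becomes a countable sum over fixed indices; measurability and
    independence are then used term by term. *)
Let series_pick n w (g : nat -> \bar R) : (forall j, 0 <= g j)%E ->
  (\sum_(j <oo) ((\1_[set w | J n w = j] w)%:E * g j) = g (J n w))%E.
Proof.
move=> g0; rewrite (@nneseries_single _ _ (J n w)); last first.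
  move=> j jJ; rewrite indicE memNset ?mul0e//=.
  by move=> Jj; rewrite -Jj eqxx in jJ.
by rewrite indicE mem_set// mul1e.
Qed.

Lemma measurable_random_time : measurable_fun setT L.
Proof.
apply/measurable_EFinP.
apply: (emeasurable_fun_cvg (fun n w => (grid n (J n w))%:E)); last first.
  by move=> w _; apply: cvg_EFin; [exact: nearW|exact: cvg_grid].
move=> n; apply: (eq_measurable_fun (fun w => (
    \sum_(j <oo) ((\1_[set w | J n w = j] w)%:E * (grid n j)%:E))%E)).
  by move=> w _; rewrite series_pick// => j; rewrite lee_fin divr_ge0// exprn_ge0.
apply: measurable_nneseries => [j w|j].
  by rewrite mule_ge0 ?lee_fin// divr_ge0// exprn_ge0.
by apply: emeasurable_funM => //; apply/measurable_EFinP; exact: measurable_indic.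
Qed.

Section Sampling.
Variables (A : R -> set T) (a : R -> R).
Hypothesis measurable_sample : forall u, 0 <= u -> measurable (A u).
Hypothesis sample_law : forall u, 0 <= u -> P (A u) = (a u)%:E.
Hypothesis sample_rc : forall u w, 0 <= u -> \forall s \near u^'+, A s w <-> A u w.
Hypothesis law_rc : forall u, 0 <= u -> a s @[s --> u^'+] --> a u.
Hypothesis sample_indep : forall n j,
  P (A (grid n j) `&` [set w | J n w = j]) =
  (P (A (grid n j)) * P [set w | J n w = j])%E.

Let grid_ge0 n j : 0 <= grid n j.
Proof. by rewrite divr_ge0// exprn_ge0. Qed.

Let a_ge0 u : 0 <= u -> 0 <= a u.
Proof. by move=> u0; rewrite -lee_fin -sample_law. Qed.

Let a_le1 u : 0 <= u -> a u <= 1.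
Proof.
by move=> u0; rewrite -lee_fin -sample_law//; apply: probability_le1; exact: measurable_sample.
Qed.

Let sample_cvg w : (\1_(A (grid n (J n w))) w)%:E @[n --> \oo] -->
  (\1_[set w | A (L w) w] w : R)%:E.
Proof.
apply: cvg_near_cst.
have := @near_grid w (fun s => A s w <-> A (L w) w) (iff_refl _) (sample_rc _ (L_ge0 w)).
apply: filterS => n h; rewrite !indicE; congr ((_ : bool)%:R%:E).
by apply/idP/idP; rewrite !inE/= => /h.
Qed.

Let law_cvg w : (a (grid n (J n w)))%:E @[n --> \oo] --> (a (L w))%:E.
Proof.
apply: cvg_EFin; first exact: nearW.
apply/cvgrPdist_lt => e e0.
apply: (@near_grid w (fun s => `|a (L w) - a s| < e)); first by rewrite subrr normr0.
by have /cvgrPdist_lt/(_ e e0) := law_rc (L_ge0 w).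
Qed.

Let measurable_sample_step n : measurable_fun setT
  (fun w => (\1_(A (grid n (J n w))) w : R)%:E).
Proof.
apply: (eq_measurable_fun (fun w => (
    \sum_(j <oo) ((\1_[set w | J n w = j] w)%:E * (\1_(A (grid n j)) w)%:E))%E)).
  by move=> w _; rewrite (series_pick _ _ (g := fun j => (\1_(A (grid n j)) w)%:E)).
apply: measurable_nneseries => [j w|j]; first by rewrite mule_ge0.
apply: emeasurable_funM; apply/measurable_EFinP; apply: measurable_indic => //.
exact: measurable_sample.
Qed.

Let measurable_law_step n : measurable_fun setT (fun w => (a (grid n (J n w)))%:E).
Proof.
apply: (eq_measurable_fun (fun w => (
    \sum_(j <oo) ((\1_[set w | J n w = j] w)%:E * (a (grid n j))%:E))%E)).
  by move=> w _; rewrite series_pick// => j; rewrite lee_fin a_ge0.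
apply: measurable_nneseries => [j w|j]; first by rewrite mule_ge0// lee_fin a_ge0.
by apply: emeasurable_funM => //; apply/measurable_EFinP; exact: measurable_indic.
Qed.

Let integral_step n : (\int[P]_w (\1_(A (grid n (J n w))) w)%:E =
  \int[P]_w (a (grid n (J n w)))%:E)%E.
Proof.
transitivity (\int[P]_w \sum_(j <oo) ((\1_[set w | J n w = j] w)%:E * (\1_(A (grid n j)) w)%:E))%E.
  apply: eq_integral => w _.
  by rewrite (series_pick _ _ (g := fun j => (\1_(A (grid n j)) w)%:E)).
transitivity (\int[P]_w \sum_(j <oo) ((\1_[set w | J n w = j] w)%:E * (a (grid n j))%:E))%E; last first.
  by apply: eq_integral => w _; rewrite series_pick// => j; rewrite lee_fin a_ge0.
rewrite !integral_nneseries//.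
- apply: eq_eseriesr => j _.
  transitivity (P (A (grid n j) `&` [set w | J n w = j])).
    rewrite -(setIT (_ `&` _)) -integral_indic//; last first.
      by apply: measurableI => //; exact: measurable_sample.
    by apply: eq_integral => w _; rewrite -EFinM indicI mulrC.
  rewrite sample_indep sample_law// -[X in (_ * P X)%E](setIT) -integral_indic//.
  rewrite -ge0_integralZl//.
  + by apply: eq_integral => w _; rewrite muleC.
  + by apply/measurable_EFinP; exact: measurable_indic.
  + by rewrite lee_fin a_ge0.
- move=> j; by apply: emeasurable_funM => //; apply/measurable_EFinP; exact: measurable_indic.
- by move=> j w _; rewrite mule_ge0// lee_fin a_ge0.
- move=> j; apply: emeasurable_funM; apply/measurable_EFinP; apply: measurable_indic => //.
  exact: measurable_sample.
Qed.

Lemma measurable_law_random_time : measurable_fun setT (fun w => (a (L w))%:E).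
Proof.
apply: (emeasurable_fun_cvg (fun n w => (a (grid n (J n w)))%:E)) => [n|w _].
  exact: measurable_law_step.
exact: law_cvg.
Qed.

Let measurable_sample_lim :
  measurable_fun setT (fun w => (\1_[set w | A (L w) w] w : R)%:E).
Proof.
apply: (emeasurable_fun_cvg (fun n w => (\1_(A (grid n (J n w))) w)%:E)) => [n|w _].
  exact: measurable_sample_step.
exact: sample_cvg.
Qed.

Lemma measurable_sample_random_time : measurable [set w | A (L w) w].
Proof.
have /measurable_EFinP := measurable_sample_lim.
move=> /(_ measurableT [set 1] (measurable_set1 _)); rewrite setTI.
congr (measurable _); apply/seteqP; split => w; rewrite /= indicE.
  by case: (boolP (w \in _)); rewrite ?inE// => _ /esym/eqP; rewrite oner_eq0.
by move=> Aw; rewrite mem_set.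
Qed.

(** On the grid the identity is independence summed over the index. Both sides pass to the limit by
    dominated convergence with bound [1]: the indicators by right continuity of the sample, the laws
    by that of [a]. *)
Lemma sample_random_time : (P [set w | A (L w) w] = \int[P]_w (a (L w))%:E)%E.
Proof.
have i1 : P.-integrable setT (cst 1%E) by exact: finite_measure_integrable_cst.
have [|||| _ _ H1] := @dominated_convergence _ _ _ P setT measurableT
  (fun n w => (\1_(A (grid n (J n w))) w)%:E) (fun w => (\1_[set w | A (L w) w] w)%:E)
  (cst 1%E) measurable_sample_step.
- exact: measurable_sample_lim.
- by apply: aeW => w _; exact: sample_cvg.
- exact: i1.
- by apply: aeW => w n _; rewrite /= ger0_norm// lee_fin indicE; case: (_ \in _).
have [||| _ _ H2] := @dominated_convergence _ _ _ P setT measurableT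
  (fun n w => (a (grid n (J n w)))%:E) (fun w => (a (L w))%:E)
  (cst 1%E) measurable_law_step measurable_law_random_time.
- by apply: aeW => w _; exact: law_cvg.
- exact: i1.
- by apply: aeW => w n _; rewrite /= ger0_norm ?a_ge0// lee_fin a_le1.
rewrite -[LHS](_ : (\int[P]_w (\1_[set w | A (L w) w] w)%:E = _)%E); last first.
  by rewrite integral_indic ?setIT//; exact: measurable_sample_random_time.
apply: (cvg_unique _ H1); rewrite //=.
by under eq_fun do rewrite integral_step.
Qed.

End Sampling.
End RandomTime.

(** * The inverse subordinator as an independent random time *)

Section InverseSubordinator.
Context {d : measure_display} {T : measurableType d} {R : realType}.
Variables (P : probability T R) (nu : R) (sigma : R -> {RV P >-> R}).
Hypothesis nu_gt0 : 0 < nu.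
Hypothesis Hsigma : stable_subordinator nu sigma.
Local Notation mu := (@lebesgue_measure R).
Local Notation Rpos := (`[0%R, +oo[%classic : set R).
Variable t : R.
Hypothesis t_ge0 : 0 <= t.
Local Notation L := (inverse_subordinator sigma t).
Let grid n j : R := j%:R / 2 ^+ n.

Let grid_ge0 n j : 0 <= grid n j.
Proof. by rewrite divr_ge0// exprn_ge0. Qed.

Let sig_nd w s u : 0 <= s -> s <= u -> sigma s w <= sigma u w.
Proof. exact: (subordinator_nondecreasing Hsigma). Qed.

Let passage w := [set s : R | 0 <= s /\ t < sigma s w].

Let LE w : L w = inf (passage w). Proof. by []. Qed.

Let passage_lb w : has_lbound (passage w).
Proof. by exists 0 => s []. Qed.

Lemma inverse_subordinator_ge0 w : 0 <= L w.
Proof.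
rewrite LE; have [->|/set0P ne] := eqVneq (passage w) set0; first by rewrite inf0.
by apply: lb_le_inf => // s [].
Qed.

Lemma inverse_subordinator_le w s : 0 <= s -> t < sigma s w -> L w <= s.
Proof. by move=> s0 ts; rewrite LE; apply: ge_inf. Qed.

Lemma inverse_subordinator_ge w s u : 0 <= s -> sigma s w <= t ->
  t < sigma u w -> 0 <= u -> s <= L w.
Proof.
move=> s0 st tu u0; rewrite LE; apply: lb_le_inf; first by exists u.
move=> r [r0 tr]; rewrite leNgt; apply/negP => rs.
by have := sig_nd w r0 (ltW rs); rewrite leNgt (le_lt_trans st).
Qed.

(** The default [0] is unambiguous: [sigma 0 w = 0 <= t], so a genuine passage above [t] has a
    positive index. *)
Definition first_index (n : nat) (w : T) : nat :=
  if pselect (exists j, t < sigma (grid n j) w) is left h then ex_minn h else 0%N.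

Lemma first_indexP n w j : first_index n w = j <->
  if j is i.+1 then sigma (grid n i) w <= t /\ t < sigma (grid n j) w
  else forall i, sigma (grid n i) w <= t.
Proof.
rewrite /first_index; case: pselect => [h|h]; last first.
  have {}h i : sigma (grid n i) w <= t.
    by rewrite leNgt; apply/negP => ti; apply: h; exists i.
  split=> [<-//|]; case: j => // j [_]; by rewrite ltNge h.
case: ex_minnP => m tm mmin; split=> [<-|].
  case: m tm mmin => [|m] tm mmin.
    by move: tm; rewrite /grid mul0r (subordinator_0 Hsigma) ltNge t_ge0.
  split=> //; rewrite leNgt; apply/negP => /mmin; by rewrite ltnn.
case: j => [H|j [jt tj]]; first by move: tm; rewrite ltNge H.
apply/eqP; rewrite eqn_leq mmin//= ltnNge; apply/negP => mj.
have : sigma (grid n m) w <= sigma (grid n j) w.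
  by apply: sig_nd => //; rewrite ler_pM2r ?invr_gt0 ?exprn_gt0// ler_nat.
by rewrite leNgt (le_lt_trans jt).
Qed.

Lemma first_index_bounds n w :
  L w <= grid n (first_index n w) <= L w + (2 ^+ n)^-1.
Proof.
have p2 : 0 < 2 ^+ n :> R by rewrite exprn_gt0.
case E : (first_index n w) (first_indexP n w (first_index n w)) => [|j] [+ _].
  move=> /(_ erefl) H.
  (* Monotonicity extends the bound from the grid to all times, and [inf] of the empty set is [0],
     the grid time of index [0]. *)
  have P0 : passage w = set0.
    rewrite -subset0 => s [s0 ts]; have := H (Num.truncn (s * 2 ^+ n)).+1.
    rewrite leNgt => /negP; apply; apply: lt_le_trans ts _; apply: sig_nd => //.
    by rewrite /grid ler_pdivlMr// ltW// Num.Theory.truncnS_gt.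
  by rewrite LE P0 inf0 /grid mul0r lexx add0r invr_ge0 ltW.
move=> /(_ erefl)[jt tj]; apply/andP; split; first exact: inverse_subordinator_le.
rewrite /grid -natr1 mulrDl mul1r lerD2r.
exact: (inverse_subordinator_ge _ _ tj).
Qed.

(** Membership in the sigma-algebra of [sigma], and not just measurability, is what independence of
    the two processes asks for. *)
Lemma first_index_process_sigma n j :
  process_sigma_algebra sigma [set w | first_index n w = j].
Proof.
pose G := \bigcup_(u in `[0, +oo[) preimage_set_system setT (sigma u) measurable.
have sle u s : 0 <= u -> @measurable _ (g_sigma_algebraType G) [set w | sigma u w <= s].
  move=> u0; apply: sub_sigma_algebra; exists u; first by rewrite /= in_itv/= u0.
  exists `]-oo, s]%classic; first exact: measurable_itv.
  by rewrite setTI; apply/seteqP; split => w; rewrite /= in_itv.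
have mJ : @measurable _ (g_sigma_algebraType G) [set w | first_index n w = j].
  case: j => [|j].
    rewrite (_ : [set w | _] = \bigcap_i [set w | sigma (grid n i) w <= t]).
      by apply: bigcapT_measurable => i; exact: sle.
    apply/seteqP; split => w /=; first by move=> /first_indexP H i _; exact: H.
    by move=> H; apply/first_indexP => i; exact: H.
  rewrite (_ : [set w | _] = [set w | sigma (grid n j) w <= t] `&`
      ~` [set w | sigma (grid n j.+1) w <= t]).
    by apply: (@measurableI _ (g_sigma_algebraType G)); [exact: sle|apply: measurableC; exact: sle].
  apply/seteqP; split => w /=.
    by move=> /first_indexP[? ?]; split=> //; apply/negP; rewrite -ltNge.
  by move=> [? /negP]; rewrite -ltNge => ?; apply/first_indexP.
exact: mJ.
Qed.

Lemma process_sigma_measurable d' (E : measurableType d') (X : R -> {RV P >-> E}) A :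
  process_sigma_algebra X A -> measurable A.
Proof.
apply: smallest_sub; first exact: sigma_algebra_measurable.
move=> B [u _ [C mC <-]]; exact: measurable_funPT.
Qed.

Lemma measurable_first_index n j : measurable [set w | first_index n w = j].
Proof. exact: process_sigma_measurable (first_index_process_sigma n j). Qed.

Lemma measurable_inverse_subordinator : measurable_fun setT L.
Proof.
apply: (@measurable_random_time _ _ _ _ first_index).
- exact: first_index_bounds.
- exact: measurable_first_index.
Qed.

(** By monotonicity these are the paths that never exceed [t], on which [inverse_subordinator] takes
    its default value. *)
Definition bounded_paths : set T := [set w | forall m : nat, sigma m%:R w <= t].

(** Chernoff's bound with [v = 1] is [exp (t - m)] at time [m]. *)
Lemma bounded_paths_null : measurable bounded_paths /\ P bounded_paths = 0%E.
Proof.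
have mB : measurable bounded_paths.
  rewrite (_ : bounded_paths = \bigcap_m [set w | sigma m%:R w <= t]).
    apply: bigcapT_measurable => m.
    have := measurable_funPT (sigma m%:R) measurableT _ (measurable_itv `]-oo, t]).
    by rewrite setTI; congr (measurable _); apply/seteqP; split => w; rewrite /= in_itv.
  by apply/seteqP; split => w /= H m; [move=> _|]; exact: H.
split=> //; apply/eqP; rewrite eq_le measure_ge0 andbT.
have H m : (P bounded_paths <= (expR t * expR (-1) ^+ m)%:E)%E.
  have m0 : 0 <= m%:R :> R by [].
  have := subordinator_chernoff Hsigma t m0 ltr01.
  rewrite mul1r powR1 mulr1 -(mulrN1 m%:R) expRM_natl; apply: le_trans.
  apply: le_measure; rewrite ?inE//; first exact: measurable_subordinator_le.
  by move=> w /= wB; rewrite /subordinator_le/= max_l.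
have Pfin : P bounded_paths \is a fin_num by exact: fin_num_measure.
rewrite -(fineK Pfin) lee_fin.
have C : expR t * expR (-1) ^+ m @[m --> \oo] --> (0 : R).
  rewrite -[X in _ --> X](mulr0 (expR t)); apply: cvgM; first exact: cvg_cst.
  by apply: cvg_expr; rewrite ger0_norm ?expR_ge0// -expR0 ltr_expR oppr_lt0.
apply: (cvgr_to_ge C); near=> m; by rewrite -lee_fin fineK.
Unshelve. all: by end_near. Qed.

(** The conditions [s < L w] and [sigma s w <= t] can thus differ only at [s = L w], a null set of
    times. *)
Lemma inverse_subordinator_passage w s : ~ bounded_paths w -> 0 <= s ->
  (s < L w -> sigma s w <= t) /\ (sigma s w <= t -> s <= L w).
Proof.
move=> wB s0; split=> [sL|st].
  rewrite leNgt; apply/negP => ts.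
  by have := inverse_subordinator_le s0 ts; rewrite leNgt sL.
have [m tm] : exists m : nat, t < sigma m%:R w.
  apply: contrapT => H; apply: wB => m; rewrite leNgt; apply/negP => tm.
  by apply: H; exists m.
exact: (inverse_subordinator_ge s0 st tm).
Qed.

(** For almost every path [Phi (L w)] is the integral of [phi] over the times with [sigma s w <= t];
    Tonelli exchanges this integral with the expectation. *)
Lemma expectation_occupation (phi Phi : R -> R) :
  measurable_fun setT phi -> measurable_fun setT Phi ->
  (forall s : R, 0 <= s -> 0 <= phi s) ->
  (forall u : R, 0 <= u -> 0 <= Phi u) ->
  (forall u : R, 0 <= u ->
    (\int[mu]_(s in `[0%R, u]) (phi s)%:E = (Phi u)%:E)%E) ->
  (\int[P]_w (Phi (L w))%:E = occupation sigma phi t)%E.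
Proof.
move=> mphi mPhi phi0 Phi0 intphi.
pose phiR (s : R) : R := (0 <= s)%R%:R * phi s.
have phiR0 s : 0 <= phiR s.
  by rewrite /phiR; have [s0|_] := leP 0 s; rewrite ?mul0r ?mul1r ?phi0.
have mphiR : measurable_fun setT phiR.
  apply: measurable_funM => //.
  by apply/measurable_EFinP; exact: measurable_half_line.
have mS : measurable_fun setT (fun z : R * T => (sigma (Num.max z.1 0) z.2 <= t)%R).
  by apply: measurable_fun_ler => //; exact: (measurable_subordinator2 Hsigma).
pose b (z : R * T) : R := (sigma (Num.max z.1 0) z.2 <= t)%R%:R.
have mb : measurable_fun setT b.
  by apply: (measurableT_comp (f := fun x : bool => x%:R : R)).
pose f (z : R * T) : \bar R := ((phiR z.1)%:E * (b z)%:E)%E.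
have b0 z : 0 <= b z by [].
have f0 z : (0 <= f z)%E by rewrite mule_ge0 ?lee_fin.
have mf : measurable_fun setT f.
  apply: emeasurable_funM; apply/measurable_EFinP => //.
  exact: (measurableT_comp (f := phiR)).
have msec w : measurable_fun setT (fun s => f (s, w)).
  by apply: (measurableT_comp (f := f)) => //; apply/measurable_fun_pair.
have mE : measurable_fun setT (EFin \o phi) by apply/measurable_EFinP.
have [mB PB0] := bounded_paths_null.
transitivity (\int[P]_w \int[mu]_s f (s, w))%E.
  apply: ge0_ae_eq_integral => //.
  - apply/measurable_EFinP; apply: (measurableT_comp (f := Phi)) => //.
    exact: measurable_inverse_subordinator.
  - exact: (measurable_fun_fubini_tonelli_G (m1 := mu) f).
  - by move=> w _; rewrite lee_fin Phi0// inverse_subordinator_ge0.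
  - by move=> w _; exact: integral_ge0.
  exists bounded_paths; split=> // w /= H; apply: contrapT => wB; apply: H => _.
  have L0 := inverse_subordinator_ge0 w.
  rewrite -intphi// integral_mkcond; apply: ge0_ae_eq_integral => //.
  - have mD : measurable (`[0, L w]%classic : set R) by exact: measurable_itv.
    exact: ((measurable_restrictT _ mD).1 (measurable_funTS mE)).
  - exact: msec.
  - by move=> s _; rewrite patchE; case: ifPn => //; rewrite inE/= in_itv/= => /andP[s0 _]; rewrite lee_fin phi0.
  exists [set L w]; split=> //; first exact: lebesgue_measure_set1.
  move=> s /= H; apply: contrapT => /eqP sL; apply: H => _.
  rewrite patchE mem_setE in_itv/= /f/= /phiR /b/=.
  have [s0|s0] := leP 0 s; last by rewrite mul0r mul0e.
  rewrite ?max_l// mul1r/=.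
  have [h1 h2] := inverse_subordinator_passage wB s0.
  have [sl|ls|/eqP] := ltgtP s (L w); last by rewrite (negbTE sL).
    by rewrite h1// mule1.
  by rewrite (_ : (sigma s w <= t) = false) ?mule0//; apply/negbTE/negP => /h2; rewrite leNgt ls.
rewrite -fubini_tonelli// /occupation integral_half_line; apply: eq_integral => s _.
rewrite /f/= muleA -EFinM -/(phiR s) ge0_integralZl//; first last.
- by rewrite lee_fin; exact: phiR0.
- by move=> w _; rewrite lee_fin.
- apply/measurable_EFinP.
  apply: (measurableT_comp (f := b) (g := fun w => (s, w))); first exact: mb.
  by apply/measurable_fun_pair.
congr (_ * _)%E; rewrite -[in RHS](setIT (subordinator_le _ _ _)) -integral_indic//; last first.
  exact: measurable_subordinator_le.
apply: eq_integral => w _; rewrite /b/= indicE; congr ((_ : bool)%:R%:E).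
by apply/idP/idP; rewrite inE.
Qed.

Lemma inverse_subordinator_sampling (A : R -> set T) (a : R -> R) :
  (forall u, 0 <= u -> measurable (A u)) ->
  (forall u, 0 <= u -> P (A u) = (a u)%:E) ->
  (forall u w, 0 <= u -> \forall s \near u^'+, A s w <-> A u w) ->
  (forall u, 0 <= u -> a s @[s --> u^'+] --> a u) ->
  (forall u B, 0 <= u -> process_sigma_algebra sigma B ->
    P (A u `&` B) = (P (A u) * P B)%E) ->
  measurable [set w | A (L w) w] /\
  measurable_fun setT (fun w => (a (L w))%:E) /\
  P [set w | A (L w) w] = (\int[P]_w (a (L w))%:E)%E.
Proof.
move=> mA PA rcA rca indep.
have ind n j : P (A (grid n j) `&` [set w | first_index n w = j]) =
    (P (A (grid n j)) * P [set w | first_index n w = j])%E.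
  by apply: indep => //; exact: first_index_process_sigma.
split; first exact: (measurable_sample_random_time inverse_subordinator_ge0
  first_index_bounds measurable_first_index mA rcA).
split; first exact: (measurable_law_random_time inverse_subordinator_ge0
  first_index_bounds measurable_first_index PA rca).
exact: (sample_random_time inverse_subordinator_ge0
  first_index_bounds measurable_first_index mA PA rcA rca ind).
Qed.

End InverseSubordinator.

Section StartTime.
Context {d : measure_display} {T : measurableType d} {R : realType}.
Variables (P : probability T R) (nu : R) (sigma : R -> {RV P >-> R}).
Hypothesis nu_gt0 : 0 < nu.
Hypothesis Hsigma : stable_subordinator nu sigma.

(** For [t = 0] Chernoff's bound is [exp (- s v ^ nu)] with [v] arbitrary. Hence almost surely
    [sigma] is positive at all times [1 / m.+1], and the passage above [0] is immediate. *)
Lemma inverse_subordinator0 : exists N, [/\ measurable N, P N = 0%E &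
  forall w, ~ N w -> inverse_subordinator sigma 0 w = 0].
Proof.
pose B m : set T := [set w | sigma (m.+1%:R^-1) w <= 0].
have mB m : measurable (B m).
  have := measurable_funPT (sigma (m.+1%:R^-1)) measurableT _ (measurable_itv `]-oo, 0]).
  by rewrite setTI; congr (measurable _); apply/seteqP; split => w; rewrite /= in_itv.
have PB m : P (B m) = 0%E.
  have s0 : 0 < m.+1%:R^-1 :> R by rewrite invr_gt0.
  apply/eqP; rewrite eq_le measure_ge0 andbT.
  have H (y : R) : 0 < y -> (P (B m) <= (expR (- (m.+1%:R^-1 * y)))%:E)%E.
    move=> y0; pose v := y `^ nu^-1; have v0 : 0 < v by exact: powR_gt0.
    have vnu : v `^ nu = y by rewrite /v -powRrM mulVf ?gt_eqF// powRr1// ltW.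
    have := subordinator_chernoff Hsigma 0 (ltW s0) v0.
    rewrite vnu mulr0 expR0 mul1r; apply: le_trans; apply: le_measure; rewrite ?inE//.
      exact: measurable_subordinator_le.
    by move=> w /= wB; rewrite /subordinator_le/= max_l// ltW.
  have Pfin : P (B m) \is a fin_num by exact: fin_num_measure.
  rewrite -(fineK Pfin) lee_fin.
  have C : expR (- (m.+1%:R^-1 * y)) @[y --> +oo] --> (0 : R).
    have /= := @cvg_comp _ _ _ (fun y : R => m.+1%:R^-1 * y) (fun x => expR (- x)) _ _ _ _ (@cvgr_expR R).
    by apply; apply: gt0_cvgMry => //; exact: cvg_id.
  apply: (cvgr_to_ge C); near=> y; rewrite -lee_fin fineK//; apply: H.
  by near: y; exact: nbhs_pinfty_gt.
exists (\bigcup_m B m); split.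
- exact: bigcupT_measurable.
- apply: measure_negligible; first exact: bigcupT_measurable.
  apply: negligible_bigcup => m; by exists (B m); split; [exact: mB|exact: PB|].
move=> w wN; apply/eqP; rewrite eq_le inverse_subordinator_ge0 andbT.
have C : m.+1%:R^-1 @[m --> \oo] --> (0 : R) by exact: cvg_harmonic.
apply: (cvgr_to_ge C); near=> m; apply: inverse_subordinator_le => //.
by rewrite ltNge; apply/negP => h; apply: wN; exists m.
Unshelve. all: by end_near. Qed.

End StartTime.

(** * States of the queue as numbers of phases *)

Section QueueStates.
Variable k : nat.
Hypothesis k_ge1 : (1 <= k)%N.

(** Inverse of [queue_length] on the states: [j.+1 = k (n - 1) + s] says that [n - 1] and [s - 1]
    are quotient and remainder of [j] by [k]. *)
Definition state_of_length (i : nat) : nat * nat :=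
  if i is j.+1 then ((j %/ k).+1, (j %% k).+1) else (0, 0)%N.

Lemma state_of_length_state i : queue_states k (state_of_length i).
Proof.
case: i => [|j]; first by left.
by right; split=> //=; rewrite ltn_mod.
Qed.

Lemma queue_lengthK i : queue_length k (state_of_length i) = i.
Proof.
case: i => [//|j]; rewrite /queue_length/=.
by rewrite subn1/= addnS mulnC -divn_eq.
Qed.

Lemma state_of_lengthK x : queue_states k x -> state_of_length (queue_length k x) = x.
Proof.
case: x => n s /= [[-> ->]//|[/= n1 /andP[s1 sk]]].
rewrite /queue_length/=; case: n n1 => // n _; case: s s1 sk => // s _ sk.
rewrite /= subn1/= addnS/= mulnC divnMDl// divn_small// addn0 modnMDl modn_small//.
Qed.

Lemma eq_state_of_length j x : queue_states k x ->
  (state_of_length j == x) = (j == queue_length k x).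
Proof.
move=> Sx; apply/eqP/eqP => [<-|->]; first by rewrite queue_lengthK.
exact: state_of_lengthK.
Qed.

Lemma queue_length_eq0 x : queue_states k x -> queue_length k x = 0%N -> x = (0, 0)%N.
Proof. by move=> Sx x0; rewrite -(state_of_lengthK Sx) x0. Qed.

Lemma esum_queue_states {R : realType} (f : nat * nat -> \bar R) :
  (forall x, queue_states k x -> 0 <= f x)%E ->
  (\esum_(x in queue_states k) f x = \sum_(i <oo) f (state_of_length i))%E.
Proof.
move=> f0; rewrite nneseries_esumT; last first.
  by move=> i; apply: f0; exact: state_of_length_state.
apply: (@reindex_esum _ _ _ setT (queue_states k) state_of_length).
split.
- by move=> i _; exact: state_of_length_state.
- by move=> i j _ _ /(congr1 (queue_length k)); rewrite !queue_lengthK.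
- by move=> x Sx; exists (queue_length k x) => //; exact: state_of_lengthK.
Qed.

(** An arrival adds [k] phases; the three kinds of service transition (next phase, next customer,
    last departure) all remove one. *)
Lemma queue_rateE {R : realType} (lambda mu : R) i j :
  queue_rate lambda mu k (state_of_length i) (state_of_length j) =
  lambda * (j == i + k)%N%:R + k%:R * mu * ((0 < i)%N && (j == i.-1))%:R.
Proof.
case: i => [|i].
  rewrite /queue_rate/= (eq_state_of_length _ (x := (1, k)%N)); last first.
    by right; split=> //=; rewrite k_ge1/=.
  by rewrite /queue_length/= muln0 !add0n !mulr0 !addr0.
set n := (i %/ k)%N; set s := (i %% k)%N.
have sk : (s < k)%N by rewrite ltn_mod.
have iE : i = (k * n + s)%N by rewrite mulnC -divn_eq.
rewrite /queue_rate/= -/n -/s mulr0 add0r.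
rewrite (eq_state_of_length _ (x := (n.+2, s.+1))); last by right; split.
have -> : queue_length k (n.+2, s.+1) = (i.+1 + k)%N.
  by rewrite /queue_length/= iE; nia.
rewrite -!addrA; congr (_ + _).
case: s sk iE => [|s] sk iE.
  rewrite mulr0 add0r; case: n iE => [|n] iE.
    rewrite /= mulr0 add0r (eq_state_of_length _ (x := (0, 0)%N)); last by left.
    by rewrite iE muln0.
  rewrite /= mulr0 addr0.
  rewrite (eq_state_of_length _ (x := (n.+1, k))); last first.
    by right; split=> //=; rewrite k_ge1/=.
  have -> // : queue_length k (n.+1, k) = i by rewrite /queue_length/= iE; nia.
have -> : ((n.+1, s.+2) == (1, 1))%N = false by apply/negbTE/eqP => -[].
rewrite /= !mulr0 !addr0.
rewrite (eq_state_of_length _ (x := (n.+1, s.+1))); last by right; split=> //=; exact: ltnW.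
by have -> // : queue_length k (n.+1, s.+1) = i by rewrite /queue_length/= iE; nia.
Qed.

End QueueStates.


Section QueueRates.
Context {R : realType}.
Variables (lambda mu : R) (k : nat).
Hypotheses (lambda_gt0 : 0 < lambda) (mu_gt0 : 0 < mu) (k_ge1 : (1 <= k)%N).
Local Notation st := (state_of_length k).
Local Notation b := (k%:R * mu).

(** A fictitious jump from [0] to itself at rate [b] is cancelled by the diagonal; it gives all
    states the same total rate [lambda + b], the form matching [walk_step]. *)
Lemma rate_matrixE i j :
  rate_matrix (queue_states k) (queue_rate lambda mu k) (st i) (st j) =
  lambda * (j == i + k)%N%:R + b * (j == i.-1)%:R - (lambda + b) * (i == j)%:R.
Proof.
have b0 : 0 <= b by rewrite mulr_ge0 // ltW.
have l0 := ltW lambda_gt0.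
have qE := queue_rateE k_ge1 lambda mu.
have q0 i1 i2 : 0 <= queue_rate lambda mu k (st i1) (st i2).
  by rewrite qE addr_ge0// mulr_ge0.
rewrite /rate_matrix (eq_state_of_length k_ge1 _ (state_of_length_state k_ge1 _)) queue_lengthK.
have [<-|ij] := eqVneq i j; last first.
  rewrite qE mulr0 subr0; congr (_ + _ * (_ : bool)%:R).
  by case: i ij => [|i] //=; rewrite eq_sym => /negbTE ->.
have ik : (i == i + k)%N = false by apply/negbTE; lia.
rewrite ik esum_mkcondr esum_queue_states//; last first.
  move=> x Sx; case: ifP => // _; rewrite -(state_of_lengthK k_ge1 Sx) lee_fin.
  exact: q0.
rewrite (eq_eseriesr (g := fun j => ((lambda * (j == i + k)%N%:R)%:E +
    (b * ((0 < i)%N && (j == i.-1))%:R)%:E)%E)); last first.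
  move=> l _; rewrite qE; case: ifPn => // /negP; rewrite inE/= => /contrapT/eqP.
  rewrite (eq_state_of_length k_ge1 _ (state_of_length_state k_ge1 _)) queue_lengthK => /eqP ->.
  rewrite ik mulr0 add0e; case: (i) => [|m]/=; first by rewrite mulr0.
  by rewrite (_ : (m.+1 == m) = false) ?mulr0//; apply/negbTE; lia.
rewrite nneseriesD; [|by move=> l _; rewrite lee_fin mulr_ge0..].
rewrite (@nneseries_single _ _ (i + k)) ?eqxx ?mulr1; last first.
  by move=> l /negbTE ->; rewrite mulr0.
rewrite (@nneseries_single _ _ i.-1) ?eqxx ?andbT; last first.
  by move=> l /negbTE ->; rewrite andbF mulr0.
rewrite /= mulr0 add0r; case: (i) => [|m]; first by rewrite /= mulr0 mulr1; ring.
by rewrite /= (_ : (m.+1 == m) = false) ?mulr0 ?mulr1; [rewrite add0r|apply/negbTE; lia].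
Qed.

Section Transition.
Variable p : R -> nat * nat -> nat * nat -> R.
Hypothesis Hp : transition_function (queue_states k) (queue_rate lambda mu k) p.

Definition length_transition (t : R) (i j : nat) : R := p t (st i) (st j).
Local Notation pl := length_transition.

Lemma length_transition_ge0 (t : R) i j : 0 <= t -> 0 <= pl t i j.
Proof. by move=> t0; apply: (transition_ge0 Hp) => //; exact: state_of_length_state. Qed.

Lemma length_transition_sum1 (t : R) i : 0 <= t -> (\sum_(j <oo) (pl t i j)%:E = 1)%E.
Proof.
move=> t0; have Si := state_of_length_state k_ge1 i.
rewrite -(transition_sum1 Hp t0 Si) esum_queue_states// => x Sx.
by rewrite lee_fin (transition_ge0 Hp).
Qed.

Lemma length_transition0 i j : pl 0 i j = (i == j)%:R.
Proof.
rewrite /pl (transition_0 Hp); [|exact: state_of_length_state..].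
by rewrite (eq_state_of_length k_ge1 _ (state_of_length_state k_ge1 _)) queue_lengthK.
Qed.

Lemma length_transition_semigroup (s t : R) i j : 0 <= s -> 0 <= t ->
  ((pl (s + t) i j)%:E = \sum_(l <oo) (pl s i l * pl t l j)%:E)%E.
Proof.
move=> s0 t0; have S := state_of_length_state k_ge1.
rewrite /pl (transition_semigroup Hp s0 t0 (S i) (S j)) esum_queue_states// => x Sx.
by rewrite lee_fin mulr_ge0// (transition_ge0 Hp).
Qed.

Lemma length_transition_rate i j :
  ((pl h i j - (i == j)%:R) / h) @[h --> (0 : R)^'+] -->
  lambda * (j == i + k)%N%:R + b * (j == i.-1)%:R - (lambda + b) * (i == j)%:R.
Proof.
have S := state_of_length_state k_ge1.
have := transition_rate Hp (S i) (S j); rewrite rate_matrixE.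
by rewrite (eq_state_of_length k_ge1 _ (S _)) queue_lengthK.
Qed.

Lemma length_transition_right_continuous (u : R) i j : 0 <= u ->
  pl s i j @[s --> u^'+] --> pl u i j.
Proof.
move=> u0; have C := cvg_chain_diag length_transition_rate i.
apply/cvgrPdist_le => e e0.
have [d /= d0 Hd] : \forall h \near (0 : R)^'+, `|1 - pl h i i| <= e.
  by move/cvgrPdist_le : C; apply.
exists d => //= s us lts; have h0 : 0 < s - u by rewrite subr_gt0.
have := chain_modulus length_transition_ge0 length_transition_sum1
  length_transition_semigroup i j u0 (ltW h0).
rewrite [u + _]addrC subrK distrC => /le_trans; apply; apply: le_trans (ler_norm _) _.
by apply: Hd => //=; rewrite sub0r normrN gtr0_norm// -(gtr0_norm h0) distrC.
Qed.

End Transition.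
End QueueRates.

(** * The fractional queue *)

Section FractionalQueue.
Context {d : measure_display} {T : measurableType d} {R : realType}.
Variables (P : probability T R) (lambda mu nu : R) (k : nat).
Variables (Q : R -> {RV P >-> (nat * nat)%type}) (sigma : R -> {RV P >-> R}).
Hypotheses (lambda_gt0 : 0 < lambda) (mu_gt0 : 0 < mu) (k_ge1 : (1 <= k)%N).
Hypothesis nu_gt0 : 0 < nu.
Hypothesis HQ : classical_queue lambda mu k Q.
Hypothesis Hsigma : stable_subordinator nu sigma.
Local Notation st := (state_of_length k).
Local Notation empty0 := [set w | Q 0 w = (0, 0)%N].

Lemma classical_queue_event (u : R) x : 0 <= u ->
  process_sigma_algebra Q [set w | Q u w = x].
Proof.
move=> u0; apply: sub_sigma_algebra; exists u; first by rewrite /= in_itv/= u0.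
exists [set x]; last by rewrite setTI.
case: x => m n; rewrite (_ : [set _] = [set m] `*` [set n]); first exact: measurableX.
by apply/seteqP; split => -[x y]/= [-> ->].
Qed.

Lemma measurable_classical_queue_event (u : R) x : 0 <= u ->
  measurable [set w | Q u w = x].
Proof. by move=> u0; apply: (process_sigma_measurable (X := Q)); exact: classical_queue_event. Qed.

Lemma measurable_fractional_state (t : R) x : 0 <= t ->
  measurable [set w | fractional_state Q sigma t w = x].
Proof.
move=> t0; apply: (measurable_sample_random_time (A := fun u => [set w | Q u w = x])
  (inverse_subordinator_ge0 sigma t) (first_index_bounds Hsigma t0)
  (measurable_first_index Hsigma t0)) => [u u0|u w u0].
  exact: measurable_classical_queue_event.
by apply: filterS (ctmc_right_continuous HQ w u0) => s /= ->.
Qed.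

Lemma classical_queue_state (u : R) w : 0 <= u -> queue_states k (Q u w).
Proof. exact: (ctmc_state HQ). Qed.

(** [starts_empty] reads the queue at the random time [L(0)], which is almost surely [0]; this
    reduces the conditioning to the initial state of [Q]. *)
Lemma starts_empty_ae : measurable (starts_empty k Q sigma) /\
  {ae P, forall w, (starts_empty k Q sigma w <-> empty0 w)}.
Proof.
have E w : starts_empty k Q sigma w <-> fractional_state Q sigma 0 w = (0, 0)%N.
  rewrite /starts_empty/= /fractional_queue_length; split=> [|-> //].
  by apply: queue_length_eq0 => //; apply: classical_queue_state; exact: inverse_subordinator_ge0.
split.
  rewrite (_ : starts_empty k Q sigma = [set w | fractional_state Q sigma 0 w = (0, 0)%N]).
    exact: measurable_fractional_state.
  by apply/seteqP; split => w /E.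
have [N [mN PN HN]] := inverse_subordinator0 nu_gt0 Hsigma.
exists N; split=> // w /= H; apply: contrapT => /HN L0; apply: H.
by rewrite E /fractional_state L0.
Qed.

Lemma integral_starts_empty (f : T -> R) : (forall w, 0 <= f w) -> measurable_fun setT f ->
  (\int[P]_w (f w * \1_(starts_empty k Q sigma) w)%:E =
   \int[P]_w (f w * \1_empty0 w)%:E)%E.
Proof.
move=> f0 mf; have [mS [N [mN PN HN]]] := starts_empty_ae.
have mE := measurable_classical_queue_event (0, 0)%N (lexx (0 : R)).
have mI (A : set T) : measurable A -> measurable_fun setT (fun w => (f w * \1_A w)%:E).
  by move=> mA; apply/measurable_EFinP; apply: measurable_funM => //; exact: measurable_indic.
apply: ge0_ae_eq_integral; [exact: measurableT|exact: mI|exact: mI|..].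
- by move=> w _; rewrite lee_fin mulr_ge0.
- by move=> w _; rewrite lee_fin mulr_ge0.
exists N; split=> // w /= H; apply: HN => /= h; apply: H => _.
by congr ((_ * (_ : bool)%:R)%:E); apply/idP/idP; rewrite !inE => /h.
Qed.

Lemma fractional_queue_length_sum (t : R) w :
  ((fractional_queue_length k Q sigma t w)%:R%:E = \sum_(i <oo)
    (i%:R * \1_[set w | fractional_state Q sigma t w = st i] w)%:E :> \bar R)%E.
Proof.
have Sx : queue_states k (fractional_state Q sigma t w).
  by apply: classical_queue_state; exact: inverse_subordinator_ge0.
rewrite (@nneseries_single _ _ (fractional_queue_length k Q sigma t w)).
  by rewrite indicE mem_set ?mulr1//= state_of_lengthK.
move=> i ix; rewrite indicE memNset ?mulr0//= => xi.
by move: ix; rewrite /fractional_queue_length xi queue_lengthK eqxx.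
Qed.

Lemma measurable_fractional_queue_length (t : R) : 0 <= t ->
  measurable_fun setT (fun w => (fractional_queue_length k Q sigma t w)%:R : R).
Proof.
move=> t0; apply/measurable_EFinP; apply: (eq_measurable_fun (fun w => (\sum_(i <oo)
    (i%:R * \1_[set w | fractional_state Q sigma t w = st i] w)%:E)%E)).
  by move=> w _; rewrite -fractional_queue_length_sum.
apply: measurable_nneseries => [i w|i]; first by rewrite lee_fin mulr_ge0.
apply/measurable_EFinP; apply: measurable_funM => //; apply: measurable_indic.
exact: measurable_fractional_state.
Qed.

Hypothesis Hindep : independent_processes Q sigma.
Hypothesis Hstart : (0 < P (starts_empty k Q sigma))%E.

Lemma starts_empty_probability : P (starts_empty k Q sigma) = P empty0.
Proof.
have [mS _] := starts_empty_ae.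
have mE := measurable_classical_queue_event (0, 0)%N (lexx (0 : R)).
have := integral_starts_empty (f := cst 1) (fun=> ler01) (measurable_cst _).
under eq_integral do rewrite mul1r.
under [in X in _ = X -> _]eq_integral do rewrite mul1r.
by rewrite !integral_indic// !setIT.
Qed.

Section Transition.
Variable p : R -> nat * nat -> nat * nat -> R.
Hypothesis Hp : transition_function (queue_states k) (queue_rate lambda mu k) p.
Hypothesis Hmarkov : forall (n : nat) (t : nat -> R) (x : nat -> nat * nat), 0 <= t 0%N ->
      {homo t : i j / (i <= j)%N >-> i <= j} -> (forall i, queue_states k (x i)) ->
      P [set w | forall i, (i <= n.+1)%N -> Q (t i) w = x i] =
      (P [set w | forall i, (i <= n)%N -> Q (t i) w = x i] *
       (p (t n.+1 - t n) (x n) (x n.+1))%:E)%E.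
Local Notation pl := (length_transition k p).

Lemma queue_law_from_empty (u : R) i : 0 <= u ->
  P ([set w | Q u w = st i] `&` empty0) = (P empty0 * (pl u 0 i)%:E)%E.
Proof.
move=> u0.
have := @Hmarkov 0 (fun j => if j is 0 then 0 else u)
  (fun j => if j is 0 then (0, 0)%N else st i) (lexx _).
rewrite subr0 /= => H; rewrite /length_transition /= in H *.
rewrite (_ : _ `&` _ = [set w | forall j, (j <= 1)%N ->
  Q (if j is 0 then 0 else u) w = if j is 0 then (0, 0)%N else st i]).
  rewrite H.
  - congr (P _ * _)%E; apply/seteqP; split => w /= h; first exact: (h 0%N).
    by case.
  - by case=> [|m] [|n].
  - by case=> [|m]; [left|exact: state_of_length_state].
apply/seteqP; split => w /=; first by move=> [h1 h2] [|[|]].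
by move=> h; split; [exact: (h 1%N)|exact: (h 0%N)].
Qed.

(** The sampled event is the intersection with the initial event, of probability [P empty0] times
    the transition probability, so no conditional measure is needed; positivity of [P empty0]
    permits the division that gives measurability. *)
Lemma fractional_law_from_empty (t : R) i : 0 <= t ->
  measurable_fun setT (fun w => (pl (inverse_subordinator sigma t w) 0 i)%:E) /\
  P ([set w | fractional_state Q sigma t w = st i] `&` empty0) =
  (P empty0 * \int[P]_w (pl (inverse_subordinator sigma t w) 0 i)%:E)%E.
Proof.
move=> t0.
have mE := measurable_classical_queue_event (0, 0)%N (lexx (0 : R)).
have Pfin : P empty0 \is a fin_num by exact: fin_num_measure.
pose c := fine (P empty0); have cE : P empty0 = c%:E by rewrite fineK.
have c0 : 0 < c by rewrite -lte_fin -cE -starts_empty_probability.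
have L0 := inverse_subordinator_ge0 sigma t.
have [|||||_ [mP ->]] := @inverse_subordinator_sampling _ _ _ P nu sigma Hsigma t t0
  (fun u => [set w | Q u w = st i] `&` empty0) (fun u => c * pl u 0 i).
- by move=> u u0; apply: measurableI => //; exact: measurable_classical_queue_event.
- by move=> u u0; rewrite queue_law_from_empty// cE.
- by move=> u w u0; apply: filterS (ctmc_right_continuous HQ w u0) => s /= ->.
- move=> u u0; apply: cvgM; first exact: cvg_cst.
  exact: (length_transition_right_continuous lambda_gt0 mu_gt0 k_ge1 Hp).
- move=> u B u0 sB; apply: Hindep => //.
  by apply: (@measurableI _ (g_sigma_algebraType _)); exact: classical_queue_event.
have mp : measurable_fun setT (fun w => (pl (inverse_subordinator sigma t w) 0 i)%:E).
  apply: (eq_measurable_fun (fun w => (c^-1)%:E * (c * pl (inverse_subordinator sigma t w) 0 i)%:E)%E).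
    by move=> w _; rewrite -EFinM mulKf// gt_eqF.
  by apply: emeasurable_funM => //; exact: measurable_cst.
split=> //; rewrite cE -ge0_integralZl//.
- by move=> w _; rewrite lee_fin (length_transition_ge0 k_ge1 Hp).
- by rewrite lee_fin ltW.
Qed.

Lemma mean_queue_lengthE (t : R) : 0 <= t -> mean_queue_length P k Q sigma t =
  (\int[P]_w \sum_(i <oo) (i%:R * pl (inverse_subordinator sigma t w) 0 i)%:E)%E.
Proof.
move=> t0.
have mE := measurable_classical_queue_event (0, 0)%N (lexx (0 : R)).
have Pfin : P empty0 \is a fin_num by exact: fin_num_measure.
pose c := fine (P empty0); have cE : P empty0 = c%:E by rewrite fineK.
have c0 : 0 < c by rewrite -lte_fin -cE -starts_empty_probability.
have L0 := inverse_subordinator_ge0 sigma t.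
have p0 w i : 0 <= pl (inverse_subordinator sigma t w) 0 i.
  exact: (length_transition_ge0 k_ge1 Hp).
have mp i := (fractional_law_from_empty i t0).1.
rewrite /mean_queue_length /cond_expectation unlock starts_empty_probability -/c.
rewrite (integral_starts_empty (f := fun w =>
  (fractional_queue_length k Q sigma t w)%:R)) //; last first.
  exact: measurable_fractional_queue_length.
have mI i : measurable_fun setT (fun w => (i%:R *
    \1_([set w | fractional_state Q sigma t w = st i] `&` empty0) w)%:E).
  apply/measurable_EFinP; apply: measurable_funM => //; apply: measurable_indic.
  by apply: measurableI => //; exact: measurable_fractional_state.
transitivity ((\int[P]_w \sum_(i <oo) (i%:R *
    \1_([set w | fractional_state Q sigma t w = st i] `&` empty0) w)%:E) * (c^-1)%:E)%E.
  congr (_ * _)%E; apply: eq_integral => w _.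
  rewrite mulrC EFinM fractional_queue_length_sum -nneseriesZl; last first.
    by move=> i _; rewrite lee_fin mulr_ge0.
  apply: eq_eseriesr => i _.
  by rewrite -EFinM indicI/= mulrC mulrA.
rewrite integral_nneseries//.
have mE' i : measurable_fun setT
    (EFin \o (\1_([set w | fractional_state Q sigma t w = st i] `&` empty0) : T -> R)).
  apply/measurable_EFinP; apply: measurable_indic.
  by apply: measurableI => //; exact: measurable_fractional_state.
rewrite muleC -nneseriesZl; last first.
  by move=> i _; apply: integral_ge0 => w _; rewrite lee_fin mulr_ge0.
rewrite integral_nneseries//; last 2 first.
- move=> i; under eq_fun do rewrite EFinM.
  by apply: emeasurable_funM => //; exact: measurable_cst.
- by move=> i w _; rewrite lee_fin mulr_ge0.
apply: eq_eseriesr => i _.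
under eq_integral do rewrite EFinM.
rewrite ge0_integralZl//; last exact: mE'.
rewrite integral_indic ?setIT//; last first.
  by apply: measurableI => //; exact: measurable_fractional_state.
transitivity ((c^-1)%:E * ((i%:R)%:E *
    (c%:E * \int[P]_w (pl (inverse_subordinator sigma t w) 0 i)%:E)))%E.
  by congr (_ * (_ * _))%E; rewrite -cE; exact: (fractional_law_from_empty i t0).2.
under [in RHS]eq_integral do rewrite EFinM.
rewrite ge0_integralZl//; last by move=> w _; rewrite lee_fin.
by rewrite !muleA -!EFinM mulrAC mulVf ?mul1r// gt_eqF.
Qed.

End Transition.
End FractionalQueue.

(** * Mean queue length through occupation integrals *)

Lemma measurable_erlang_mass {R : realType} (x : R) j : 0 < x ->
  measurable_fun setT (erlang_mass x j).
Proof.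
move=> x0; apply: continuous_measurable_fun => u.
exact: (is_derive_cvg (is_derive_erlang_mass x0 j u)).
Qed.

Section MeanOccupation.
Context {d : measure_display} {T : measurableType d} {R : realType}.
Variables (P : probability T R) (lambda mu nu : R) (k : nat).
Variables (Q : R -> {RV P >-> (nat * nat)%type}) (sigma : R -> {RV P >-> R}).
Hypotheses (lambda_gt0 : 0 < lambda) (mu_gt0 : 0 < mu) (k_ge1 : (1 <= k)%N).
Hypothesis nu_gt0 : 0 < nu.
Hypothesis HQ : classical_queue lambda mu k Q.
Hypothesis Hsigma : stable_subordinator nu sigma.
Hypothesis Hindep : independent_processes Q sigma.
Hypothesis Hstart : (0 < P (starts_empty k Q sigma))%E.
Local Notation leb := (@lebesgue_measure R).
Local Notation Rpos := (`[0%R, +oo[%classic : set R).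
Local Notation b := (k%:R * mu).
Local Notation theta := (lambda + b).
Local Notation occ j t := (occupation sigma (erlang_density theta j) t).
Local Notation mean_time t := (occupation sigma (erlang_density 0 0) t).

Let b_ge0 : 0 <= b. Proof. by rewrite mulr_ge0// ltW. Qed.
Let theta_gt0 : 0 < theta. Proof. by rewrite ltr_wpDr. Qed.

Lemma erlang_density00 (s : R) : erlang_density 0 0 s = 1 :> R.
Proof. by rewrite /erlang_density expr0 divr1 mul0r oppr0 expR0 mulr1. Qed.

(** The mean identity of the classical chain at time [u], integrated at [u = L w]: the expectation
    of [L] is [mean_time t], that of [erlang_mass theta j (L w)] is [occ j t]. *)
Lemma mean_queue_length_occupation (t : R) : 0 <= t ->
  (mean_queue_length P k Q sigma t + b%:E * mean_time t =
   (lambda * k%:R)%:E * mean_time t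
   + b%:E * \sum_(j <oo) (return_weight lambda b k j)%:E * occ j t)%E.
Proof.
move=> t0; have [p Hp Hmarkov] := ctmc_markov HQ.
pose L := inverse_subordinator sigma t; have L0 := inverse_subordinator_ge0 sigma t.
have mL : measurable_fun setT (EFin \o L).
  by apply/measurable_EFinP; exact: (measurable_inverse_subordinator Hsigma t0).
have pl0 (u : R) i j : 0 <= u -> 0 <= length_transition k p u i j.
  exact: (length_transition_ge0 k_ge1 Hp).
have mass0 j w : 0 <= erlang_mass theta j (L w).
  rewrite -lee_fin -integral_erlang_density//.
  apply: integral_ge0 => s; rewrite /= in_itv/= => /andP[s0 _].
  by rewrite lee_fin erlang_density_ge0.
have w0 j : 0 <= return_weight lambda b k j.
  exact: (return_weight_ge0 k lambda_gt0 b_ge0).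
have mmass j : measurable_fun setT (fun w => (erlang_mass theta j (L w))%:E).
  apply/measurable_EFinP; apply: (measurableT_comp (f := erlang_mass theta j)).
    exact: measurable_erlang_mass.
  by exact/measurable_EFinP.
have mmean : measurable_fun setT (fun w =>
    \sum_(i <oo) (i%:R * length_transition k p (L w) 0 i)%:E)%E.
  apply: measurable_nneseries => [i w|i]; first by rewrite lee_fin mulr_ge0 ?pl0.
  under eq_fun do rewrite EFinM.
  apply: emeasurable_funM; first exact: measurable_cst.
  exact: (fractional_law_from_empty lambda_gt0 mu_gt0 k_ge1 nu_gt0 HQ Hsigma
    Hindep Hstart Hp Hmarkov i t0).1.
have timeE : (\int[P]_w (L w)%:E = mean_time t)%E.
  apply: (expectation_occupation Hsigma t0 (phi := erlang_density 0 0) (Phi := id)) => //.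
  - exact: measurable_erlang_density.
  - by move=> s _; rewrite erlang_density00.
  - move=> u u0; under eq_integral do rewrite erlang_density00.
    rewrite integral_cst//= mul1e lebesgue_measure_itv/= lte_fin.
    by move: u0; rewrite le_eqVlt => /predU1P[<-|->]; rewrite ?ltxx ?oppr0 ?adde0 ?sube0.
have massE j : (\int[P]_w (erlang_mass theta j (L w))%:E = occ j t)%E.
  apply: (expectation_occupation Hsigma t0 (Phi := erlang_mass theta j)) => //.
  - exact: measurable_erlang_density.
  - exact: measurable_erlang_mass.
  - by move=> s s0; exact: erlang_density_ge0.
  - move=> u u0; rewrite -lee_fin -integral_erlang_density//.
    apply: integral_ge0 => s; rewrite /= in_itv/= => /andP[s0 _].
    by rewrite lee_fin erlang_density_ge0.
  - by move=> u u0; rewrite integral_erlang_density.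
have mterm j : measurable_fun setT (fun w =>
    (return_weight lambda b k j * erlang_mass theta j (L w))%:E).
  under eq_fun do rewrite EFinM.
  by apply: emeasurable_funM => //; exact: measurable_cst.
have msum : measurable_fun setT (fun w =>
    \sum_(j <oo) (return_weight lambda b k j * erlang_mass theta j (L w))%:E)%E.
  by apply: measurable_nneseries => // j w; rewrite lee_fin mulr_ge0.
transitivity (\int[P]_w (\sum_(i <oo) (i%:R * length_transition k p (L w) 0 i)%:E
    + (b * L w)%:E))%E.
  rewrite ge0_integralD//.
  - rewrite (mean_queue_lengthE lambda_gt0 mu_gt0 k_ge1 nu_gt0 HQ Hsigma
    Hindep Hstart Hp Hmarkov t0).
    congr (_ + _)%E; under [in RHS]eq_integral do rewrite EFinM.
    rewrite ge0_integralZl//; first by rewrite timeE.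
    by move=> w _; rewrite lee_fin; exact: L0.
  - by move=> w _; apply: nneseries_ge0 => i _ _; rewrite lee_fin mulr_ge0 ?pl0.
  - by move=> w _; rewrite lee_fin mulr_ge0//; exact: L0.
  - under eq_fun do rewrite EFinM.
    by apply: emeasurable_funM => //; exact: measurable_cst.
under eq_integral => w _.
  rewrite (@chain_mean _ lambda b k (length_transition k p) lambda_gt0 b_ge0 pl0
    (length_transition_sum1 k_ge1 Hp) (length_transition0 k_ge1 Hp)
    (length_transition_semigroup k_ge1 Hp)
    (length_transition_rate lambda_gt0 mu_gt0 k_ge1 Hp) (L w)); last exact: L0.
  over.
have s0 w : (0 <= \sum_(j <oo) (return_weight lambda b k j * erlang_mass theta j (L w))%:E)%E.
  by apply: nneseries_ge0 => j _ _; rewrite lee_fin mulr_ge0.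
have ak0 : 0 <= lambda * k%:R by rewrite mulr_ge0// ltW.
rewrite ge0_integralD//.
- congr (_ + _)%E.
    under eq_integral do rewrite EFinM.
    by rewrite ge0_integralZl ?timeE// => w _; rewrite lee_fin; exact: L0.
  rewrite ge0_integralZl//; congr (_ * _)%E.
  rewrite (@integral_nneseries _ _ _ P setT measurableT
    (fun j w => (return_weight lambda b k j * erlang_mass theta j (L w))%:E) mterm);
    last by move=> j w _; rewrite lee_fin; exact: mulr_ge0.
  apply: eq_eseriesr => j _; under eq_integral do rewrite EFinM.
  rewrite ge0_integralZl ?massE//; first by move=> w _; rewrite lee_fin.
  by rewrite lee_fin.
- by move=> w _; rewrite lee_fin mulr_ge0//; exact: L0.
- under eq_fun do rewrite EFinM.
  by apply: emeasurable_funM => //; exact: measurable_cst.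
- by move=> w _; rewrite mule_ge0//; exact: s0.
- by apply: emeasurable_funM => //; exact: measurable_cst.
Qed.

(** Poisson probabilities sum to [1]: the multiples [theta ^+ j] of the Erlang densities add up to
    the constant density of [mean_time]. *)
Lemma occupation_resolution (t : R) :
  (\sum_(j <oo) (theta ^+ j)%:E * occ j t = mean_time t)%E.
Proof.
transitivity (\sum_(j <oo) \int[leb]_(s in Rpos)
    ((theta ^+ j * erlang_density theta j s)%:E * P (subordinator_le sigma s t)))%E.
  apply: eq_eseriesr => j _; rewrite -ge0_integralZl//.
  - by apply: eq_integral => s _; rewrite EFinM muleA.
  - apply: measurable_funTS; apply: (measurable_occupation_integrand Hsigma).
    exact: measurable_erlang_density.
  - by move=> s; rewrite /= in_itv/= andbT => s0; rewrite mule_ge0// lee_fin erlang_density_ge0.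
  - by rewrite lee_fin exprn_ge0// ltW.
have D0 (s : R) j : 0 <= s -> 0 <= theta ^+ j * erlang_density theta j s.
  by move=> s0; rewrite mulr_ge0 ?exprn_ge0 ?erlang_density_ge0// ltW.
rewrite -integral_nneseries//.
- apply: eq_integral => s; rewrite inE/= in_itv/= andbT => s0.
  rewrite erlang_density00 mul1e.
  have /fineK <- : P (subordinator_le sigma s t) \is a fin_num.
    by rewrite fin_num_measure//; exact: measurable_subordinator_le.
  set c := fine _.
  transitivity (\sum_(j <oo) (c * expR (- (theta * s)))%:E * ((theta * s) ^+ j / j`!%:R)%:E)%E.
    apply: eq_eseriesr => j _; rewrite -!EFinM /erlang_density exprMn; congr EFin.
    ring.
  rewrite nneseriesZl; last first.
    by move=> j _; rewrite lee_fin divr_ge0// exprn_ge0// mulr_ge0// ltW.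
  by rewrite nneseries_exp -EFinM -mulrA -expRD addrC subrr expR0 mulr1.
- move=> j; apply: measurable_funTS.
  apply: (measurable_occupation_integrand Hsigma (phi := fun s => theta ^+ j * erlang_density theta j s)).
  by apply: measurable_funM => //; exact: measurable_erlang_density.
- by move=> j s; rewrite /= in_itv/= andbT => s0; rewrite mule_ge0// lee_fin D0.
Qed.

(** The return weights are at most [theta ^+ j]. The sequence [x] is general because it stands both
    for occupation integrals and for their Laplace transforms. *)
Lemma weighted_sum_fin_num (x : nat -> \bar R) : (forall j, 0 <= x j)%E ->
  (\sum_(j <oo) (theta ^+ j)%:E * x j)%E \is a fin_num ->
  (\sum_(j <oo) (return_weight lambda b k j)%:E * x j)%E \is a fin_num.
Proof.
move=> x0; have w0 j : 0 <= return_weight lambda b k j.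
  exact: (return_weight_ge0 k lambda_gt0 b_ge0).
have wx0 j : (0 <= (return_weight lambda b k j)%:E * x j)%E by rewrite mule_ge0// lee_fin.
have s0 : (0 <= \sum_(j <oo) (return_weight lambda b k j)%:E * x j)%E by exact: nneseries_ge0.
move=> /fin_numPlt/andP[_ hi]; rewrite ge0_fin_numE//; apply: le_lt_trans hi.
apply: lee_nneseries => // j _; apply: lee_wpmul2r => //.
by rewrite lee_fin; exact: (return_weight_le k lambda_gt0 b_ge0).
Qed.

Lemma mean_timeE (t : R) : 0 <= t -> mean_time t = (t `^ nu / Gamma (nu + 1))%:E.
Proof. by move=> t0; rewrite (occupation_moment nu_gt0 Hsigma)// mulr1. Qed.

Lemma occupation_weight_fin_num (t : R) : 0 <= t ->
  (\sum_(j <oo) (return_weight lambda b k j)%:E * occ j t)%E \is a fin_num.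
Proof.
move=> t0; apply: weighted_sum_fin_num.
  by move=> j; apply: occupation_ge0 => s s0; exact: erlang_density_ge0.
by rewrite occupation_resolution mean_timeE.
Qed.

(** With finiteness established, the term [b * mean_time t] can be moved across. *)
Lemma mean_queue_length_explicit (t : R) : 0 <= t ->
  (mean_queue_length P k Q sigma t = (k%:R * (lambda - mu))%:E * mean_time t
   + b%:E * \sum_(j <oo) (return_weight lambda b k j)%:E * occ j t)%E.
Proof.
move=> t0; have := mean_queue_length_occupation t0.
rewrite mean_timeE// -(fineK (occupation_weight_fin_num t0)).
set o := _ / _; set s := fine _; rewrite -!EFinM => /(congr1 (fun x => x - (b * o)%:E)%E).
by rewrite addeK// => ->; rewrite -!EFinD; congr EFin; ring.
Qed.

End MeanOccupation.

Lemma eq_iterated_sum {R : realType} (f g : nat -> nat -> R) (s : R) :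
  (forall m r, (1 <= m)%N -> f m r = g m r) -> iterated_sum f s -> iterated_sum g s.
Proof.
move=> fg [a fa as_]; exists a => // m m1.
by under eq_fun do under eq_bigr do rewrite -fg//; exact: fa.
Qed.

(** * Laplace transform of the mean queue length *)

Section LaplaceMean.
Context {d : measure_display} {T : measurableType d} {R : realType}.
Variables (P : probability T R) (lambda mu nu : R) (k : nat).
Variables (Q : R -> {RV P >-> (nat * nat)%type}) (sigma : R -> {RV P >-> R}).
Hypotheses (lambda_gt0 : 0 < lambda) (mu_gt0 : 0 < mu) (k_ge1 : (1 <= k)%N).
Hypothesis nu_gt0 : 0 < nu.
Hypothesis HQ : classical_queue lambda mu k Q.
Hypothesis Hsigma : stable_subordinator nu sigma.
Hypothesis Hindep : independent_processes Q sigma.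
Hypothesis Hstart : (0 < P (starts_empty k Q sigma))%E.
Local Notation leb := (@lebesgue_measure R).
Local Notation Rpos := (`[0%R, +oo[%classic : set R).
Local Notation b := (k%:R * mu).
Local Notation theta := (lambda + b).
Local Notation occ j t := (occupation sigma (erlang_density theta j) t).
Local Notation mean_time t := (occupation sigma (erlang_density 0 0) t).

Let b_ge0 : 0 <= b. Proof. by rewrite mulr_ge0// ltW. Qed.
Let theta_gt0 : 0 < theta. Proof. by rewrite ltr_wpDr. Qed.
Let w_ge0 j : 0 <= return_weight lambda b k j.
Proof. exact: (return_weight_ge0 k lambda_gt0 b_ge0). Qed.

Let occ_ge0 (x t : R) j : (0 <= occupation sigma (erlang_density x j) t)%E.
Proof. by apply: occupation_ge0 => s s0; exact: erlang_density_ge0. Qed.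

Let measurable_occ (x : R) j : measurable_fun setT (occupation sigma (erlang_density x j)).
Proof.
apply: (measurable_occupation Hsigma); first exact: measurable_erlang_density.
by move=> s s0; exact: erlang_density_ge0.
Qed.

(** Termwise by Tonelli; general weights cover both the return weights and the powers of [theta]. *)
Let laplace_sum (w : nat -> R) (v : R) : (forall j, 0 <= w j) -> 0 < v ->
  (laplace_transform (fun t => \sum_(j <oo) (w j)%:E * occ j t) v =
   \sum_(j <oo) (w j)%:E * (v^-1 * ((theta + v `^ nu) ^+ j.+1)^-1)%:E)%E.
Proof.
move=> w0 v0; rewrite /laplace_transform.
transitivity (\int[leb]_(t in Rpos) \sum_(j <oo) ((w j)%:E * ((expR (- (v * t)))%:E * occ j t)))%E.
  apply: eq_integral => t _; rewrite -nneseriesZl.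
    by apply: eq_eseriesr => j _; rewrite muleCA.
  by move=> j _; rewrite mule_ge0 ?occ_ge0 ?lee_fin.
have mt i : measurable_fun Rpos (fun t => (expR (- (v * t)))%:E * occ i t)%E.
  apply: measurable_funTS; apply: emeasurable_funM => //.
  by apply/measurable_EFinP; exact: measurable_expRNM.
have t0 i t : (0 <= (expR (- (v * t)))%:E * occ i t)%E.
  by rewrite mule_ge0 ?occ_ge0 ?lee_fin ?expR_ge0.
rewrite integral_nneseries//.
- apply: eq_eseriesr => j _; rewrite ge0_integralZl ?lee_fin//; last exact: mt.
  by rewrite (laplace_occupation_erlang Hsigma _ (ltW theta_gt0) v0).
- by move=> i; apply: emeasurable_funM; [exact: measurable_cst|exact: mt].
- by move=> i t _; rewrite mule_ge0// lee_fin.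
Qed.

(** The additive identity is transformed, rather than the explicit formula with its coefficient
    [k (lambda - mu)] of unknown sign, so that all integrands are nonnegative. *)
Lemma laplace_mean_queue_length (v : R) : 0 < v ->
  exists2 s : R, (\sum_(j <oo) (return_weight lambda b k j *
      (v^-1 * ((theta + v `^ nu) ^+ j.+1)^-1))%:E = s%:E)%E &
    laplace_transform (mean_queue_length P k Q sigma) v =
    (k%:R * (lambda - mu) * (1 / v `^ (nu + 1)) + b * s)%:E.
Proof.
move=> v0; pose G j : R := v^-1 * ((theta + v `^ nu) ^+ j.+1)^-1.
have vnu0 : 0 < v `^ nu by exact: powR_gt0.
have G0 j : (0 <= (G j)%:E)%E.
  by rewrite lee_fin mulr_ge0 ?invr_ge0 ?exprn_ge0 ?addr_ge0// ltW.
pose o : R := 1 / v `^ (nu + 1).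
have oE : laplace_transform (fun t => mean_time t) v = o%:E.
  rewrite /laplace_transform (laplace_occupation_erlang Hsigma _ (lexx 0) v0).
  rewrite add0r expr1 /o powRD ?powRr1 ?ltW//; last by rewrite (gt_eqF v0) implybT.
  by rewrite invfM mul1r mulrC.
(* With the weights [theta ^+ j] the sum is the transform of [mean_time], hence finite. *)
have sfin : (\sum_(j <oo) (return_weight lambda b k j)%:E * (G j)%:E)%E \is a fin_num.
  apply: (weighted_sum_fin_num lambda_gt0 mu_gt0 (k := k) (x := fun j => (G j)%:E)) => //.
  have theta0 i : 0 <= theta ^+ i by rewrite exprn_ge0// ltW.
  rewrite -(laplace_sum theta0 v0) (_ : laplace_transform _ v = o%:E)// -oE.
  apply: eq_integral => t _.
  by rewrite (occupation_resolution k lambda_gt0 mu_gt0 Hsigma).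
exists (fine (\sum_(j <oo) (return_weight lambda b k j)%:E * (G j)%:E)).
  by rewrite fineK//; apply: eq_eseriesr => j _; rewrite EFinM.
set s := fine _; rewrite -/o.
have sE : laplace_transform (fun t =>
    \sum_(j <oo) (return_weight lambda b k j)%:E * occ j t)%E v = s%:E.
  by rewrite laplace_sum// -/(G _) fineK.
pose M t := mean_queue_length P k Q sigma t.
pose S t := (\sum_(j <oo) (return_weight lambda b k j)%:E * occ j t)%E.
have mS : measurable_fun setT S.
  apply: measurable_nneseries => [j t|j]; first by rewrite mule_ge0 ?lee_fin.
  by apply: emeasurable_funM => //; exact: measurable_cst.
have S0 t : (0 <= S t)%E by apply: nneseries_ge0 => j _ _; rewrite mule_ge0 ?lee_fin.
have mD : measurable Rpos by exact: measurable_itv.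
have mM : measurable_fun Rpos M.
  apply: (eq_measurable_fun (fun t => (k%:R * (lambda - mu))%:E * mean_time t + b%:E * S t)%E).
    move=> t; rewrite inE/= in_itv/= andbT => t0.
    by rewrite /M (mean_queue_length_explicit lambda_gt0 mu_gt0 k_ge1 nu_gt0 HQ Hsigma
    Hindep Hstart t0).
  apply: measurable_funTS; apply: emeasurable_funD;
    apply: emeasurable_funM => //; exact: measurable_cst.
have M0 t : (0 <= M t)%E.
  rewrite /M /mean_queue_length /cond_expectation mule_ge0 ?lee_fin ?invr_ge0 ?fine_ge0//.
  by rewrite unlock; apply: integral_ge0 => w _; rewrite lee_fin mulr_ge0.
pose e t := (expR (- (v * t)))%:E : \bar R.
have e0 t : (0 <= e t)%E by rewrite lee_fin expR_ge0.
have me : measurable_fun setT e by apply/measurable_EFinP; exact: measurable_expRNM.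
have time0 t : (0 <= mean_time t)%E by exact: occ_ge0.
have mtime : measurable_fun setT (fun t => mean_time t) by exact: measurable_occ.
have laplaceDZ (f g : R -> \bar R) (c : R) : (forall t, 0 <= f t)%E -> (forall t, 0 <= g t)%E ->
    0 <= c -> measurable_fun Rpos f -> measurable_fun Rpos g ->
    (laplace_transform (fun t => f t + c%:E * g t) v =
     laplace_transform f v + c%:E * laplace_transform g v)%E.
  move=> f0 g0 c0 mf mg; have meR : measurable_fun Rpos e by exact: measurable_funTS.
  rewrite /laplace_transform -[(c%:E * _)%E]ge0_integralZl//; last 2 first.
  - exact: emeasurable_funM.
  - by move=> t _; rewrite mule_ge0 ?e0.
  rewrite -ge0_integralD//; last 4 first.
  - by move=> t _; rewrite mule_ge0 ?e0.
  - exact: emeasurable_funM.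
  - by move=> t _; rewrite mule_ge0 ?lee_fin// mule_ge0 ?e0.
  - by apply: emeasurable_funM; [exact: measurable_cst|exact: emeasurable_funM].
  apply: eq_integral => t _; rewrite ge0_muleDr ?mule_ge0//.
  by rewrite [(c%:E * (_ * _))%E]muleCA.
have E1 := laplaceDZ M _ b M0 time0 b_ge0 mM (measurable_funTS mtime).
have ak0 : 0 <= lambda * k%:R by rewrite mulr_ge0// ltW.
have mf : measurable_fun Rpos (fun t => cst 0%E t + (lambda * k%:R)%:E * mean_time t)%E.
  apply: measurable_funTS; apply: emeasurable_funD; first exact: measurable_cst.
  by apply: emeasurable_funM => //; exact: measurable_cst.
have f0 t : (0 <= cst 0 t + (lambda * k%:R)%:E * mean_time t)%E.
  by rewrite add0e mule_ge0// lee_fin.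
have E3 := laplaceDZ _ _ b f0 S0 b_ge0 mf (measurable_funTS mS).
have E2 := laplaceDZ (cst 0%E) _ _ (fun=> lexx _) time0 ak0
  (measurable_cst _) (measurable_funTS mtime).
have L0 : laplace_transform (cst 0%E) v = 0%E.
  by rewrite /laplace_transform; apply: integral0_eq => t _; rewrite mule0.
rewrite {}E2 L0 oE sE add0e in E3; rewrite oE in E1.
have : (laplace_transform M v + b%:E * o%:E = (lambda * k%:R)%:E * o%:E + b%:E * s%:E)%E.
  rewrite -E1 -E3; apply: eq_integral => t; rewrite inE/= in_itv/= andbT => t0.
  by rewrite add0e (mean_queue_length_occupation lambda_gt0 mu_gt0 k_ge1 nu_gt0 HQ Hsigma
    Hindep Hstart t0).
rewrite -!EFinM => /(congr1 (fun x => x - (b * o)%:E)%E).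
by rewrite addeK// => ->; rewrite -!EFinD; congr EFin; ring.
Qed.

End LaplaceMean.

Theorem theorem6p2 (d : measure_display) (T : measurableType d) (R : realType)
    (P : probability T R) (lambda mu nu : R) (k : nat)
    (Q : R -> {RV P >-> (nat * nat)%type}) (sigma : R -> {RV P >-> R})
    (lambda_gt0 : 0 < lambda) (mu_gt0 : 0 < mu) (k_ge1 : (1 <= k)%N)
    (nu_gt0 : 0 < nu) (nu_lt1 : nu < 1)
    (HQ : classical_queue lambda mu k Q)
    (Hsigma : stable_subordinator nu sigma)
    (Hindep : independent_processes Q sigma)
    (Hstart : (0 < P (starts_empty k Q sigma))%E) :
  (forall t : R, 0 <= t ->
     exists2 s : R,
       iterated_sum (fun m r : nat =>
         coefC0 lambda mu k m r * t `^ (gammaM nu k m r - 1)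
         * mittag_leffler nu (gammaM nu k m r) (delta0 k m r)%:R
             (- (lambda + k%:R * mu) * t `^ nu)) s &
       mean_queue_length P k Q sigma t =
       (k%:R * (lambda - mu) * (t `^ nu / Gamma (nu + 1)) + k%:R * mu * s)%:E)
  /\
  (forall v : R, 0 < v ->
     exists2 s : R,
       iterated_sum (fun m r : nat =>
         coefC0 lambda mu k m r
         * (v `^ (nu * (delta0 k m r)%:R - gammaM nu k m r)
            / (lambda + k%:R * mu + v `^ nu) ^+ delta0 k m r)) s &
       laplace_transform (mean_queue_length P k Q sigma) v =
       (k%:R * (lambda - mu) * (1 / v `^ (nu + 1)) + k%:R * mu * s)%:E).
Proof.
have b_ge0 : 0 <= k%:R * mu by rewrite mulr_ge0// ltW.
have theta_gt0 : 0 < lambda + k%:R * mu by rewrite ltr_wpDr.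
(* The regrouped series are indexed by the number [j] of steps, while [delta0] is [j.+1]. *)
have delta_pred m r : (1 <= m)%N -> (delta0 k m r).-1.+1 = delta0 k m r.
  by move=> m1; rewrite prednK// /delta0 addn_gt0 m1.
split=> [t t0|v v0].
  pose occ j := occupation sigma (erlang_density (lambda + k%:R * mu) j) t.
  pose G j := t `^ (nu * j.+1%:R) * mittag_leffler nu (nu * j.+1%:R + 1) j.+1%:R
    (- (lambda + k%:R * mu) * t `^ nu).
  have occE j : occ j = (G j)%:E.
    exact: (occupation_mittag_leffler nu_gt0 Hsigma j (ltW theta_gt0) t0).
  have G0 j : 0 <= G j.
    by rewrite -lee_fin -occE; apply: occupation_ge0 => s s0; exact: erlang_density_ge0.
  have sfin := occupation_weight_fin_num k lambda_gt0 mu_gt0 nu_gt0 Hsigma t0.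
  exists (fine (\sum_(j <oo) (return_weight lambda (k%:R * mu) k j)%:E * occ j)%E).
    have /= H := @iterated_sum_regroup _ lambda mu k lambda_gt0 mu_gt0 G
      (fine (\sum_(j <oo) (return_weight lambda (k%:R * mu) k j)%:E * occ j)%E) G0.
    apply: eq_iterated_sum (H _) => [m r m1|].
      by rewrite /G delta_pred// /gammaM addrK mulrA.
    by rewrite fineK//; apply: eq_eseriesr => j _; rewrite occE EFinM.
  rewrite (mean_queue_length_explicit lambda_gt0 mu_gt0 k_ge1 nu_gt0 HQ Hsigma
    Hindep Hstart t0).
  rewrite (mean_timeE nu_gt0 Hsigma t0) -[X in (_ + _ * X)%E]fineK//.
have [s Hs ->] := laplace_mean_queue_length lambda_gt0 mu_gt0 k_ge1 nu_gt0 HQ Hsigma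
    Hindep Hstart v0.
exists s => //; apply: eq_iterated_sum (iterated_sum_regroup lambda_gt0 mu_gt0 _ Hs).
  (* [nu * delta0 - gammaM = -1], so the numerator is [v^-1] for all [m] and [r]. *)
  move=> m r m1; rewrite delta_pred// /gammaM opprD addNKr powRN powRr1 ?ltW//.
move=> j; apply: mulr_ge0; rewrite invr_ge0 ?(ltW v0)// exprn_ge0//.
by rewrite addr_ge0 ?powR_ge0 ?(ltW theta_gt0).
Qed.
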